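(* $F\colon M\mapsto F_M$ and $H\colon M\mapsto H_M$ are contravariant functors from $\mathcal O_0$ to the category of endofunctors on $\mathcal O_0$; $F$ is right exact and $H$ is left exact.
   Context: $\mathfrak g$ is a finite-dimensional complex semisimple Lie algebra with a fixed triangular decomposition $\mathfrak g=\mathfrak n_-\oplus\mathfrak h\oplus\mathfrak n_+$, $R_-$ the negative roots; $\lambda\leqslant\mu$ means $\lambda-\mu\in\mathbb N_0R_-$. $\mathcal O$ is the BGG category (weight $\mathfrak g$-modules finitely generated over $U(\mathfrak n_-)$), $\mathcal O_0$ its principal block, and $\restriction_0$ the projection onto the component in $\mathcal O_0$. For a weight module $M$, $M^*$ and $M^\star$ both have underlying space $\bigoplus_\lambda\mathrm{Hom}_{\mathbb C}(M_\lambda,\mathbb C)$, with action $(xf)(m)=f(-xm)$ on $M^*$ and $(xf)(m)=f(\theta(x)m)$ on $M^\star$, $\theta$ the Chevalley anti-automorphism. $M^{\leqslant\lambda}:=M/M^{\not\leqslant\lambda}$, where $M^{\not\leqslant\lambda}$ is the submodule generated by all $M_\mu$ with $\mu\not\leqslant\lambda$; this is functorial in $M$. For $M\in\mathcal O_0$, $F_M$ and $H_M$ are the left and right adjoints of $G_M\colon\mathcal O_0\to\mathcal O_0$, $G_MN=(M\otimes_{\mathbb C} N)\restriction_0$; explicitly $F_MN=(M^*\otimes N)^{\leqslant0}\restriction_0$ and $H_M=\star\circ F_{M^\star}\circ\star$. For $\phi\colon M\to K$ in $\mathcal O_0$, the natural transformation $F_\phi\colon F_K\to F_M$ is $F_\phi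 N=(\phi^*\otimes\mathrm{Id}_N)^{\leqslant0}\restriction_0$, and $H_\phi\colon H_K\to H_M$ is obtained by duality: $H_\phi=\star\circ F_{\phi^\star}\circ\star$. Exactness of sequences of endofunctors is understood pointwise (after evaluation at each $N\in\mathcal O_0$). A contravariant functor $X$ is right exact if $0\to A\to B\to C$ exact implies $X_C\to X_B\to X_A\to0$ exact, and left exact if $A\to B\to C\to0$ exact implies $0\to X_C\to X_B\to X_A$ exact. *)

(* Defs.v *)
From HB Require Import structures.
From mathcomp Require Import all_boot all_algebra generic_quotient ring_quotient.
From mathcomp Require Import boolp classical_sets functions finmap monalg.
From Stdlib Require Import Relations.

Set Implicit Arguments.
Unset Strict Implicit.
Unset Printing Implicit Defensive.

Import GRing.Theory.
Local Open Scope ring_scope.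
Local Open Scope classical_set_scope.
Local Open Scope quotient_scope.

Section Subspaces.
Variables (K : fieldType) (V : lmodType K).

Record subsp (S : submodClosed V) : predArgType :=
  Subsp { subsp_val : V; subsp_valP : subsp_val \in S }.
HB.instance Definition _ S := [isSub for @subsp_val S].
HB.instance Definition _ S := [Choice of subsp S by <:].
HB.instance Definition _ S := [SubChoice_isSubLmodule of subsp S by <:].

(* [submodClosed] does not inherit from [zmodClosed] *)
Definition zsub (S : submodClosed V) : {pred V} := S.
Lemma zsub_closed S : zmod_closed (zsub S).
Proof.
split; first exact: (rpred0 S).
by move=> u v uS vS; rewrite -scaleN1r; apply: (@rpredD _ S); rewrite ?rpredZ.
Qed.
HB.instance Definition _ S := GRing.isZmodClosed.Build V (zsub S) (zsub_closed S).

Definition quotsp (S : submodClosed V) : Type := Quotient.quot (zsub S).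
HB.instance Definition _ S := GRing.Zmodule.on (quotsp S).

Section Quot.
Variable S : submodClosed V.
Notation Q := (quotsp S).

Notation Q0 := (Quotient.quot (zsub S)).

Definition qpi (v : V) : Q := \pi_Q0 v.
Definition qrepr (u : Q) : V := repr (u : Q0).

Lemma qreprK u : qpi (qrepr u) = u.
Proof. exact: reprK. Qed.

Lemma qpi_eq v w : (qpi v = qpi w) <-> (v - w \in S).
Proof.
rewrite (Quotient.idealrBE (zsub S)).
by split=> [h|/eqP]; first exact/eqP.
Qed.

Lemma qpi_zmod : zmod_morphism qpi.
Proof. by move=> x y; rewrite /qpi; exact: raddfB. Qed.
HB.instance Definition _ := GRing.isZmodMorphism.Build V Q qpi qpi_zmod.

Definition qscale (a : K) (u : Q) : Q := qpi (a *: qrepr u).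

Lemma qscaleE a v : qscale a (qpi v) = qpi (a *: v).
Proof.
by apply/qpi_eq; rewrite -scalerBr rpredZ //; apply/qpi_eq; rewrite qreprK.
Qed.

Lemma qscaleA a b v : qscale a (qscale b v) = qscale (a * b) v.
Proof. by rewrite -[v]qreprK !qscaleE scalerA. Qed.
Lemma qscale1 : left_id 1 qscale.
Proof. by move=> v; rewrite -[v]qreprK qscaleE scale1r. Qed.
Lemma qscaleDr : right_distributive qscale +%R.
Proof.
move=> a u v; rewrite -[u]qreprK -[v]qreprK -raddfD !qscaleE -raddfD.
by rewrite scalerDr.
Qed.
Lemma qscaleDl v : {morph qscale^~ v : a b / a + b}.
Proof.
by move=> a b; rewrite -[v]qreprK !qscaleE -raddfD scalerDl.
Qed.
HB.instance Definition _ :=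
  GRing.Zmodule_isLmodule.Build K Q qscaleA qscale1 qscaleDr qscaleDl.

Lemma qpi_scale : scalable qpi.
Proof. by move=> a v; rewrite -qscaleE. Qed.
HB.instance Definition _ := GRing.isScalable.Build K V Q *:%R qpi qpi_scale.

Lemma qpi0 v : (qpi v = 0) <-> (v \in S).
Proof. by rewrite -(raddf0 qpi) qpi_eq subr0. Qed.

(* meaningful only when f is linear and vanishes on S *)
Definition qlift (W : lmodType K) (f : V -> W) (u : Q) : W := f (qrepr u).

Lemma qliftE (W : lmodType K) (f : {linear V -> W}) v :
  (forall w, w \in S -> f w = 0) -> qlift f (qpi v) = f v.
Proof.
move=> fS; apply/eqP; rewrite -subr_eq0 /qlift -linearB fS //.
by apply/qpi_eq; rewrite qreprK.
Qed.

Lemma qlift_linear (W : lmodType K) (f : {linear V -> W}) :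
  (forall w, w \in S -> f w = 0) -> linear (qlift f).
Proof.
move=> fS a u v; rewrite -[u]qreprK -[v]qreprK -linearP.
by rewrite !(qliftE _ fS) linearP.
Qed.
End Quot.

Section Span.
Variable X : set V.
Definition span_pred : {pred V} :=
  fun v => `[< forall S : submodClosed V, X `<=` [set` S] -> v \in S >].
Lemma span_closed : submod_closed span_pred.
Proof.
split; first by apply/asboolP => S _; exact: rpred0.
move=> a u v /asboolP hu /asboolP hv; apply/asboolP => S XS.
by rewrite rpredD ?rpredZ ?hu ?hv.
Qed.
HB.instance Definition _ := GRing.isSubmodClosed.Build K V span_pred span_closed.
Definition spanset : submodClosed V := span_pred.
Lemma sub_spanset : X `<=` [set` spanset].
Proof. by move=> x Xx; apply/asboolP => S; exact. Qed.

Lemma spanset_ind (P : V -> Prop) : P 0 ->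
  (forall a u v, P u -> P v -> P (a *: u + v)) -> (forall x, X x -> P x) ->
  forall v, v \in spanset -> P v.
Proof.
move=> P0 PD PX v /asboolP.
pose S : {pred V} := fun v => `[< P v >].
have Sc : submod_closed S.
  by split=> [|a u w /asboolP hu /asboolP hw]; apply/asboolP => //; apply: PD.
pose SM := GRing.isSubmodClosed.Build K V S Sc.
pose S' : submodClosed V := HB.pack S SM.
by move=> /(_ S') h; apply/asboolP/h => x /PX Px; apply/asboolP.
Qed.
End Span.
End Subspaces.


Lemma linear_0 (K : fieldType) (V W : lmodType K) (f : V -> W) :
  linear f -> f 0 = 0.
Proof. by move=> fl; have := fl (-1) 0 0; rewrite scaler0 addr0 scaleN1r addNr. Qed.

Lemma linear_comb (K : fieldType) (V W : lmodType K) (f f' : V -> W) a :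
  linear f -> linear f' -> linear (fun v => a *: f v + f' v).
Proof.
move=> fl fl' b u v; rewrite fl fl' scalerDr [in RHS]scalerDr !scalerA.
by rewrite [b * a]mulrC addrACA.
Qed.

Lemma linear_comp (K : fieldType) (U V W : lmodType K)
  (f : V -> W) (f' : U -> V) : linear f -> linear f' -> linear (f \o f').
Proof. by move=> fl fl' a u v; rewrite /= fl' fl. Qed.

Section Tensor.
Variables (K : fieldType) (V W : lmodType K).
Notation free := {malg K[[the choiceType of (V * W)%type]]}.

Definition bilin (U : lmodType K) (b : V -> W -> U) :=
  (forall w, linear (b^~ w)) /\ (forall v, linear (b v)).

Definition tens_rel : set free :=
  [set z | exists a v v' w,
     z = << (a *: v + v', w) >> - a *: << (v, w) >> - << (v', w) >>]
  `|` [set z | exists a v w w',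
     z = << (v, a *: w + w') >> - a *: << (v, w) >> - << (v, w') >>].

Definition tens : Type := quotsp (spanset tens_rel).
HB.instance Definition _ := GRing.Lmodule.on tens.

Definition tpure (v : V) (w : W) : tens := qpi (spanset tens_rel) << (v, w) >>.

Lemma tpure_bilin : bilin tpure.
Proof.
split=> [w a v v'|v a w w']; rewrite /tpure -linearP; apply/qpi_eq;
  apply: sub_spanset; rewrite opprD addrA; [left|right];
  [by exists a, v, v', w | by exists a, v, w, w'].
Qed.

Definition fext (U : lmodType K) (b : V -> W -> U) (z : free) : U :=
  \sum_(k <- msupp z) z@_k *: b k.1 k.2.

Lemma fextEw (U : lmodType K) (b : V -> W -> U) (D : {fset (V * W)%type}) z :
  fsubset (msupp z) D -> fext b z = \sum_(k <- D) z@_k *: b k.1 k.2.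
Proof.
move=> zD; rewrite /fext [RHS](big_fsetID _ [in msupp z]) /=.
rewrite [X in _ + X]big1_fset ?addr0; last first.
  by move=> k; rewrite !inE => /andP[_ kz] _; rewrite mcoeff_outdom // scale0r.
apply: eq_fbigl => k; rewrite !inE /= andbC.
by case kz: (k \in msupp z) => //=; have /= -> := fsubsetP zD _ kz.
Qed.

Lemma fext_linear (U : lmodType K) (b : V -> W -> U) : linear (fext b).
Proof.
move=> a x y; pose D := (msupp x `|` msupp y `|` msupp (a *: x + y))%fset.
rewrite !(@fextEw _ b D); try by apply/fsubsetP => k; rewrite !inE => ->; rewrite ?orbT.
rewrite scaler_sumr -big_split /=; apply: eq_bigr => k _.
by rewrite mcoeffD mcoeffZ scalerDl scalerA.
Qed.
HB.instance Definition _ (U : lmodType K) (b : V -> W -> U) :=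
  GRing.isLinear.Build K free U *:%R (@fext U b) (fext_linear b).

Lemma fextU (U : lmodType K) (b : V -> W -> U) v w :
  fext b << (v, w) >> = b v w.
Proof.
rewrite (@fextEw _ b [fset (v, w)]%fset) ?msuppU_le //.
by rewrite big_seq_fset1 mcoeffUU scale1r.
Qed.

Definition tlift (U : lmodType K) (b : V -> W -> U) : tens -> U := qlift (fext b).


Section Lift.
Variables (U : lmodType K) (b : V -> W -> U).
Hypothesis hb : bilin b.

Lemma fext_rel z : z \in spanset tens_rel -> fext b z = 0.
Proof.
have [bl br] := hb.
apply: (spanset_ind (P := fun z => fext b z = 0)); first exact: linear0.
  by move=> a u v hu hv; rewrite fext_linear hu hv scaler0 addr0.
by move=> x [] [a [v [v' [w ->]]]]; rewrite !linearB linearZ /= !fextU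
  ?bl ?br [X in X - _ - _]addrC addrK subrr.
Qed.

Lemma tliftE v w : tlift b (tpure v w) = b v w.
Proof. by rewrite /tlift qliftE; [exact: fextU | exact: fext_rel]. Qed.

Lemma tlift_linear : linear (tlift b).
Proof. by apply: qlift_linear; exact: fext_rel. Qed.
End Lift.

Lemma tens_ext (U : lmodType K) (f g : tens -> U) : linear f -> linear g ->
  (forall v w, f (tpure v w) = g (tpure v w)) -> f =1 g.
Proof.

move=> fl gl fg u; rewrite -[u]qreprK [qrepr u]monalgE.
suff: forall s : seq (V * W)%type, f (qpi _ (\sum_(k <- s) << (qrepr u)@_k *g k >>)) =
  g (qpi _ (\sum_(k <- s) << (qrepr u)@_k *g k >>)) by apply.
elim=> [|[v w] s IHs]; first by rewrite big_nil linear0 !linear_0.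
rewrite big_cons; set c := (qrepr u)@_(v, w).
have -> : << c *g (v, w) >> = c *: << (v, w) >> :> free.
  by apply/malgP => k; rewrite mcoeffZ !mcoeffU mulr_natr.
by rewrite linearP fl gl IHs; congr (_ *: _ + _); exact: fg.
Qed.
End Tensor.

Record lieAlg (K : fieldType) := LieAlg {
  lie_sort :> vectType K;
  brk : lie_sort -> lie_sort -> lie_sort;
  brk_bilin : bilin brk;
  brkxx : forall x, brk x x = 0;
  brk_jacobi : forall x y z,
    brk x (brk y z) + brk y (brk z x) + brk z (brk x y) = 0 }.

Section Lie.
Variables (K : fieldType) (g : lieAlg K).

HB.instance Definition _ (x : g) :=
  GRing.isLinear.Build K g g *:%R (brk x) ((brk_bilin g).2 x).

Lemma brkC (x y : g) : brk x y = - brk y x.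
Proof.
have [bl br] := brk_bilin g; apply/eqP; rewrite -addr_eq0; apply/eqP.
have Dl a b c : brk (a + b) c = brk a c + brk b c :> g.
  by have := bl c 1 a b; rewrite !scale1r.
have Dr a b c : brk a (b + c) = brk a b + brk a c :> g.
  by have := br a 1 b c; rewrite !scale1r.
by have := brkxx (x + y); rewrite Dl !Dr !brkxx add0r addr0.
Qed.

Record antihom := Antihom {
  anti_fun :> g -> g;
  anti_linear : linear anti_fun;
  anti_brk : forall x y, anti_fun (brk x y) = brk (anti_fun y) (anti_fun x) }.

Lemma opp_linear : linear (fun x : g => - x).
Proof. by move=> a x y; rewrite opprD scalerN. Qed.
Lemma opp_brk (x y : g) : - brk x y = brk (- y) (- x).
Proof.
have Nr a b : brk a (- b) = - brk a b :> g by exact: (linearN (brk a)).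
by rewrite Nr [brk (- y) x]brkC Nr opprK.
Qed.
Definition opp_anti : antihom := Antihom opp_linear opp_brk.

Definition ideal (I : {vspace g}) := forall x y, y \in I -> brk x y \in I.

Definition derived (U : {vspace g}) : {vspace g} :=
  <<[seq brk x y | x <- vbasis U, y <- vbasis U]>>%VS.

Definition solvable (U : {vspace g}) := exists n, iter n derived U = 0%VS.

Definition semisimple :=
  forall I : {vspace g}, ideal I -> solvable I -> I = 0%VS.

Record gmod := Gmod {
  gmod_sort :> lmodType K;
  act : g -> gmod_sort -> gmod_sort;
  act_bilin : bilin act;
  act_brk : forall x y m, act (brk x y) m = act x (act y m) - act y (act x m) }.

HB.instance Definition _ (M : gmod) (x : g) :=
  GRing.isLinear.Build K M M *:%R (act x) ((act_bilin M).2 x).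

Lemma act_linl (M : gmod) (m : M) : linear (fun x : g => act x m).
Proof. exact: (act_bilin M).1. Qed.

Record ghom (M N : gmod) := Ghom {
  ghom_fun :> M -> N;
  ghom_linear : linear ghom_fun;
  ghom_act : forall x m, ghom_fun (act x m) = act x (ghom_fun m) }.

HB.instance Definition _ (M N : gmod) (f : ghom M N) :=
  GRing.isLinear.Build K M N *:%R f (ghom_linear f).

Lemma ghom_ext (M N : gmod) (f f' : ghom M N) : f =1 f' -> f = f'.
Proof.
case: f f' => f f1 f2 [f' f1' f2'] /= /funext eqf.
by case: _ / eqf in f1' f2' *; congr Ghom; exact: Prop_irrelevance.
Qed.

Lemma id_linear (M : gmod) : linear (@id M). Proof. by []. Qed.
Definition idg (M : gmod) : ghom M M :=
  Ghom (@id_linear M) (fun _ _ => erefl).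

Section Comp.
Variables (M N P : gmod) (f : ghom N P) (f' : ghom M N).
Lemma comp_linear : linear (f \o f').
Proof. by move=> a u v; rewrite /= !linearP. Qed.
Lemma comp_act x m : (f \o f') (act x m) = act x ((f \o f') m).
Proof. by rewrite /= !ghom_act. Qed.
Definition compg : ghom M P := Ghom comp_linear comp_act.
End Comp.

Definition giso (M N : gmod) := exists f : ghom M N, bijective f.

Definition triv_act (x : g) (a : K^o) : K^o := 0.
Lemma triv_bilin : bilin triv_act.
Proof. by split=> ? ? ? ?; rewrite /triv_act scaler0 addr0. Qed.
Lemma triv_brk x y m : triv_act (brk x y) m =
  triv_act x (triv_act y m) - triv_act y (triv_act x m).
Proof. by rewrite /triv_act subr0. Qed.
Definition gtriv : gmod := Gmod triv_bilin triv_brk.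

Record submod (M : gmod) := Submod {
  submod_sub :> submodClosed M;
  submod_act : forall x m, m \in submod_sub -> act x m \in submod_sub }.

Section SubQuot.
Variables (M : gmod) (S : submod M).

Definition sub_act (x : g) (m : subsp S) : subsp S :=
  Subsp (submod_act x (subsp_valP m)).
Lemma sub_bilin : bilin sub_act.
Proof.
split=> [m a x y|x a m n]; apply: val_inj; first exact: (act_bilin M).1.
exact: (act_bilin M).2.
Qed.
Lemma sub_brk x y m :
  sub_act (brk x y) m = sub_act x (sub_act y m) - sub_act y (sub_act x m).
Proof. by apply: val_inj; rewrite /= act_brk. Qed.
Definition gsub : gmod := Gmod sub_bilin sub_brk.

Definition quot_act (x : g) : quotsp S -> quotsp S :=
  qlift (fun m => qpi S (act x m)).
Lemma quot_actE x m : quot_act x (qpi S m) = qpi S (act x m).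
Proof.
apply/qpi_eq; rewrite -linearB; apply: submod_act.
by apply/qpi_eq; rewrite qreprK.
Qed.
Lemma quot_bilin : bilin quot_act.
Proof.
split=> [u a x y|x a u v].
  by rewrite -[u]qreprK !quot_actE (act_linl (qrepr u)) linearP.
by rewrite -[u]qreprK -[v]qreprK -linearP !quot_actE !linearP.
Qed.
Lemma quot_brk x y u : quot_act (brk x y) u =
  quot_act x (quot_act y u) - quot_act y (quot_act x u).
Proof. by rewrite -[u]qreprK !quot_actE -linearB act_brk. Qed.
Definition gquot : gmod := Gmod quot_bilin quot_brk.
End SubQuot.

Section SubQuotMap.
Variables (M N : gmod) (f : ghom M N) (S : submod M) (T : submod N).
Hypothesis fS : forall m, m \in S -> f m \in T.

Definition sub_map (m : gsub S) : gsub T := Subsp (fS (subsp_valP m)).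
Lemma sub_map_linear : linear sub_map.
Proof. by move=> a u v; apply: val_inj; rewrite /= linearP. Qed.
Lemma sub_map_act x m : sub_map (act x m) = act x (sub_map m).
Proof. by apply: val_inj; rewrite /= ghom_act. Qed.
Definition gsub_map : ghom (gsub S) (gsub T) := Ghom sub_map_linear sub_map_act.

Definition quot_map : gquot S -> gquot T := qlift (fun m => qpi T (f m)).
Lemma quot_mapE m : quot_map (qpi S m) = qpi T (f m).
Proof.
apply/qpi_eq; rewrite -linearB; apply: fS.
by apply/qpi_eq; rewrite qreprK.
Qed.
Lemma quot_map_linear : linear quot_map.
Proof.
move=> a u v; rewrite -[u]qreprK -[v]qreprK -linearP !quot_mapE.
by rewrite !linearP.
Qed.
Lemma quot_map_act x u : quot_map (act x u) = act x (quot_map u).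
Proof. by rewrite -[u]qreprK /= quot_actE !quot_mapE ghom_act quot_actE. Qed.
Definition gquot_map : ghom (gquot S) (gquot T) :=
  Ghom quot_map_linear quot_map_act.
End SubQuotMap.

Section Generated.
Variables (M : gmod) (X : set M).
Definition gen_pred : {pred M} :=
  fun m => `[< forall S : submod M, X `<=` [set` S] -> m \in S >].
Lemma gen_closed : submod_closed gen_pred.
Proof.
split; first by apply/asboolP => S _; exact: rpred0.
move=> a u v /asboolP hu /asboolP hv; apply/asboolP => S XS.
by rewrite rpredD ?rpredZ ?hu ?hv.
Qed.
HB.instance Definition _ := GRing.isSubmodClosed.Build K M gen_pred gen_closed.
Lemma gen_act x m : m \in gen_pred -> act x m \in gen_pred.
Proof.
by move=> /asboolP hm; apply/asboolP => S XS; apply: submod_act; exact: hm.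
Qed.
Definition gen_submod : submod M := @Submod M gen_pred gen_act.
Lemma sub_gen : X `<=` [set` gen_submod].
Proof. by move=> x Xx; apply/asboolP => S; exact. Qed.
End Generated.

Section Preimage.
Variables (V W : lmodType K) (f : {linear V -> W}) (T : submodClosed W).
Definition pre_pred : {pred V} := fun m => f m \in T.
Lemma pre_closed : submod_closed pre_pred.
Proof.
split; first by rewrite unfold_in /pre_pred linear0 rpred0.
by move=> a u v hu hv; rewrite unfold_in /pre_pred linearP rpredD ?rpredZ.
Qed.
HB.instance Definition _ := GRing.isSubmodClosed.Build K V pre_pred pre_closed.
Definition presp : submodClosed V := pre_pred.
End Preimage.

Lemma pre_act (M N : gmod) (f : ghom M N) (T : submod N) x m :
  m \in presp f T -> act x m \in presp f T.
Proof. by rewrite !unfold_in /pre_pred /= ghom_act; exact: submod_act. Qed.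
Definition pre_submod (M N : gmod) (f : ghom M N) (T : submod N) : submod M :=
  Submod (@pre_act M N f T).

Section Image.
Variables (M N : gmod) (f : ghom M N) (S : submod M).
Definition img_pred : {pred N} := fun n => `[< exists2 m, m \in S & n = f m >].
Lemma img_closed : submod_closed img_pred.
Proof.
split; first by apply/asboolP; exists 0; rewrite ?rpred0 ?linear0.
move=> a u v /asboolP[m mS ->] /asboolP[m' mS' ->]; apply/asboolP.
by exists (a *: m + m'); rewrite ?linearP ?rpredD ?rpredZ.
Qed.
HB.instance Definition _ := GRing.isSubmodClosed.Build K N img_pred img_closed.
Lemma img_act x n : n \in img_pred -> act x n \in img_pred.
Proof.
move=> /asboolP[m mS ->]; apply/asboolP.
by exists (act x m); rewrite ?ghom_act ?submod_act.
Qed.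
Definition img_submod : submod N := @Submod N img_pred img_act.
Lemma img_mem m : m \in S -> f m \in img_submod.
Proof. by move=> mS; apply/asboolP; exists m. Qed.
End Image.

Lemma gen_submod_map (M N : gmod) (f : ghom M N) (X : set M) (Y : set N) :
  (forall m, X m -> Y (f m)) ->
  forall m, m \in gen_submod X -> f m \in gen_submod Y.
Proof.
move=> XY m /asboolP /(_ (pre_submod f (gen_submod Y))); apply=> y /XY.
exact: sub_gen.
Qed.

Section GTensor.
Variables M N : gmod.

Definition tens_act_pure (x : g) (m : M) (n : N) : tens M N :=
  tpure (act x m) n + tpure m (act x n).
Lemma tens_act_pure_bilin x : bilin (tens_act_pure x).
Proof.
have [tl tr] := @tpure_bilin K M N.
split=> [n a m m'|m a n n']; rewrite /tens_act_pure linearP ?tl ?tr /=.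
  by rewrite scalerDr addrACA.
by rewrite scalerDr addrACA.
Qed.
Definition tens_act (x : g) : tens M N -> tens M N := tlift (tens_act_pure x).
Lemma tens_actE x m n :
  tens_act x (tpure m n) = tpure (act x m) n + tpure m (act x n).
Proof. exact: (tliftE (tens_act_pure_bilin x)). Qed.
Lemma tens_act_linear x : linear (tens_act x).
Proof. exact: tlift_linear (tens_act_pure_bilin x). Qed.
HB.instance Definition _ x :=
  GRing.isLinear.Build K _ _ *:%R (tens_act x) (tens_act_linear x).

Lemma tens_bilin : bilin tens_act.
Proof.
have [tl tr] := @tpure_bilin K M N.
split; last exact: tens_act_linear.
move=> u a x y.
apply: (tens_ext (f := tens_act (a *: x + y))
  (g := fun u => a *: tens_act x u + tens_act y u)) => [||m n].
- exact: tens_act_linear.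
- by apply: linear_comb; exact: tens_act_linear.
- by rewrite !tens_actE !act_linl tl tr scalerDr addrACA.
Qed.
Lemma tens_brk x y u :
  tens_act (brk x y) u = tens_act x (tens_act y u) - tens_act y (tens_act x u).
Proof.
have [tl tr] := @tpure_bilin K M N.
have tlB m m' n : tpure (m - m') n = tpure m n - tpure m' n :> tens M N.
  by rewrite [m - m']addrC -scaleN1r tl scaleN1r addrC.
have trB m n n' : tpure m (n - n') = tpure m n - tpure m n' :> tens M N.
  by rewrite [n - n']addrC -scaleN1r tr scaleN1r addrC.
have tD z v w : tens_act z (v + w) = tens_act z v + tens_act z w.
  by have := tens_act_linear z 1 v w; rewrite !scale1r.
have -> : tens_act x (tens_act y u) - tens_act y (tens_act x u) =
          -1 *: tens_act y (tens_act x u) + tens_act x (tens_act y u).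
  by rewrite scaleN1r addrC.
apply: (tens_ext (f := tens_act (brk x y))
  (g := fun u => -1 *: (tens_act y \o tens_act x) u + (tens_act x \o tens_act y) u))
  => [||m n].
- exact: tens_act_linear.
- by apply: linear_comb; apply: linear_comp; exact: tens_act_linear.
- rewrite /= !tens_actE !tD !tens_actE !act_brk tlB trB scaleN1r !opprD.
  set A := tpure (act x (act y m)) n; set B := tpure (act y (act x m)) n.
  set C := tpure m (act x (act y n)); set D := tpure m (act y (act x n)).
  set E := tpure (act x m) (act y n); set F := tpure (act y m) (act x n).
  move: A B C D E F => A B C D E F.
  rewrite [- B - E + _]addrACA.
  rewrite [RHS](AC ((2*2)*(2*2)) ((5*1)*(8*4)*((2*6)*(3*7)))) /=.
  by rewrite !addNr !addr0.
Qed.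
Definition gtens : gmod := Gmod tens_bilin tens_brk.
End GTensor.

Section GTensorMap.
Variables (M N M' N' : gmod) (f : ghom M M') (f' : ghom N N').
Definition tens_map_pure (m : M) (n : N) : tens M' N' := tpure (f m) (f' n).
Lemma tens_map_pure_bilin : bilin tens_map_pure.
Proof.
have [tl tr] := @tpure_bilin K M' N'.
by split=> [n a m m'|m a n n']; rewrite /tens_map_pure linearP ?tl ?tr.
Qed.
Definition tens_map : gtens M N -> gtens M' N' := tlift tens_map_pure.
Lemma tens_mapE m n : tens_map (tpure m n) = tpure (f m) (f' n).
Proof. exact: (tliftE tens_map_pure_bilin). Qed.
Lemma tens_map_linear : linear tens_map.
Proof. exact: tlift_linear tens_map_pure_bilin. Qed.
Lemma tens_map_act x u : tens_map (act x u) = act x (tens_map u).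
Proof.
apply: (tens_ext (f := tens_map \o tens_act x)
  (g := @tens_act M' N' x \o tens_map)) => [a v w|a v w|m n] /=.
- by rewrite tens_act_linear tens_map_linear.
- by rewrite tens_map_linear tens_act_linear.
have tD v w : tens_map (v + w) = tens_map v + tens_map w.
  by have := tens_map_linear 1 v w; rewrite !scale1r.
by rewrite tens_actE !tens_mapE tens_actE tD !tens_mapE !ghom_act.
Qed.
Definition gtens_map : ghom (gtens M N) (gtens M' N') :=
  Ghom tens_map_linear tens_map_act.
End GTensorMap.
End Lie.

Section Roots.
Variables (K : fieldType) (g : lieAlg K) (h : {vspace g}).

Definition weight := 'Hom(subvs_of h, K^o).
HB.instance Definition _ := Vector.on weight.

Definition wspace (M : gmod g) (a : weight) : set M :=
  [set m | forall t : subvs_of h, act (vsval t) m = a t *: m].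

Definition rspace (a : weight) : {vspace g} :=
  (\bigcap_(t <- vbasis {:subvs_of h})
     lker (linfun (brk (vsval t)) - a t *: \1)%VF)%VS.

Lemma rspaceP (a : weight) (x : g) : reflect
  (forall t : subvs_of h, brk (vsval t) x = a t *: x) (x \in rspace a).
Proof.
have E t : (x \in lker (linfun (brk (vsval t)) - a t *: \1)%VF) =
    (brk (vsval t) x == a t *: x).
  by rewrite memv_ker add_lfunE opp_lfunE scale_lfunE id_lfunE lfunE subr_eq0.
apply: (iffP idP) => [|hx].
- rewrite /rspace (big_nth 0) big_mkord => /subv_bigcapP hx t.
  have {}hx (i : 'I_(size (vbasis {:subvs_of h}))) :
      brk (vsval (vbasis {:subvs_of h})`_i) x = a (vbasis {:subvs_of h})`_i *: x.
    by apply/eqP; rewrite -E memvE; exact: hx.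
  have bl := (brk_bilin g).1 x.
  have b0 : brk 0 x = 0 :> g.
    exact: (linear_0 bl).
  rewrite (coord_vbasis (memvf t)); elim/big_ind: _ => [|u v hu hv|i _].
  + by rewrite !linear0 b0 scale0r.
  + by rewrite !linearD /= -[vsval u]scale1r bl scale1r hu hv scalerDl.
  + rewrite !linearZ /= -[_ *: vsval _]addr0 bl b0 addr0.
    by rewrite (hx (cast_ord (esym (size_tuple _)) i)) scalerA.
- rewrite /rspace (big_nth 0) big_mkord memvE; apply/subv_bigcapP => i _.
  by rewrite -memvE E hx.
Qed.

(* r may have repetitions, so natspan s consists of the N-linear combinations
   of elements of s *)
Definition natspan (s : seq weight) (a : weight) :=
  exists2 r : seq weight, {subset r <= s} & a = \sum_(b <- r) b.
End Roots.
Arguments wspace {K g h} M a.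

(* The last two fields make h act diagonalisably on g with zero weight space
   equal to h, so that h is a Cartan subalgebra. The roots span the dual of h when
   g is semisimple, hence simple_roots_basis. *)
Record triangular (K : fieldType) (g : lieAlg K) := Triangular {
  cartan : {vspace g};
  roots : seq (weight cartan);
  simple_roots : seq (weight cartan);
  pos_roots := [seq a <- roots | `[< natspan simple_roots a >]];
  neg_roots := [seq a <- roots | `[< natspan simple_roots (- a) >]];
  nplus : {vspace g} := (\sum_(a <- pos_roots) rspace a)%VS;
  nminus : {vspace g} := (\sum_(a <- neg_roots) rspace a)%VS;
  cartan_abelian : forall x y, x \in cartan -> y \in cartan -> brk x y = 0;
  roots_uniq : uniq roots;
  rootsP : forall a, (a \in roots) = (a != 0) && (rspace a != 0%VS);
  simple_roots_basis : basis_of {:weight cartan} simple_roots;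
  simple_roots_sub : {subset simple_roots <= roots};
  simple_roots_sign : forall a, a \in roots ->
    natspan simple_roots a \/ natspan simple_roots (- a);
  triangular_sum : (nminus + cartan + nplus)%VS = {:g}%VS;
  triangular_direct : directv (nminus + cartan + nplus)%VS }.

(* e, f and t run over Chevalley generators: t = [e, f] is the coroot of a *)
Record chevalley (K : fieldType) (g : lieAlg K) (D : triangular g) := Chevalley {
  chev_anti :> antihom g;
  chev_bij : bijective chev_anti;
  chev_cartan : forall x, x \in cartan D -> chev_anti x = x;
  chev_simple : forall a, a \in simple_roots D ->
    exists e f (t : subvs_of (cartan D)),
      [/\ e \in rspace a /\ f \in rspace (- a),
          brk e f = vsval t /\ a t = 2%:R :> K,
          chev_anti e = f & chev_anti f = e] }.

Section CategoryO.
Variables (K : fieldType) (g : lieAlg K) (D : triangular g).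
Notation wt := (weight (cartan D)).
Notation gmod := (gmod g).

Definition wle (a b : wt) := natspan (neg_roots D) (a - b).

Definition gsurj (M N : gmod) (f : ghom M N) := forall n, exists m, f m = n.
Definition exact_at (A B C : gmod) (f : ghom A B) (f' : ghom B C) :=
  forall b, f' b = 0 <-> exists a, f a = b.

Definition weight_module (M : gmod) := forall m : M, exists2 s : seq M,
  (forall v, v \in s -> exists a : wt, wspace M a v) & m = \sum_(v <- s) v.

(* finite generation over U(n_-): a U(n_-)-submodule is a subspace stable under
   n_- *)
Definition fg_nminus (M : gmod) := exists s : seq M, forall S : submodClosed M,
  (forall x m, x \in nminus D -> m \in S -> act x m \in S) ->
  {subset s <= S} -> forall m, m \in S.

Definition inO (M : gmod) := weight_module M /\ fg_nminus M.

Definition gsimple (M : gmod) := (exists m : M, m != 0) /\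
  forall S : submod M, (forall m, m \in S -> m = 0) \/ (forall m, m \in S).

Definition nonsplit_ext (L L' : gmod) :=
  exists (E : gmod) (i : ghom L E) (p : ghom E L'),
    [/\ inO E, injective i, exact_at i p, gsurj p &
        ~ exists s : ghom L' E, forall u, p (s u) = u].

(* two simple modules of O lie in the same block when they are related by the
   equivalence relation generated by isomorphism and nonvanishing of Ext^1 *)
Definition linked : gmod -> gmod -> Prop :=
  clos_refl_sym_trans gmod (fun L L' =>
    [/\ inO L, gsimple L, inO L', gsimple L' & giso L L' \/ nonsplit_ext L L']).

Definition comp_factor (L M : gmod) :=
  gsimple L /\ exists (S : submod M) (f : ghom (gsub S) L), gsurj f.

(* Modules in O have finite length, so their composition factors are their
   simple subquotients. The block is that of the trivial module. *)
Definition inO0 (M : gmod) :=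
  inO M /\ forall L, comp_factor L M -> linked (gtriv g) L.

Lemma wspace_map (M N : gmod) (f : ghom M N) (a : wt) m :
  wspace M a m -> wspace N a (f m).
Proof. by move=> hm t; rewrite -ghom_act hm linearZ. Qed.

Lemma inO0_surj (M N : gmod) (f : ghom M N) : gsurj f -> inO0 M -> inO0 N.
Proof.
move=> fs [[Mw [s sP]] ML]; split; first split.
- move=> n; have [m <-] := fs n; have [r rw ->] := Mw m.
  exists [seq f v | v <- r]; last by rewrite linear_sum big_map.
  by move=> _ /mapP[v /rw[a va] ->]; exists a; exact: wspace_map.
- exists [seq f v | v <- s] => S Sst sS n; have [m <-] := fs n.
  apply: (sP (presp f S)) => [x v xn vS|v vs].
    by rewrite unfold_in /pre_pred /= ghom_act; exact: Sst.
  by apply: sS; exact: map_f.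
- move=> L [Ls [S [p ps]]]; apply: ML; split=> //.
  pose fS := gsub_map (f := f) (S := pre_submod f S) (T := S) (fun _ h => h).
  exists (pre_submod f S), (compg p fS) => l.
  have [[n nS] <-] := ps l; have [m mn] := fs n.
  have mS : m \in pre_submod f S by rewrite unfold_in /= /pre_pred mn.
  by exists (Subsp mS); congr (p _); apply: val_inj.
Qed.

(* For M in O, the direct summand of M in O_0 is the sum of all the submodules of
   M belonging to O_0, and f maps the summand of M to that of N, so that the
   induced map is the restriction of f. *)
Definition block0_set (M : gmod) : set M :=
  [set m | exists2 S : submod M, inO0 (gsub S) & m \in S].

Definition block0 (M : gmod) : gmod := gsub (gen_submod (@block0_set M)).

Lemma block0_set_map (M N : gmod) (f : ghom M N) m :
  @block0_set M m -> @block0_set N (f m).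
Proof.
move=> [S S0 mS]; exists (img_submod f S); last exact: img_mem.
pose fS : ghom (gsub S) (gsub (img_submod f S)) :=
  gsub_map (f := f) (fun m => @img_mem _ _ M N f S m).
apply: (inO0_surj (f := fS) _ S0) => -[n nS].
have /asboolP[k kS nk] := nS.
by exists (Subsp kS); apply: val_inj.
Qed.

Definition block0_map (M N : gmod) (f : ghom M N) :
  ghom (block0 M) (block0 N) := gsub_map (gen_submod_map (block0_set_map f)).

Definition nle_set (a : wt) (M : gmod) : set M :=
  [set m | exists2 b, ~ wle b a & wspace M b m].

Definition trunc (a : wt) (M : gmod) : gmod := gquot (gen_submod (@nle_set a M)).

Lemma nle_set_map a (M N : gmod) (f : ghom M N) m :
  @nle_set a M m -> @nle_set a N (f m).
Proof. by move=> [b ba hm]; exists b => //; exact: wspace_map. Qed.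

Definition trunc_map (a : wt) (M N : gmod) (f : ghom M N) :
  ghom (trunc a M) (trunc a N) := gquot_map (gen_submod_map (@nle_set_map a M N f)).

(* the elements of the direct sum of the Hom(M_a, K) are the linear forms on M
   vanishing on all but finitely many weight spaces *)
Section Dual.
Variable s : antihom g.

Section DualModule.
Variable M : gmod.
Notation fM := [the lmodType K of M -> K^o].

Definition rdual_spec (f : M -> K^o) := linear f /\
  exists r : seq wt, forall a, a \notin r -> forall m, wspace M a m -> f m = 0.
Definition rdual_pred : {pred fM} := fun f => `[< rdual_spec f >].

Lemma rdual_comb k (f f' : M -> K^o) : rdual_spec f -> rdual_spec f' ->
  rdual_spec (fun m => k *: f m + f' m).
Proof.
move=> [fl [r hr]] [fl' [r' hr']]; split; first exact: linear_comb.
exists (r ++ r') => a; rewrite mem_cat negb_or => /andP[ar ar'] m hm.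
by rewrite (hr _ ar) // (hr' _ ar') // scaler0 addr0.
Qed.

Lemma rdual_closed : submod_closed rdual_pred.
Proof.
split.
  apply/asboolP; split; last by exists [::].
  by move=> k u v; rewrite /= scaler0 addr0.
by move=> k f f' /asboolP hf /asboolP hf'; apply/asboolP; exact: rdual_comb.
Qed.
HB.instance Definition _ :=
  GRing.isSubmodClosed.Build K fM rdual_pred rdual_closed.
Definition rdual_sub : submodClosed fM := rdual_pred.
Definition rdual : Type := subsp rdual_sub.
HB.instance Definition _ := GRing.Lmodule.on rdual.

Lemma rdual_act_root (a : wt) x (f : M -> K^o) :
  x \in rspace a -> rdual_spec f -> rdual_spec (fun m => f (act x m)).
Proof.
move=> /rspaceP xa [fl [r hr]]; split.
  by move=> k u v; rewrite linearP fl.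
exists [seq b - a | b <- r] => b br m hm; apply: (hr (b + a)).
  by apply: contra br => bar; apply/mapP; exists (b + a) => //; rewrite addrK.
move=> t; have := act_brk (vsval t) x m.
rewrite xa hm linearZ /= -[_ *: x]addr0 act_linl (linear_0 (act_linl m)) addr0.
by move/eqP; rewrite -subr_eq0 opprB addrA subr_eq0 => /eqP <-;
  rewrite add_lfunE scalerDl addrC.
Qed.

Lemma rdual_act_cartan x (f : M -> K^o) :
  x \in cartan D -> rdual_spec f -> rdual_spec (fun m => f (act x m)).
Proof.
move=> xh [fl [r hr]]; split; first by move=> k u v; rewrite linearP fl.
exists r => b br m hm; apply: (hr _ br).
have -> : x = vsval (Subvs xh) by [].
by rewrite hm => t; rewrite linearZ /= hm !scalerA mulrC.
Qed.

Lemma rdual_act_add x y (f : M -> K^o) :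
  (forall f, rdual_spec f -> rdual_spec (fun m => f (act x m))) ->
  (forall f, rdual_spec f -> rdual_spec (fun m => f (act y m))) ->
  rdual_spec f -> rdual_spec (fun m => f (act (x + y) m)).
Proof.
move=> hx hy hf; have -> : (fun m => f (act (x + y) m)) =
    (fun m => 1 *: f (act x m) + f (act y m)).
  apply/funext => m; rewrite -[x in x + y]scale1r act_linl hf.1.
  by rewrite scale1r.
by apply: rdual_comb; [exact: hx|exact: hy].
Qed.

Lemma rdual_act_spec x (f : M -> K^o) :
  rdual_spec f -> rdual_spec (fun m => f (act x m)).
Proof.
have sumP (r : seq wt) y f' : y \in (\sum_(a <- r) rspace a)%VS ->
    rdual_spec f' -> rdual_spec (fun m => f' (act y m)).
  elim: r y f' => [|a r IHr] y f'.
    rewrite big_nil memv0 => /eqP -> hf; apply: rdual_act_cartan hf.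
    exact: mem0v.
  rewrite big_cons => /memv_addP[u ua [v vr ->]] hf.
  apply: rdual_act_add => [f'' hf''|f'' hf''|//]; first exact: (rdual_act_root ua hf'').
  exact: IHr.
have : x \in {:g}%VS by exact: memvf.
rewrite -(triangular_sum D) => /memv_addP[y /memv_addP[u un [v vh ->]] [w wn ->]].
move=> hf; apply: rdual_act_add => [f' hf'|f' hf'|//]; last exact: (sumP _ _ _ wn hf').
apply: rdual_act_add => [f'' hf''|f'' hf''|//]; first exact: (sumP _ _ _ un hf'').
exact: rdual_act_cartan.
Qed.

Lemma rdual_act_mem x (f : rdual) :
  (fun m => subsp_val f (act (s x) m)) \in rdual_sub.
Proof.
by apply/asboolP/rdual_act_spec; have /asboolP := subsp_valP f.
Qed.
Definition rdual_act (x : g) (f : rdual) : rdual := Subsp (rdual_act_mem x f).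

Lemma rdual_ext (f f' : rdual) : subsp_val f =1 subsp_val f' -> f = f'.
Proof. by move=> /funext ff'; exact: val_inj. Qed.

Lemma rdual_linear (f : rdual) : linear (subsp_val f).
Proof. by have /asboolP[] := subsp_valP f. Qed.

Lemma rdual_bilin : bilin rdual_act.
Proof.
split=> [f a x y|x a f f']; apply: rdual_ext => m //=.
by rewrite anti_linear act_linl rdual_linear.
Qed.

Lemma rdual_brk x y f :
  rdual_act (brk x y) f = rdual_act x (rdual_act y f) - rdual_act y (rdual_act x f).
Proof.
apply: rdual_ext => m /=.
by rewrite anti_brk act_brk -scaleN1r addrC rdual_linear scaleN1r addrC.
Qed.

Definition gdual : gmod := Gmod rdual_bilin rdual_brk.
End DualModule.

Section DualMap.
Variables (M N : gmod) (p : ghom M N).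

Lemma rdual_map_spec (f : N -> K^o) :
  rdual_spec f -> rdual_spec (fun m => f (p m)).
Proof.
move=> [fl [r hr]]; split; first by move=> a u v; rewrite linearP fl.
by exists r => a ar m hm; apply: (hr a ar); exact: wspace_map.
Qed.

Lemma rdual_map_mem (f : gdual N) : (fun m => subsp_val f (p m)) \in rdual_sub M.
Proof. by apply/asboolP/rdual_map_spec; have /asboolP := subsp_valP f. Qed.
Definition rdual_map (f : gdual N) : gdual M := Subsp (rdual_map_mem f).

Lemma rdual_map_linear : linear rdual_map.
Proof. by move=> a f f'; apply: rdual_ext. Qed.
Lemma rdual_map_act x f : rdual_map (act x f) = act x (rdual_map f).
Proof. by apply: rdual_ext => m; rewrite /= ghom_act. Qed.
Definition gdual_map : ghom (gdual N) (gdual M) :=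
  Ghom rdual_map_linear rdual_map_act.
End DualMap.
End Dual.

(* A contravariant functor X from O_0 to endofunctors of O_0 is given by data
   defined on all modules, with laws required on O_0 only: the modules X_M N, the
   maps X_M f, and the components of X_p : X_M' -> X_M for p : M -> M'. *)
Record contra_data := ContraData {
  cob : gmod -> gmod -> gmod;
  cmor : forall (M N N' : gmod), ghom N N' -> ghom (cob M N) (cob M N');
  cnat : forall (M M' : gmod), ghom M M' -> forall N, ghom (cob M' N) (cob M N) }.

Definition is_endofunctor (T : gmod -> gmod)
    (Tm : forall N N', ghom N N' -> ghom (T N) (T N')) :=
  [/\ forall N, inO0 N -> inO0 (T N),
      forall N, inO0 N -> Tm N N (idg N) = idg (T N) &
      forall N N' N'', inO0 N -> inO0 N' -> inO0 N'' ->
      forall (f : ghom N' N'') (f' : ghom N N'),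
        Tm N N'' (compg f f') = compg (Tm N' N'' f) (Tm N N' f')].

Definition is_natural (T T' : gmod -> gmod)
    (Tm : forall N N', ghom N N' -> ghom (T N) (T N'))
    (Tm' : forall N N', ghom N N' -> ghom (T' N) (T' N'))
    (eta : forall N, ghom (T N) (T' N)) :=
  forall N N', inO0 N -> inO0 N' -> forall f : ghom N N',
    compg (eta N') (Tm N N' f) = compg (Tm' N N' f) (eta N).

Record is_contravariant_functor (X : contra_data) : Prop := {
  contra_endofunctor : forall M, inO0 M -> is_endofunctor (@cmor X M);
  contra_natural : forall M M', inO0 M -> inO0 M' -> forall p : ghom M M',
    is_natural (@cmor X M') (@cmor X M) (cnat X p);
  contra_id : forall M, inO0 M -> forall N, inO0 N ->
    cnat X (idg M) N = idg (cob X M N);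
  contra_comp : forall M M' M'', inO0 M -> inO0 M' -> inO0 M'' ->
    forall (p : ghom M' M'') (q : ghom M M'), forall N, inO0 N ->
    cnat X (compg p q) N = compg (cnat X q N) (cnat X p N) }.

Definition right_exact (X : contra_data) :=
  forall A B C, inO0 A -> inO0 B -> inO0 C ->
  forall (p : ghom A B) (q : ghom B C), injective p -> exact_at p q ->
  forall N, inO0 N -> exact_at (cnat X q N) (cnat X p N) /\ gsurj (cnat X p N).

Definition left_exact (X : contra_data) :=
  forall A B C, inO0 A -> inO0 B -> inO0 C ->
  forall (p : ghom A B) (q : ghom B C), exact_at p q -> gsurj q ->
  forall N, inO0 N ->
    injective (cnat X q N) /\ exact_at (cnat X q N) (cnat X p N).

(* (x f) m = f (- x m) *)
Definition mdual := gdual (opp_anti g).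
Definition mdual_map := gdual_map (opp_anti g).

Definition F_ob (M N : gmod) : gmod := block0 (trunc 0 (gtens (mdual M) N)).

Definition F_mor (M N N' : gmod) (f : ghom N N') : ghom (F_ob M N) (F_ob M N') :=
  block0_map (trunc_map 0 (gtens_map (idg (mdual M)) f)).

Definition F_nat (M M' : gmod) (p : ghom M M') (N : gmod) :
    ghom (F_ob M' N) (F_ob M N) :=
  block0_map (trunc_map 0 (gtens_map (mdual_map p) (idg N))).

Definition F_data : contra_data := ContraData F_mor F_nat.

Section Hfunctor.
Variable theta : chevalley D.

(* (x f) m = f (theta x m) *)
Definition star := gdual theta.
Definition star_map := gdual_map theta.

Definition H_ob (M N : gmod) : gmod := star (F_ob (star M) (star N)).

Definition H_mor (M N N' : gmod) (f : ghom N N') : ghom (H_ob M N) (H_ob M N') :=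
  star_map (F_mor (star M) (star_map f)).

Definition H_nat (M M' : gmod) (p : ghom M M') (N : gmod) :
    ghom (H_ob M' N) (H_ob M N) :=
  star_map (F_nat (star_map p) (star N)).

Definition H_data : contra_data := ContraData H_mor H_nat.
End Hfunctor.
End CategoryO.

(* Main.v *)
From HB Require Import structures.
From Stdlib Require Import Relations.
From mathcomp Require Import all_boot all_order all_algebra.
From mathcomp Require Import boolp classical_sets functions reals complex zify ring.
Require Import Defs.

(** The Casimir operator of the Killing form acts on a vector of weight mu killed
    by n_+ by a scalar c(mu), where c is quadratic in mu with a positive definite
    leading part on the root lattice. So for M in O only finitely many weights of M
    can carry a singular vector of a subquotient of M, and two nested submodules of
    M that agree on these finitely many, finite-dimensional weight spaces are equal.
    This gives finite length and the stability of O under submodules and duality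
    (neither Noetherianity of U(n_-) nor the PBW theorem is needed), and, by
    splitting extensions of unlinked simple modules, the decomposition
    M = M_0 + M_1 with M_0 the summand of M in O_0. Hence the block projection is
    exact on O. Since M |-> M^* is exact, and the tensor product and the truncation
    are right exact, F is right exact; H is left exact because the star duality is
    exact and preserves O_0. *)

Set Implicit Arguments.
Unset Strict Implicit.
Unset Printing Implicit Defensive.

Import Order.TTheory GRing.Theory Num.Theory.
Local Open Scope ring_scope.
Local Open Scope classical_set_scope.

(** * Linear algebra *)

Section LinearAlgebra.
Variable K : fieldType.

(** The tensor product of the dual of M with N is in general outside O: its weights are unbounded
    and its weight spaces infinite-dimensional. Exactness is therefore followed through weight
    modules, and O is entered only after the truncation. There a functional tensored with a weight
    vector v of N survives only if minus its weight is a weight of M above that of v, which leaves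
    finitely many possibilities. The block is defined by linkage of simple modules and not by
    central characters, so M_0 and M_1 are obtained as maximal submodules with all factors linked,
    respectively not linked, to the trivial module. The surjectivity on blocks that results already
    implies exactness in the middle. Positivity comes from traces over root strings: for t = [x, y]
    with x, y of weights a and -a, every w_i(t) is a real multiple of a(t). The same fact shows that
    the radical of the Killing form meets h trivially, which lets semisimplicity exclude it. Weight
    control is compatible with transposition: passing to perpendicular spaces exchanges small and
    large submodules at the same weights, which puts the star dual in O. *)

Lemma submodB (V : lmodType K) (S : submodClosed V) u v :
  u \in S -> v \in S -> u - v \in S.
Proof. by move=> uS vS; rewrite -scaleN1r rpredD ?rpredZ. Qed.

(** Turns a linearly closed property into a subspace, so that [rpred_sum] and the minimality of
    spans apply to it; most inductions over generators below take this form. *)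
Lemma subcl_ex (V : lmodType K) (P : V -> Prop) : P 0 ->
  (forall a u v, P u -> P v -> P (a *: u + v)) ->
  exists S : submodClosed V, forall v, v \in S <-> P v.
Proof.
move=> P0 PD; pose S : {pred V} := fun v => `[< P v >].
have Sc : submod_closed S.
  by split=> [|a u w /asboolP hu /asboolP hw]; apply/asboolP => //; apply: PD.
pose SM := GRing.isSubmodClosed.Build K V S Sc.
pose S' : submodClosed V := HB.pack S SM.
by exists S' => v; split => [/asboolP|?] //; apply/asboolP.
Qed.

Section Span.
Variables (V : lmodType K).

Definition lincomb (s : seq V) (u : 'rV[K]_(size s)) : V :=
  \sum_i u 0 i *: s`_i.

Lemma lincomb_linear s : linear (@lincomb s).
Proof.
move=> a u v; rewrite /lincomb scaler_sumr -big_split /=.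
by apply: eq_bigr => i _; rewrite !mxE scalerDl scalerA.
Qed.
HB.instance Definition _ s :=
  GRing.isLinear.Build K _ V *:%R (@lincomb s) (@lincomb_linear s).

Definition inspan (s : seq V) (v : V) := exists u, v = @lincomb s u.

Lemma inspan0 s : inspan s 0.
Proof. by exists 0; rewrite linear0. Qed.

Lemma inspanP s a u v : inspan s u -> inspan s v -> inspan s (a *: u + v).
Proof. by move=> [x ->] [y ->]; exists (a *: x + y); rewrite linearP. Qed.

Lemma mem_inspan s v : v \in s -> inspan s v.
Proof.
move=> /[dup] vs; rewrite -index_mem => lt; exists (delta_mx 0 (Ordinal lt)).
rewrite /lincomb (bigD1 (Ordinal lt)) //= big1 => [|i /negPf ni].
  by rewrite mxE !eqxx scale1r addr0 nth_index.
by rewrite mxE ni andbF scale0r.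
Qed.

Lemma inspan_sub s (S : submodClosed V) v :
  {subset s <= S} -> inspan s v -> v \in S.
Proof.
by move=> sS [u ->]; apply: rpred_sum => i _; apply/rpredZ/sS/mem_nth.
Qed.

Lemma inspan_trans s s' v : (forall w, w \in s -> inspan s' w) ->
  inspan s v -> inspan s' v.
Proof.
have [S SP] := subcl_ex (inspan0 s') (@inspanP s') => ss' sv.
by apply/SP; apply: inspan_sub sv => w /ss' /SP.
Qed.

Lemma inspan_mono s s' v : {subset s <= s'} -> inspan s v -> inspan s' v.
Proof. by move=> ss'; apply: inspan_trans => w /ss'; exact: mem_inspan. Qed.
End Span.

(** Take a subspace inside [S] of maximal dimension: adding the line of a missing vector of [S]
    would enlarge it. *)
Lemma vspace_of (vT : vectType K) (S : submodClosed vT) :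
  exists U : {vspace vT}, forall u, (u \in U) = (u \in S).
Proof.
pose P d := `[< exists2 U : {vspace vT}, forall u, u \in U -> u \in S & \dim U = d >].
have exP : exists d, P d.
  by exists 0%N; apply/asboolP; exists 0%VS; rewrite ?dimv0 // => u; rewrite memv0 => /eqP->; exact: rpred0.
have ubP d : P d -> (d <= \dim {:vT})%N by move=> /asboolP[U _ <-]; exact: dimvS (subvf U).
have [d /asboolP[U US dU] dmax] := ex_maxnP exP ubP.
exists U => u; apply/idP/idP => [/US //|uS].
have /dmax : P (\dim (U + <[u]>)).
  apply/asboolP; exists (U + <[u]>)%VS => // w /memv_addP[x xU [y /vlineP[k ->] ->]].
  by rewrite rpredD ?rpredZ // US.
rewrite -dU => le; have /eqP -> : U == (U + <[u]>)%VS by rewrite -(geq_leqif (dimv_leqif_eq (addvSl _ _))).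
by apply: (subvP (addvSr _ _)); exact: memv_line.
Qed.

Section FiniteSpan.
Variables (V : lmodType K) (S : submodClosed V).

(** Preimages in [S] of a basis of phi(S) span [S], because [phi] is injective there. *)
Lemma fd_inj n (phi : {linear V -> 'rV[K]_n}) :
  (forall v, v \in S -> phi v = 0 -> v = 0) ->
  exists2 s : seq V, {subset s <= S} & forall v, v \in S -> inspan s v.
Proof.
move=> inj; have [|a u v [x xS ->] [y yS ->]|I IP] :=
  @subcl_ex 'rV[K]_n (fun u => exists2 v, v \in S & u = phi v).
- by exists 0; rewrite ?rpred0 ?linear0.
- by exists (a *: x + y); rewrite ?linearP ?rpredD ?rpredZ.
have [U UI] := vspace_of I.
have /choice[h hP] u : exists v, u \in U -> v \in S /\ u = phi v.
  case: (boolP (u \in U)) => [|_]; last by exists 0.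
  by rewrite UI => /IP[v vS ->]; exists v.
have hb b : b \in vbasis U -> h b \in S /\ b = phi (h b).
  by move=> /vbasis_mem /hP.
exists [seq h b | b <- vbasis U] => [_ /mapP[b /hb[? _] ->] //|v vS].
have /coord_vbasis E : phi v \in U by rewrite UI; apply/IP; exists v.
have -> : v = \sum_i coord (vbasis U) i (phi v) *: h (vbasis U)`_i.
  apply/eqP; rewrite -subr_eq0; apply/eqP/inj.
    rewrite submodB ?rpred_sum // => i _; rewrite rpredZ //.
    by apply: (hb _ _).1; rewrite mem_nth ?size_tuple.
  rewrite linearB linear_sum /= [X in X - _]E; apply/eqP; rewrite subr_eq0.
  apply/eqP/eq_bigr => i _; rewrite linearZ /=; congr (_ *: _).
  by apply: (hb _ _).2; rewrite mem_nth ?size_tuple.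
have [T TP] := subcl_ex (@inspan0 V [seq h b | b <- vbasis U]) (@inspanP V _).
apply/TP/rpred_sum => i _; apply/rpredZ/TP/mem_inspan/map_f.
by rewrite mem_nth ?size_tuple.
Qed.

(** The coefficient rows whose combination of [s] lies in [S] form a subspace of a row space; a
    basis of it is pushed back to [V]. *)
Lemma fd_sub (s : seq V) : exists2 s', {subset s' <= S} &
  forall v, inspan s v -> v \in S -> inspan s' v.
Proof.
have [|a u v uS vS|T TP] := @subcl_ex 'rV[K]_(size s) (fun u => lincomb u \in S).
- by rewrite linear0 rpred0.
- by rewrite linearP rpredD ?rpredZ.
have [U UT] := vspace_of T.
have US u : u \in U <-> lincomb u \in S by rewrite UT; exact: TP.
exists [seq lincomb u | u <- vbasis U] => [_ /mapP[u /vbasis_mem/US ? ->] //|].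
move=> _ [u ->] /US /coord_vbasis ->; rewrite linear_sum.
have [R RP] := subcl_ex (@inspan0 V [seq lincomb u | u <- vbasis U]) (@inspanP V _).
apply/RP/rpred_sum => i _; rewrite linearZ /=; apply/rpredZ/RP/mem_inspan/map_f.
by rewrite mem_nth ?size_tuple.
Qed.
End FiniteSpan.

(* A partially defined linear form is encoded by its graph. *)
Lemma graph_ext (W : lmodType K) (G : submodClosed (W * K^o)%type) (s : seq W) :
  (forall k, (0, k) \in G -> k = 0) ->
  exists G' : submodClosed (W * K^o)%type, [/\ {subset G <= G'},
    forall k, (0, k) \in G' -> k = 0 &
    forall w, inspan s w -> exists k, (w, k) \in G'].
Proof.
move=> G0; elim: s => [|c s [G1 [GG1 G10 dom]]].
  exists G; split=> // w [u ->]; exists 0.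
  by rewrite /lincomb big_ord0; exact: rpred0.
(* [G2] adds the value 0 at [c]. It is still the graph of a form when [c] is outside the domain of
   [G1], since a relation at 0 with a nonzero coefficient of [c] would put [c] in that domain. *)
have [|a _ _ [x xG [k ->]] [y yG [l ->]]|G2 G2P] :=
    @subcl_ex (W * K^o)%type (fun z => exists2 x, x \in G1 & exists k, z = k *: (c, 0) + x).
- by exists 0; [exact: rpred0|exists 0; rewrite scale0r addr0].
- exists (a *: x + y); first by rewrite rpredD ?rpredZ.
  by exists (a * k + l); rewrite scalerDr scalerA scalerDl addrACA.
have G12 : {subset G1 <= G2}.
  by move=> x xG; apply/G2P; exists x => //; exists 0; rewrite scale0r add0r.
have domS (G' : submodClosed (W * K^o)%type) : {subset G1 <= G'} ->
    (exists k, (c, k) \in G') -> forall w, inspan (c :: s) w -> exists k, (w, k) \in G'.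
  move=> G1G' [k ck] w sw; have [||D DP] := @subcl_ex W (fun w => exists k, (w, k) \in G').
  - by exists 0; exact: rpred0.
  - move=> a u v [k1 h1] [k2 h2]; exists (a *: (k1 : K^o) + k2).
    exact: (rpredD (rpredZ a h1) h2).
  apply/DP; apply: inspan_sub sw => v; rewrite inE => /predU1P[->|vs].
    by apply/DP; exists k.
  by apply/DP; have [l /G1G' h] := dom _ (mem_inspan vs); exists l.
case: (pselect (exists k, (c, k) \in G1)) => [cG|ncG].
  by exists G1; split=> //; exact: domS.
exists G2; split.
- by move=> x /GG1/G12.
- move=> k /G2P[[w l] xG [b [wE kE]]].
  have b0 : b = 0.
    apply/eqP/negPn/negP => b0; case: ncG; exists (- b^-1 *: (l : K^o)).
    have -> : (c, - b^-1 *: (l : K^o)) = - b^-1 *: (w, l : K^o).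
      congr pair; rewrite scaleNr; apply/eqP; rewrite -subr_eq0 opprK.
      rewrite -[X in X + _](scale1r c) -(mulVf b0) -scalerA -scalerDr.
      by rewrite -wE scaler0.
    by rewrite rpredZ.
  move: wE kE xG; rewrite b0 !scale0r !add0r => <- ->; exact: G10.
- apply: domS => //; exists 0; apply/G2P; exists 0; first exact: rpred0.
  by exists 1; rewrite scale1r addr0.
Qed.
End LinearAlgebra.

(** * Weight modules *)

Section Weights.
Variables (K : fieldType) (g : lieAlg K) (D : triangular g).
Notation h := (cartan D).
Notation wt := (weight (cartan D)).
Notation gmod := (gmod g).

Lemma wspace0 (M : gmod) (a : wt) : wspace M a 0.
Proof. by move=> t; rewrite linear0 scaler0. Qed.

Lemma wspace_lin (M : gmod) (a : wt) k u v :
  wspace M a u -> wspace M a v -> wspace M a (k *: u + v).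
Proof.
by move=> hu hv t; rewrite linearP /= hu hv scalerDr !scalerA mulrC.
Qed.

Lemma wspaceZ (M : gmod) (a : wt) k u : wspace M a u -> wspace M a (k *: u).
Proof. by move=> hu t; rewrite linearZ /= hu !scalerA mulrC. Qed.

Lemma wspace_sub (M : gmod) (a : wt) :
  exists S : submodClosed M, forall v, v \in S <-> wspace M a v.
Proof. by apply: subcl_ex; [exact: wspace0|move=> k u v; exact: wspace_lin]. Qed.

Lemma actDl (M : gmod) x y (m : M) : act (x + y) m = act x m + act y m.
Proof. by rewrite -[x in LHS]scale1r act_linl scale1r. Qed.
Lemma act0l (M : gmod) (m : M) : act 0 m = 0.
Proof. exact: linear_0 (act_linl m). Qed.
Lemma actZl (M : gmod) k x (m : M) : act (k *: x) m = k *: act x m.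
Proof. by rewrite -[k *: x]addr0 act_linl act0l addr0. Qed.

Lemma act_swap (M : gmod) x y (m : M) :
  act x (act y m) = act (brk x y) m + act y (act x m).
Proof. by rewrite act_brk subrK. Qed.

Lemma act_rspace (M : gmod) (a b : wt) x m :
  x \in rspace b -> wspace M a m -> wspace M (a + b) (act x m).
Proof.
move=> /rspaceP xb ma t; rewrite act_swap xb actZl ma linearZ /=.
by rewrite -scalerDl add_lfunE addrC.
Qed.

(** A list of pairs (t, k) stands for the product of the elements t - k of U(h): [hev] is its value
    at a weight and [hop] its action on a module. *)
Definition hev (l : seq (subvs_of h * K)) (a : wt) : K :=
  \prod_(tc <- l) (a tc.1 - tc.2).
Definition hop (M : gmod) (l : seq (subvs_of h * K)) (m : M) : M :=
  foldr (fun tc m => act (vsval tc.1) m - tc.2 *: m) m l.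

Lemma hop_lin (M : gmod) l k (u v : M) : hop l (k *: u + v) = k *: hop l u + hop l v.
Proof.
elim: l => //= tc l ->; rewrite linearP /= scalerDr opprD addrACA scalerBr.
by rewrite !scalerA mulrC.
Qed.

Lemma hop_wt (M : gmod) l (a : wt) (m : M) : wspace M a m -> hop l m = hev l a *: m.
Proof.
move=> ma; elim: l => [|tc l IH] /=; first by rewrite /hev big_nil scale1r.
rewrite IH linearZ /= ma /hev big_cons !scalerA -scalerBl; congr (_ *: _).
by rewrite mulrBl [in LHS]mulrC.
Qed.

Lemma hop_stable (M : gmod) (S : submodClosed M) l :
  (forall (t : subvs_of h) m, m \in S -> act (vsval t) m \in S) ->
  forall m, m \in S -> hop l m \in S.
Proof.
by move=> St m mS; elim: l => //= tc l IH; rewrite submodB ?rpredZ ?St.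
Qed.

(** One factor t - b(t) for each [b] in [r], with t chosen such that a(t) differs from b(t). *)
Lemma sep_ex (a : wt) (r : seq wt) : a \notin r ->
  exists l, hev l a != 0 /\ forall b, b \in r -> hev l b = 0.
Proof.
elim: r => [_|b r IH]; first by exists [::]; rewrite /hev big_nil oner_neq0.
rewrite inE negb_or => /andP[ab /IH[l [la lr]]].
have [t nt] : exists t, a t <> b t.
  by apply: contrapT => nt; case/eqP: ab; apply/lfunP => t; apply: contrapT => ?; case: nt; exists t.
exists ((t, b t) :: l); rewrite /hev !big_cons mulf_neq0 ?subr_eq0 //; last exact/eqP.
by split=> // c; rewrite inE big_cons => /predU1P[->|/lr]; rewrite ?subrr ?mul0r // /hev => ->; rewrite mulr0.
Qed.

Lemma submod_ex (M : gmod) (P : M -> Prop) : P 0 ->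
  (forall a u v, P u -> P v -> P (a *: u + v)) ->
  (forall x m, P m -> P (act x m)) ->
  exists S : submod M, forall m, m \in S <-> P m.
Proof.
move=> P0 PD Pa; have [S SP] := subcl_ex P0 PD.
have Sa x m : m \in S -> act x m \in S by move=> /SP/Pa-/(_ x)/SP.
by exists (Submod Sa) => m; exact: SP.
Qed.

Section WeightModule.
Variable M : gmod.

Definition wne (a : wt) : submodClosed M :=
  spanset [set m | exists2 b : wt, b <> a & wspace M b m].

(** Independence of weight spaces. An element of [wne a] is killed by every operator of U(h)
    vanishing at the finitely many weights it involves, while [sep_ex] provides one that acts on the
    weight [a] by a nonzero scalar. *)
Lemma wne_wspace0 a m : m \in wne a -> wspace M a m -> m = 0.
Proof.
move=> /(spanset_ind (P := fun m => exists2 r : seq wt, a \notin r & forall l,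
  (forall b, b \in r -> hev l b = 0) -> hop l m = 0)) H.
case: H.
- exists [::] => // l _; elim: l => //= tc l ->.
  by rewrite linear0 scaler0 subrr.
- move=> k u v [r ar hr] [r' ar' hr']; exists (r ++ r').
    by rewrite mem_cat negb_or ar.
  move=> l hl; rewrite hop_lin hr ?hr' ?scaler0 ?addr0 // => b br;
    by rewrite hl // mem_cat br ?orbT.
- move=> v [b /eqP ba bv]; exists [:: b]; first by rewrite inE eq_sym.
  by move=> l /(_ b (mem_head _ _)) E; rewrite (hop_wt _ bv) E scale0r.
move=> r /sep_ex[l [la lr]] /(_ l lr) + ma.
by rewrite (hop_wt _ ma) => /eqP; rewrite scaler_eq0 (negPf la) => /eqP.
Qed.

(** The projection to the weight space of [a] along [wne a], chosen with default 0; on weight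
    modules it is well defined, linear and natural. *)
Definition wcomp (a : wt) (m : M) : M :=
  xget 0 [set m' | wspace M a m' /\ m - m' \in wne a].

Hypothesis Mw : weight_module D M.

Lemma wt_ind (P : M -> Prop) : P 0 ->
  (forall k u v, P u -> P v -> P (k *: u + v)) ->
  (forall (a : wt) m, wspace M a m -> P m) -> forall m, P m.
Proof.
move=> P0 PD Pw m; have [S SP] := subcl_ex P0 PD.
have [s sw ->] := Mw m; apply/SP; rewrite big_seq; apply: rpred_sum => v /sw[a].
by move=> /Pw/SP.
Qed.

Lemma wcompP a m : wspace M a (wcomp a m) /\ m - wcomp a m \in wne a.
Proof.
rewrite /wcomp; apply: (@xgetPex _ 0 [set m' | wspace M a m' /\ m - m' \in wne a]).
apply: (wt_ind (P := fun m => exists m', wspace M a m' /\ m - m' \in wne a)).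
- by exists 0; split; [exact: wspace0|rewrite subrr rpred0].
- move=> k u v [u' [uw un]] [v' [vw vn]]; exists (k *: u' + v').
  split; first exact: wspace_lin.
  by rewrite opprD addrACA -scalerBr rpredD ?rpredZ.
- move=> b v bv; have [<-|/eqP ba] := eqVneq b a.
    by exists v; split=> //; rewrite subrr rpred0.
  exists 0; split; first exact: wspace0.
  by rewrite subr0; apply: sub_spanset; exists b.
Qed.

Lemma wcompw a m : wspace M a (wcomp a m). Proof. exact: (wcompP a m).1. Qed.

Lemma wcomp_uniq a m m' : wspace M a m' -> m - m' \in wne a -> wcomp a m = m'.
Proof.
move=> mw mn; have [cw cn] := wcompP a m.
apply/eqP; rewrite -subr_eq0; apply/eqP/(@wne_wspace0 a).
  have -> : wcomp a m - m' = (m - m') - (m - wcomp a m).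
    by rewrite opprB [RHS]addrC addrA subrK.
  exact: submodB.
by rewrite addrC -scaleN1r; apply: wspace_lin.
Qed.

Lemma wcomp_lin a : linear (wcomp a).
Proof.
move=> k u v; have [uw un] := wcompP a u; have [vw vn] := wcompP a v.
apply: wcomp_uniq; first exact: wspace_lin.
by rewrite opprD addrACA -scalerBr rpredD ?rpredZ.
Qed.

Lemma wcomp_id a m : wspace M a m -> wcomp a m = m.
Proof. by move=> ma; apply: wcomp_uniq; rewrite ?subrr ?rpred0. Qed.

Lemma wcomp_ne a b m : wspace M b m -> b <> a -> wcomp a m = 0.
Proof.
move=> mb ba; apply: wcomp_uniq; first exact: wspace0.
by rewrite subr0; apply: sub_spanset; exists b.
Qed.

Lemma wcomp0 a : wcomp a 0 = 0. Proof. exact: linear_0 (wcomp_lin a). Qed.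

(** The list may be enlarged at will, so that the supports of two vectors can be replaced by a
    common one. *)
Lemma wsupp m : exists r : seq wt, forall r', uniq r' -> {subset r <= r'} ->
  m = \sum_(a <- r') wcomp a m.
Proof.
move: m; apply: wt_ind.
- by exists [::] => r' _ _; rewrite big1 // => a _; rewrite wcomp0.
- move=> k u v [r hr] [r' hr']; exists (r ++ r') => s su sr.
  under eq_bigr do rewrite wcomp_lin.
  rewrite big_split /= -scaler_sumr -hr -?hr' // => b br;
    by apply: sr; rewrite mem_cat br ?orbT.
- move=> a m ma; exists [:: a] => r ru ar.
  rewrite (bigD1_seq a) ?ar ?mem_head //= wcomp_id // big1 ?addr0 // => b /eqP ba.
  by apply: wcomp_ne ma _ => ab; apply: ba.
Qed.

(** A product of factors t - b(t) that vanishes at the other weights of [m] but not at [a] maps [m]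
    to a nonzero multiple of its component, and it preserves [S]. *)
Lemma wcomp_stable (S : submodClosed M) a m :
  (forall (t : subvs_of h) m, m \in S -> act (vsval t) m \in S) ->
  m \in S -> wcomp a m \in S.
Proof.
move=> St mS; have [r0 hr] := wsupp m.
pose r := rem a (undup (a :: r0)).
have [|l [la lr]] := @sep_ex a r; first by rewrite mem_rem_uniq ?undup_uniq // inE eqxx.
have E : hop l m = hev l a *: wcomp a m.
  rewrite {1}[m](hr (undup (a :: r0))) ?undup_uniq //; last first.
    by move=> b; rewrite mem_undup inE => ->; rewrite orbT.
  have hD (I : seq wt) F : hop l (\sum_(b <- I) F b) = \sum_(b <- I) hop l (F b) :> M.
    elim: I => [|b I IH]; last by rewrite !big_cons -IH -[F b]scale1r hop_lin !scale1r.
    by rewrite !big_nil (hop_wt l (@wspace0 M 0)) scaler0.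
  rewrite hD (bigD1_seq a) ?undup_uniq ?mem_undup ?mem_head //= big_seq_cond big1 ?addr0.
    by rewrite (hop_wt _ (wcompw a m)).
  move=> b /andP[br ba]; rewrite (hop_wt _ (wcompw b m)) lr ?scale0r //.
  by rewrite mem_rem_uniq ?undup_uniq // inE ba.
rewrite -[wcomp a m]scale1r -(mulVf la) -scalerA -E rpredZ //.
exact: hop_stable.
Qed.
End WeightModule.

Lemma wcomp_map (M N : gmod) (f : ghom M N) a m : weight_module D M ->
  weight_module D N -> f (wcomp a m) = wcomp a (f m).
Proof.
move=> Mw Nw; have [mw mn] := wcompP Mw a m; symmetry; apply: wcomp_uniq => //.
  exact: wspace_map.
rewrite -linearB; move: mn; elim/spanset_ind.
- by rewrite linear0 rpred0.
- by move=> k u v hu hv; rewrite linearP rpredD ?rpredZ.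
- by move=> v [b ba bv]; apply: sub_spanset; exists b => //; exact: wspace_map.
Qed.

Lemma weight_module_sub (M : gmod) (S : submod M) :
  weight_module D M -> weight_module D (gsub S).
Proof.
move=> Mw [m mS]; have [r hr] := wsupp Mw m.
have cS a : wcomp a m \in S.
  by apply: wcomp_stable => // t v; exact: submod_act.
exists [seq Subsp (cS a) : gsub S | a <- undup r].
  move=> _ /mapP[a _ ->]; exists a => t; apply: val_inj => /=.
  exact: wcompw.
apply: val_inj; rewrite big_map /=.
have vD (I : seq wt) (F : wt -> gsub S) : val (\sum_(b <- I) F b) = \sum_(b <- I) val (F b).
  by elim: I => [|b I IH]; rewrite ?big_nil // !big_cons -IH.
by rewrite vD /=; apply: hr; rewrite ?undup_uniq // => b; rewrite mem_undup.
Qed.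

Lemma weight_module_surj (M N : gmod) (f : ghom M N) :
  gsurj f -> weight_module D M -> weight_module D N.
Proof.
move=> fs Mw n; have [m <-] := fs n; have [r rw ->] := Mw m.
exists [seq f v | v <- r]; last by rewrite linear_sum big_map.
by move=> _ /mapP[v /rw[a va] ->]; exists a; exact: wspace_map.
Qed.

Lemma gquot_surj (M : gmod) (S : submod M) :
  exists f : ghom M (gquot S), gsurj f /\ forall m, f m = qpi S m.
Proof.
have fl : linear (fun m => qpi S m : gquot S) by move=> k u v; rewrite linearP.
exists (Ghom (N := gquot S) fl (fun x m => esym (quot_actE S x m))).
by split=> // u; exists (qrepr u); exact: qreprK.
Qed.
End Weights.

(** * The root lattice and the weights of modules in O *)

Section RootLattice.
Variables (K : fieldType) (g : lieAlg K) (D : triangular g).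
Hypothesis K0 : forall n, (n%:R == 0 :> K) = (n == 0%N).
Notation h := (cartan D).
Notation wt := (weight (cartan D)).
Notation gmod := (gmod g).
Notation rk := (size (simple_roots D)).

Definition qsum (f : 'I_rk -> nat) : wt := \sum_(i < rk) (simple_roots D)`_i *+ f i.
(** The cone Q_+ of the root lattice. The order on weights is used below through membership of
    differences in it. *)
Definition Qp (a : wt) := exists f, a = qsum f.

Definition scoord (i : 'I_rk) (a : wt) : K := coord (in_tuple (simple_roots D)) i a.

Lemma scoord_lin i : linear (scoord i : wt -> K^o).
Proof. by move=> k u v; rewrite /scoord linearP. Qed.
HB.instance Definition _ i :=
  GRing.isLinear.Build K wt K^o *:%R (scoord i) (scoord_lin i).

Lemma natr_inj m n : m%:R = n%:R :> K -> m = n.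
Proof.
wlog le_mn : m n / (m <= n)%N => [H E|E].
  by case/orP: (leq_total m n) => /H H'; [exact: H'|rewrite H'].
have := K0 (n - m); rewrite natrB // E subrr eqxx => /esym.
by rewrite subn_eq0 => le; apply/eqP; rewrite eqn_leq le_mn.
Qed.

Lemma simple_free : free (in_tuple (simple_roots D)).
Proof. by case/andP: (simple_roots_basis D). Qed.

Lemma weight_sum (a : wt) : a = \sum_(i < rk) scoord i a *: (simple_roots D)`_i.
Proof. by rewrite {1}(coord_basis (simple_roots_basis D : basis_of _ (in_tuple _)) (memvf a)). Qed.

Lemma scoord_simple (i j : 'I_rk) : scoord i (simple_roots D)`_j = (i == j)%:R.
Proof. by rewrite /scoord (coord_free j i simple_free) eq_sym. Qed.

Lemma scoord_qsum i f : scoord i (qsum f) = (f i)%:R.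
Proof.
rewrite /qsum linear_sum (bigD1 i) //= big1 => [|j ji].
  by rewrite raddfMn /= scoord_simple eqxx addr0.
by rewrite raddfMn /= scoord_simple eq_sym (negPf ji) mul0rn.
Qed.

Lemma qsum_inj f f' : qsum f = qsum f' -> f =1 f'.
Proof. by move=> E i; apply: natr_inj; rewrite -!scoord_qsum E. Qed.

Lemma qsumD f f' : qsum f + qsum f' = qsum (fun i => (f i + f' i)%N).
Proof. by rewrite /qsum -big_split; apply: eq_bigr => i _; rewrite mulrnDr. Qed.

Lemma qsum0 : qsum (fun=> 0%N) = 0.
Proof. by rewrite /qsum big1. Qed.

Lemma Qp0 : Qp 0. Proof. by exists (fun=> 0%N); rewrite qsum0. Qed.
Lemma QpD a b : Qp a -> Qp b -> Qp (a + b).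
Proof. by move=> [f ->] [f' ->]; rewrite qsumD; eexists. Qed.

Lemma Qp_simple a : a \in simple_roots D -> Qp a.
Proof.
move=> aS; have lt : (index a (simple_roots D) < rk)%N by rewrite index_mem.
exists (fun i => nat_of_bool (i == Ordinal lt)); rewrite /qsum (bigD1 (Ordinal lt)) //=.
by rewrite eqxx mulr1n nth_index // big1 ?addr0 // => i /negPf ->.
Qed.

Lemma natspan_Qp a : natspan (simple_roots D) a -> Qp a.
Proof.
move=> [r rS ->]; elim: r rS => [_|b r IH rS]; first by rewrite big_nil; exact: Qp0.
rewrite big_cons; apply: QpD; first by apply: Qp_simple; rewrite rS ?mem_head.
by apply: IH => x xr; rewrite rS // inE xr orbT.
Qed.

Lemma pos_rootP a : a \in pos_roots D -> a \in roots D /\ Qp a.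
Proof. by rewrite mem_filter => /andP[/asboolP/natspan_Qp]. Qed.

Lemma neg_rootP a : a \in neg_roots D -> a \in roots D /\ Qp (- a).
Proof. by rewrite mem_filter => /andP[/asboolP/natspan_Qp]. Qed.

Lemma root_neq0 a : a \in roots D -> a != 0.
Proof. by rewrite rootsP => /andP[]. Qed.

Lemma rootsE a : a \in roots D -> a \in pos_roots D \/ a \in neg_roots D.
Proof.
move=> aR; rewrite !mem_filter aR !andbT.
by have [?|?] := simple_roots_sign aR; [left|right]; apply/asboolP.
Qed.

Lemma wle_Qp (a b : wt) : wle a b -> Qp (b - a).
Proof.
rewrite /wle -(opprB a b) => -[r rN ->]; rewrite -sumrN.
elim: r rN => [_|c r IH rN]; first by rewrite big_nil; exact: Qp0.
rewrite big_cons; apply: QpD; first by apply: (neg_rootP _).2; rewrite rN ?mem_head.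
by apply: IH => x xr; rewrite rN // inE xr orbT.
Qed.

Lemma qsum_gt0 f : qsum f != 0 -> (0 < \sum_i f i)%N.
Proof.
move=> f0; rewrite lt0n; apply: contra f0; rewrite sum_nat_eq0 => /forallP f0.
by rewrite /qsum big1 // => i _; have /eqP -> := f0 i; rewrite mulr0n.
Qed.

(** The simple coordinates of c - b are natural numbers bounded by those of c - d, hence by their
    sum, which leaves finitely many functions. *)
Lemma Qp_interval (c d : wt) : exists P : seq wt, forall b, Qp (c - b) -> Qp (b - d) -> b \in P.
Proof.
have [[F FE]|nF] := pselect (Qp (c - d)); last first.
  by exists [::] => b cb bd; case: nF; rewrite -[c](subrK b) -addrA; exact: QpD.
exists [seq c - qsum (fun i => f i) | f : {ffun 'I_rk -> 'I_(\sum_i F i).+1}] => b [f fE] [f' fE'].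
have fF i : (f i < (\sum_i F i).+1)%N.
  rewrite ltnS (bigD1 i) //=; have -> : F i = (f i + f' i)%N.
    by apply: (@qsum_inj F (fun i => (f i + f' i)%N)); rewrite -qsumD -FE -fE -fE' addrA subrK.
  by rewrite -addnA leq_addr.
apply/mapP; exists [ffun i => Ordinal (fF i)]; first by rewrite mem_enum.
have -> : qsum (fun i => [ffun i => Ordinal (fF i)] i) = qsum f.
  by apply: eq_bigr => i _; rewrite ffunE.
by rewrite -fE opprB addrC subrK.
Qed.

Lemma height_bound (r : seq wt) (a : wt) : exists N, forall c f,
  c \in r -> c - a = qsum f -> (\sum_i f i <= N)%N.
Proof.
have /choice[N hN] c : exists N, forall f, c - a = qsum f -> (\sum_i f i <= N)%N.
  have [[f fE]|nf] := pselect (Qp (c - a)); last by exists 0%N => f fE; case: nf; exists f.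
  by exists (\sum_i f i)%N => f'; rewrite fE => /qsum_inj E; rewrite (eq_bigr _ (fun i _ => E i)).
exists (\max_(c <- r) N c) => c f cr /hN le; apply: leq_trans le _.
by apply: leq_bigmax_seq.
Qed.

Definition bounded (M : gmod) (r : seq wt) := forall (m : M) (b : wt),
  wspace M b m -> m <> 0 -> exists2 c, c \in r & Qp (c - b).
Definition fdw (M : gmod) := forall a : wt, exists s : seq M,
  forall m, wspace M a m -> inspan s m.

Lemma bounded_interval (M : gmod) r (d : wt) : bounded M r -> exists P : seq wt,
  forall b (m : M), wspace M b m -> m <> 0 -> Qp (b - d) -> b \in P.
Proof.
move=> Mr; have /choice[f fP] c := Qp_interval c d.
exists (flatten [seq f c | c <- r]) => b m mb m0 bd.
have [c cr cb] := Mr _ _ mb m0; apply/flattenP; exists (f c); first exact: map_f.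
exact: fP.
Qed.

Definition neg_vectors : seq g := flatten [seq (vbasis (rspace a) : seq g) | a <- neg_roots D].

Lemma neg_vectorsP y : y \in neg_vectors -> exists2 a, a \in neg_roots D & y \in rspace a.
Proof. by move=> /flattenP[_ /mapP[a aN ->]] /vbasis_mem ya; exists a. Qed.

Lemma root_sum_ind (r : seq wt) (P : g -> Prop) : P 0 ->
  (forall k u v, P u -> P v -> P (k *: u + v)) ->
  (forall a x, a \in r -> x \in rspace a -> P x) ->
  forall x, x \in (\sum_(a <- r) rspace a)%VS -> P x.
Proof.
move=> P0 PD; elim: r => [_|a r IH Pr] x.
  by rewrite big_nil memv0 => /eqP ->.
rewrite big_cons => /memv_addP[u ua [v vr ->]]; rewrite -[u]scale1r; apply: PD.
  by apply: Pr ua; rewrite mem_head.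
by apply: IH vr => b y br; apply: Pr; rewrite inE br orbT.
Qed.

Lemma nminus_vectors (M : gmod) (S : submodClosed M) :
  (forall y m, y \in neg_vectors -> m \in S -> act y m \in S) ->
  forall x m, x \in nminus D -> m \in S -> act x m \in S.
Proof.
move=> St x m xn mS; move: x xn; apply: root_sum_ind.
- by rewrite act0l rpred0.
- by move=> k u v hu hv; rewrite act_linl rpredD ?rpredZ.
move=> a x aN /coord_vbasis ->.
have [T TP] : exists T : submodClosed g, forall x, x \in T <-> act x m \in S.
  apply: subcl_ex; first by rewrite act0l rpred0.
  by move=> k u v hu hv; rewrite act_linl rpredD ?rpredZ.
apply/TP/rpred_sum => i _; apply/rpredZ/TP/St => //.
apply/flattenP; exists (vbasis (rspace a) : seq g); first by apply/mapP; exists a.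
by rewrite mem_nth ?size_tuple.
Qed.

Section FromGenerators.
Variables (M : gmod) (Mw : weight_module D M).
Variables (s : seq M) (r : seq wt).
Hypothesis sw : forall v, v \in s -> exists2 a, a \in r & wspace M a v.
Hypothesis sgen : forall S : submodClosed M,
  (forall x m, x \in nminus D -> m \in S -> act x m \in S) ->
  {subset s <= S} -> forall m, m \in S.

(** Monomials of length n in root vectors of n_-, in any order, applied to the weight generators
    [s]. *)
Definition words n : seq M :=
  iter n (fun l => [seq act y m | y <- neg_vectors, m <- l]) s.

Lemma wordsP n m : m \in words n -> exists c a f,
  [/\ c \in r, wspace M a m, c - a = qsum f & (n <= \sum_i f i)%N].
Proof.
elim: n m => [|n IH] m /=.
  move=> /sw[a ar ma]; exists a, a, (fun=> 0%N).
  by rewrite qsum0 subrr.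
move=> /allpairsP[[y v] /= [/neg_vectorsP[b bN yb] /IH[c [a [f [cr va E le]]]] ->]].
have [/root_neq0 b0 [f' fE]] := neg_rootP bN.
exists c, (a + b), (fun i => (f i + f' i)%N); split=> //.
- exact: act_rspace.
- by rewrite -qsumD -E -fE opprD addrA.
rewrite big_split /= -addn1 leq_add // qsum_gt0 //.
by rewrite -fE oppr_eq0.
Qed.

Lemma words_span m : m \in spanset [set w | exists n, w \in words n].
Proof.
apply: sgen => [|v vs]; last by apply: sub_spanset; exists 0%N.
apply: nminus_vectors => y v yN; move: v; apply: spanset_ind.
- by rewrite linear0 rpred0.
- by move=> k u v hu hv; rewrite linearP rpredD ?rpredZ.
move=> v [n vn]; apply: sub_spanset; exists n.+1.
by apply/allpairsP; exists (y, v).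
Qed.

Lemma bounded_gen : bounded M r.
Proof.
move=> m b mb m0; apply: contrapT => nb; apply: m0.
rewrite -(wcomp_id Mw mb); move: (words_span m); move: {mb} m; apply: spanset_ind.
- by rewrite wcomp0.
- by move=> k u v; rewrite wcomp_lin // => -> ->; rewrite scaler0 addr0.
move=> v [n /wordsP[c [a [f [cr va E _]]]]]; apply: wcomp_ne va _ => // ab.
by case: nb; exists c => //; exists f; rewrite -ab.
Qed.

(** Words of weight [a] have length at most N by [height_bound], and the projection to this weight
    kills the words of other weights. *)
Lemma fdw_gen : fdw M.
Proof.
move=> a.
have [N hN] := height_bound r a.
pose W := flatten [seq words n | n <- iota 0 N.+1].
exists W => m ma; rewrite -(wcomp_id Mw ma); move: (words_span m); move: {ma} m.
apply: spanset_ind; first by rewrite wcomp0 //; exact: inspan0.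
  by move=> k u v; rewrite wcomp_lin //; exact: inspanP.
move=> v [n vn]; have [c [b [f [cr vb E le]]]] := wordsP vn.
have [ba|/eqP ba] := eqVneq b a; last by rewrite (wcomp_ne Mw vb ba); exact: inspan0.
rewrite -ba (wcomp_id Mw vb); apply: mem_inspan; apply/flattenP; exists (words n) => //.
apply: map_f; rewrite mem_iota add0n leq0n /= ltnS (leq_trans le) // (hN c) //.
by rewrite -ba.
Qed.
End FromGenerators.

Lemma inO_generators (M : gmod) : inO D M -> exists (s : seq M) (r : seq wt),
  (forall v, v \in s -> exists2 a : wt, a \in r & wspace M a v) /\
  (forall S : submodClosed M,
    (forall x m, x \in nminus D -> m \in S -> act x m \in S) ->
    {subset s <= S} -> forall m, m \in S).
Proof.
move=> [Mw [s sg]].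
have /choice[d dP] m : exists d : seq M, (forall v, v \in d -> exists a : wt, wspace M a v)
    /\ m = \sum_(v <- d) v by have [d dw E] := Mw m; exists d.
have /choice[b bP] v : exists a : wt, (exists a : wt, wspace M a v) -> wspace M a v.
  by have [[a va]|nv] := pselect (exists a : wt, wspace M a v); [exists a|exists 0].
exists (flatten [seq d m | m <- s]), [seq b v | v <- flatten [seq d m | m <- s]].
split=> [v vs|S Sst sS].
  exists (b v); first exact: map_f.
  by apply: bP; case/flattenP: vs => _ /mapP[m _ ->] /(dP m).1.
apply: sg => // m ms; rewrite (dP m).2 big_seq; apply: rpred_sum => v vd.
by apply: sS; apply/flattenP; exists (d m) => //; exact: map_f.
Qed.

Lemma inO_weights (M : gmod) : inO D M -> (exists r, bounded M r) /\ fdw M.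
Proof.
move=> MO; have [s [r [sw sg]]] := inO_generators MO; split.
  by exists r; exact: bounded_gen MO.1 _ _ sw sg.
exact: fdw_gen MO.1 _ _ sw sg.
Qed.
End RootLattice.

(** * The adjoint module and homogeneous bases of g *)

Lemma exists_min (T : eqType) (s : seq T) (P : T -> Prop) (f : T -> int) :
  (exists2 x, x \in s & P x) ->
  exists x, [/\ x \in s, P x & forall y, y \in s -> P y -> f x <= f y].
Proof.
elim: s => [[x]//|z s IH] [x xs Px].
have [ex|nex] := pselect (exists2 x, x \in s & P x); last first.
  exists x; split=> // y ys Py.
  have E u : u \in z :: s -> P u -> u = z.
    by rewrite inE => /predU1P[//|us] Pu; case: nex; exists u.
  by rewrite (E x) // (E y).
have [y [ys Py ymin]] := IH ex; have [Pz|nPz] := pselect (P z); last first.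
  exists y; split=> [||u]; rewrite ?inE ?ys ?orbT // => /predU1P[->|]; first by [].
  exact: ymin.
have [le|/ltW le] := leP (f y) (f z).
  exists y; split=> [||u]; rewrite ?inE ?ys ?orbT // => /predU1P[->|] //.
  exact: ymin.
exists z; split=> [||u]; rewrite ?inE ?eqxx // => /predU1P[->|us Pu] //.
by apply: le_trans le _; exact: ymin.
Qed.

Lemma ex_free (K : fieldType) (vT : vectType K) (X : seq vT) :
  exists Y, [/\ {subset Y <= X}, free Y & <<Y>>%VS = <<X>>%VS].
Proof.
elim: X => [|x X [Y [YX Yf YE]]]; first by exists [::]; rewrite nil_free.
have [xY|xY] := boolP (x \in <<Y>>%VS).
  exists Y; split=> // [y /YX yX|]; first by rewrite inE yX orbT.
  by rewrite span_cons -YE; apply/esym/addv_idPr; rewrite -memvE.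
exists (x :: Y); split; rewrite ?free_cons ?xY ?span_cons ?YE //.
by move=> y; rewrite !inE => /predU1P[->|/YX ->]; rewrite ?eqxx ?orbT.
Qed.

Section Adjoint.
Variables (K : fieldType) (g : lieAlg K) (D : triangular g).
Notation h := (cartan D).
Notation wt := (weight (cartan D)).

Lemma brkDl (x y z : g) : brk (x + y) z = brk x z + brk y z.
Proof. by have := (brk_bilin g).1 z 1 x y; rewrite !scale1r. Qed.
Lemma brk0l (z : g) : brk 0 z = 0 :> g.
Proof. exact: linear_0 ((brk_bilin g).1 z). Qed.
Lemma brkZl k (x z : g) : brk (k *: x) z = k *: brk x z.
Proof. by rewrite -[k *: x]addr0 (brk_bilin g).1 brk0l addr0. Qed.
Lemma brkDr (x y z : g) : brk x (y + z) = brk x y + brk x z.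
Proof. by rewrite linearD. Qed.
Lemma brk0r (z : g) : brk z 0 = 0 :> g. Proof. by rewrite linear0. Qed.
Lemma brkZr k (x z : g) : brk x (k *: z) = k *: brk x z.
Proof. by rewrite linearZ. Qed.

Lemma brk_brk (x y z : g) : brk (brk x y) z = brk x (brk y z) - brk y (brk x z).
Proof.
have /eqP := brk_jacobi x y z; rewrite addr_eq0 => /eqP E.
rewrite brkC -[- brk z _]E; congr (_ + _).
by rewrite (brkC z x) linearN.
Qed.
Definition gad : gmod g := Gmod (brk_bilin g) brk_brk.

Lemma rspace_gad (a : wt) (x : g) : x \in rspace a <-> wspace gad a x.
Proof. by split=> [/rspaceP|/rspaceP]. Qed.

Lemma brk_rspace (a b : wt) x y :
  x \in rspace a -> y \in rspace b -> brk x y \in rspace (a + b).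
Proof.
move=> xa /rspace_gad yb; apply/rspace_gad; rewrite addrC.
exact: (act_rspace (M := gad)).
Qed.

(** Weights extended to all of [g] through the projection [vsproj] to h, so that they can be
    evaluated without the subtype [subvs_of h]. *)
Definition ev (a : wt) (x : g) : K := a (vsproj h x).
Lemma ev_lin a : linear (ev a : g -> K^o).
Proof. by move=> k x y; rewrite /ev !linearP. Qed.
HB.instance Definition _ a := GRing.isLinear.Build K g K^o *:%R (ev a) (ev_lin a).
Lemma evZr a k x : ev a (k *: x) = k * ev a x.
Proof. exact: linearZ. Qed.
Lemma ev_lfun a b k x : ev (k *: a + b) x = k * ev a x + ev b x.
Proof. by rewrite /ev add_lfunE scale_lfunE. Qed.
Lemma evZ a k x : ev (k *: a) x = k * ev a x.
Proof. by rewrite /ev scale_lfunE. Qed.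
Lemma evMn a m x : ev (a *+ m) x = ev a x *+ m.
Proof. by rewrite -scaler_nat evZ mulr_natl. Qed.
Lemma evD a b x : ev (a + b) x = ev a x + ev b x.
Proof. by rewrite /ev add_lfunE. Qed.
Lemma evN a x : ev (- a) x = - ev a x.
Proof. by rewrite /ev opp_lfunE. Qed.
Lemma ev_sum (I : Type) (r : seq I) P (F : I -> wt) x :
  ev (\sum_(i <- r | P i) F i) x = \sum_(i <- r | P i) ev (F i) x.
Proof. by rewrite /ev sum_lfunE. Qed.

Lemma act_ev (M : gmod g) (a : wt) (m : M) x :
  x \in h -> wspace M a m -> act x m = ev a x *: m.
Proof. by move=> xh ma; rewrite -{1}(vsprojK xh) ma. Qed.
Lemma brk_ev (a : wt) (x y : g) : x \in h -> y \in rspace a -> brk x y = ev a x *: y.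
Proof. by move=> xh /rspace_gad; exact: (act_ev (M := gad)). Qed.

Lemma cartan_rspace0 x : x \in h -> x \in rspace (0 : wt).
Proof.
by move=> xh; apply/rspaceP => t; rewrite lfunE scale0r; apply: (@cartan_abelian _ _ D); rewrite ?subvsP.
Qed.

(** The simple roots span the dual of h, hence yield the coordinate forms of a basis of h. *)
Lemma ev_sep x : x \in h -> (forall a, a \in simple_roots D -> ev a x = 0) -> x = 0.
Proof.
move=> xh x0; rewrite -(vsprojK xh) (coord_vbasis (memvf (vsproj h x))).
rewrite big1 ?linear0 // => i _.
pose a : wt := linfun (coord (vbasis {:subvs_of h}) i : subvs_of h -> K^o).
have -> : coord (vbasis {:subvs_of h}) i (vsproj h x) = ev a x by rewrite /ev lfunE.
rewrite (weight_sum a) ev_sum big1 ?scale0r // => j _.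
by rewrite /ev scale_lfunE -/(ev _ _) x0 ?scaler0 // mem_nth.
Qed.

(** The clause at weight 0 is what places the centralizer of h inside h, in [rspace0_cartan]. *)
Definition homogeneous_basis n (e : n.-tuple g) (w : 'I_n -> wt) :=
  basis_of {:g} e /\ forall i : 'I_n, e`_i \in rspace (w i) /\ (w i = 0 -> e`_i \in h).

(** By the triangular decomposition, bases of the root spaces together with a basis of h generate
    [g]; a free subfamily is kept. *)
Lemma homogeneous_basis_ex : exists n (e : n.-tuple g) w, homogeneous_basis e w.
Proof.
pose X := flatten [seq (vbasis (rspace a) : seq g) | a <- roots D] ++ vbasis h.
have homX x : x \in X -> exists a : wt, x \in rspace a /\ (a = 0 -> x \in h).
  rewrite mem_cat => /orP[/flattenP[_ /mapP[a aR ->]] /vbasis_mem xa|/vbasis_mem xh].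
    by exists a; split=> // a0; have := root_neq0 aR; rewrite a0 eqxx.
  by exists 0; split=> //; exact: cartan_rspace0.
have Xfull : <<X>>%VS = {:g}%VS.
  apply/eqP; rewrite eqEsubv subvf /= -(triangular_sum D).
  have sub (r : seq wt) : {subset r <= roots D} -> ((\sum_(a <- r) rspace a)%VS <= <<X>>)%VS.
    move=> rR; apply/subvP; apply: root_sum_ind.
    - exact: mem0v.
    - by move=> k u v hu hv; rewrite memvD // memvZ.
    move=> a x /rR aR xa; have : x \in <<vbasis (rspace a)>>%VS by rewrite (span_basis (vbasisP _)).
    apply/subvP/sub_span => y ya; rewrite mem_cat; apply/orP; left; apply/flattenP.
    by exists (vbasis (rspace a) : seq g) => //; apply/mapP; exists a.
  rewrite !subv_add !sub; last by move=> a; rewrite mem_filter => /andP[].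
    rewrite andbT /= -[h in (h <= _)%VS](span_basis (vbasisP _)).
    by apply: sub_span => y yh; rewrite mem_cat yh orbT.
  by move=> a; rewrite mem_filter => /andP[].
have [Y [YX Yf YE]] := ex_free X.
have /choice[w wP] (i : 'I_(size Y)) : exists a : wt, Y`_i \in rspace a /\ (a = 0 -> Y`_i \in h).
  by apply/homX/YX/mem_nth.
by exists (size Y), (in_tuple Y), w; split=> //; rewrite /basis_of YE Xfull eqxx.
Qed.
End Adjoint.

(** * The Killing form *)

Section Killing.
Variables (K : numFieldType) (g : lieAlg K) (D : triangular g).
Notation h := (cartan D).
Notation wt := (weight (cartan D)).
Variables (n : nat) (e : n.-tuple g) (w : 'I_n -> wt).
Hypothesis eB : homogeneous_basis e w.
Let K0 : forall n, (n%:R == 0 :> K) = (n == 0%N) := @pnatr_eq0 K.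

Lemma e_rspace (i : 'I_n) : e`_i \in rspace (w i). Proof. exact: (eB.2 i).1. Qed.
Lemma e_cartan (i : 'I_n) : w i = 0 -> e`_i \in h. Proof. exact: (eB.2 i).2. Qed.
Lemma e_sum x : x = \sum_i coord e i x *: e`_i.
Proof. by rewrite {1}(coord_basis eB.1 (memvf x)). Qed.
Lemma coord_e (i j : 'I_n) : coord e i e`_j = (i == j)%:R.
Proof. by rewrite coord_free 1?eq_sym //; case/andP: eB.1. Qed.

(** Comparison of the i-th coordinates of [t, x] and a(t) x, where ad t is diagonal in the basis. *)
Lemma coord_wt (a : wt) x i : x \in rspace a -> coord e i x != 0 -> w i = a.
Proof.
move=> /rspaceP xa xi; apply/lfunP => t; move/eqP: (xa t).
rewrite {1}(e_sum x) -subr_eq0 linear_sum {2}(e_sum x) scaler_sumr -sumrB => /eqP.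
move=> /(congr1 (coord e i)); rewrite linear_sum (bigD1 i) //= big1 => [|j ji].
  rewrite linear0 addr0 linearZ /= (rspaceP _ _ (e_rspace i)) scalerA scalerA -scalerBl.
  rewrite linearZ /= coord_e eqxx mulr1 [_ * w i t]mulrC -mulrBl.
  by move/eqP; rewrite mulf_eq0 (negPf xi) orbF subr_eq0 => /eqP.
rewrite linearZ /= (rspaceP _ _ (e_rspace j)) scalerA scalerA -scalerBl linearZ /=.
by rewrite coord_e eq_sym (negPf ji) mulr0.
Qed.

Lemma rspace0_cartan x : x \in rspace (0 : wt) -> x \in h.
Proof.
move=> x0; rewrite (e_sum x); apply: memv_suml => i _.
have [->|/(coord_wt x0) /e_cartan eh] := eqVneq (coord e i x) 0.
  by rewrite scale0r mem0v.
exact: memvZ.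
Qed.

Lemma root_basis (a : wt) x : x \in rspace a -> x != 0 -> exists i, w i = a.
Proof.
move=> xa; have [ex _|nex /eqP[]] := pselect (exists i, coord e i x != 0).
  by have [i /(coord_wt xa)] := ex; exists i.
rewrite (e_sum x) big1 // => i _; have [->|ni] := eqVneq (coord e i x) 0.
  by rewrite scale0r.
by case: nex; exists i.
Qed.

Lemma w_root i : w i != 0 -> w i \in roots D.
Proof.
move=> wi; rewrite rootsP wi /=; apply/eqP => E; have := e_rspace i.
rewrite E memv0 => /eqP ei0; have := coord_e i i.
by rewrite ei0 linear0 eqxx => /esym/eqP; rewrite oner_eq0.
Qed.

Lemma coord_lin (A : g -> g) i x : linear A ->
  coord e i (A x) = \sum_j coord e j x * coord e i (A e`_j).
Proof.
move=> Al; rewrite {1}(e_sum x).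
have AD (I : Type) (r : seq I) F : A (\sum_(j <- r) F j) = \sum_(j <- r) A (F j).
  elim: r => [|j r IH]; rewrite ?big_nil ?(linear_0 Al) // !big_cons -IH.
  by rewrite -[F j]scale1r Al !scale1r.
rewrite AD linear_sum; apply: eq_bigr => j _.
by rewrite -[_ *: _]addr0 Al (linear_0 Al) addr0 linearZ.
Qed.

(** This is tr(AB) = tr(BA) on the span of the basis vectors selected by [P], which A and B
    preserve. A proper [P] serves for traces over a root string, and [predT] for the properties of
    the Killing form. *)
Lemma ptraceC (P : pred 'I_n) (A B : g -> g) : linear A -> linear B ->
  (forall i j, P i -> coord e j (A e`_i) != 0 -> P j) ->
  (forall i j, P i -> coord e j (B e`_i) != 0 -> P j) ->
  \sum_(i | P i) coord e i (A (B e`_i)) = \sum_(i | P i) coord e i (B (A e`_i)).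
Proof.
move=> Al Bl PA PB; have E (A' B' : g -> g) : linear A' ->
    (forall i j, P i -> coord e j (B' e`_i) != 0 -> P j) ->
    \sum_(i | P i) coord e i (A' (B' e`_i)) =
    \sum_(i | P i) \sum_(j | P j) coord e j (B' e`_i) * coord e i (A' e`_j).
  move=> Al' PB'; apply: eq_bigr => i Pi; rewrite coord_lin //.
  rewrite (bigID P) /= [X in _ + X]big1 ?addr0 // => j nPj.
  have [->|/(PB' _ _ Pi) Pj] := eqVneq (coord e j (B' e`_i)) 0; first by rewrite mul0r.
  by rewrite Pj in nPj.
rewrite (E A B) // (E B A) // exchange_big; apply: eq_bigr => i _; apply: eq_bigr => j _.
exact: mulrC.
Qed.

Definition kil (x y : g) : K := \sum_i coord e i (brk x (brk y e`_i)).

Lemma brk_linear (x : g) : linear (brk x). Proof. exact: (brk_bilin g).2. Qed.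

Lemma kilC x y : kil x y = kil y x.
Proof. by apply: (ptraceC (P := predT)) => //; exact: brk_linear. Qed.

Lemma kil_linr x : linear (kil x : g -> K^o).
Proof.
move=> k y z; rewrite /kil scaler_sumr -big_split; apply: eq_bigr => i _ /=.
by rewrite brkDl brkZl brkDr brkZr linearD linearZ.
Qed.
HB.instance Definition _ x := GRing.isLinear.Build K g K^o *:%R (kil x) (kil_linr x).

Lemma kilDl x y z : kil (x + y) z = kil x z + kil y z.
Proof. by rewrite kilC raddfD /= !(kilC z). Qed.
Lemma kilZl k x z : kil (k *: x) z = k * kil x z.
Proof. by rewrite kilC linearZ /= (kilC z). Qed.

(** The two sides differ by the trace of the commutator of ad y with ad x ad z. *)
Lemma kil_inv x y z : kil (brk x y) z = kil x (brk y z).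
Proof.
have lin u v : linear (fun t : g => brk u (brk v t)).
  by move=> k s t; rewrite !brkDr !brkZr.
rewrite /kil; under eq_bigr do rewrite brk_brk linearB /=.
under [RHS]eq_bigr do rewrite brk_brk (linearB (brk x)) linearB /=.
rewrite !sumrB; congr (_ - _).
exact: (ptraceC (P := predT) (A := brk y) (B := fun t => brk x (brk z t)) (@brk_linear _)).
Qed.

Lemma kil_wt (a b : wt) x y : x \in rspace a -> y \in rspace b -> a + b != 0 -> kil x y = 0.
Proof.
move=> xa yb ab; rewrite /kil big1 // => i _; apply/eqP/negPn/negP => nz.
have := coord_wt (brk_rspace xa (brk_rspace yb (e_rspace i))) nz.
rewrite addrA -[X in X = _]add0r => /addIr E.
by rewrite -E eqxx in ab.
Qed.

Lemma brk_cartan (a : wt) x y : x \in rspace a -> y \in rspace (- a) -> brk x y \in h.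
Proof. by move=> xa ya; apply: rspace0_cartan; rewrite -(subrr a); exact: brk_rspace. Qed.

Lemma kil_cartan s t : s \in h -> t \in h -> kil s t = \sum_i ev (w i) s * ev (w i) t.
Proof.
move=> sh th; apply: eq_bigr => i _.
rewrite (brk_ev th (e_rspace i)) brkZr (brk_ev sh (e_rspace i)) !linearZ /= coord_e.
by rewrite eqxx mulr1 mulrC.
Qed.

(* The trace of ad [x, y] vanishes on the sum of the root spaces of the string
   (w j + Z a), which makes w j [x, y] a rational multiple of a [x, y]. *)
Lemma ev_brk_real (a : wt) x y j : x \in rspace a -> y \in rspace (- a) ->
  exists2 q, q \in Num.real & ev (w j) (brk x y) = q * ev a (brk x y).
Proof.
move=> xa ya; have th := brk_cartan xa ya; set t := brk x y in th *.
pose P : pred 'I_n := fun i => `[< exists k : int, w i = w j + a *~ k >].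
have Pj : P j by apply/asboolP; exists 0; rewrite mulr0z addr0.
have /choice[k kP] i : exists k : int, P i -> w i = w j + a *~ k.
  by case: (boolP (P i)) => [/asboolP[k ?]|_]; [exists k|exists 0].
have E : \sum_(i | P i) coord e i (brk t e`_i) = 0.
  under eq_bigr do rewrite brk_brk linearB /=.
  rewrite sumrB; apply/eqP; rewrite subr_eq0; apply/eqP/ptraceC; try exact: brk_linear.
  - move=> i l Pi /(coord_wt (brk_rspace xa (e_rspace i))) E.
    by apply/asboolP; exists (k i + 1); rewrite E mulrzDr mulr1z (kP i Pi) [LHS]addrC -!addrA.
  - move=> i l Pi /(coord_wt (brk_rspace ya (e_rspace i))) E.
    by apply/asboolP; exists (k i - 1); rewrite E mulrzBr mulr1z (kP i Pi) [LHS]addrC -!addrA.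
have {}E : \sum_(i | P i) (ev (w j) t + ev a t *~ k i) = 0.
  rewrite -[RHS]E; apply: eq_bigr => i Pi.
  rewrite (brk_ev th (e_rspace i)) linearZ /= coord_e eqxx mulr1 (kP i Pi) evD.
  by congr (_ + _); case: (k i) => m; rewrite ?NegzE ?mulrNz ?evN -!pmulrn evMn.
(* The vanishing trace reads #|P| w_j(t) + (sum of the k_i) a(t) = 0, to be solved for w_j(t). *)
exists (- ((\sum_(i | P i) k i)%:~R / #|P|%:R)).
  by rewrite realN realM ?realV ?realn ?realz.
have P0 : (#|P|%:R != 0 :> K) by rewrite K0 -lt0n; apply/card_gt0P; exists j.
apply: (mulfI P0); rewrite mulrA mulrN mulrCA divff // mulr1 mulNr.
apply/eqP; rewrite -addr_eq0 -[X in _ == X]E big_split /= sumr_const.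
by rewrite -mulrz_sumr mulrzl mulr_natl.
Qed.

Lemma kil_brk (a : wt) x y : x \in rspace a -> y \in rspace (- a) ->
  exists q : 'I_n -> K, [/\ forall i, q i \in Num.real,
    forall i, ev (w i) (brk x y) = q i * ev a (brk x y) &
    kil (brk x y) (brk x y) = ev a (brk x y) ^+ 2 * \sum_i q i ^+ 2].
Proof.
move=> xa ya; have /choice[q qP] i : exists q, q \in Num.real /\
    ev (w i) (brk x y) = q * ev a (brk x y).
  by have [q ? ?] := ev_brk_real i xa ya; exists q.
exists q; split=> [i|i|]; rewrite ?(qP i).1 ?(qP i).2 //.
have th := brk_cartan xa ya.
rewrite kil_cartan // mulr_sumr; apply: eq_bigr => i _.
by rewrite (qP i).2 -expr2 exprMn mulrC.
Qed.

(** Unless a([x, y]) is already 0, the sum of the squares of the real numbers q_i vanishes, hence so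
    does each q_i. As [a] is one of the w_i when x is nonzero, a([x, y]) = q_i a([x, y]) = 0. *)
Lemma kil_brk_eq0 (a : wt) x y : x \in rspace a -> y \in rspace (- a) ->
  kil (brk x y) (brk x y) = 0 -> ev a (brk x y) = 0.
Proof.
move=> xa ya; have [q [qr qe ->]] := kil_brk xa ya.
move/eqP; rewrite mulf_eq0 expf_eq0 => /orP[/andP[_ /eqP//]|].
have [->|x0] := eqVneq x 0; first by rewrite brk0l linear0.
have [i wi] := root_basis xa x0.
rewrite psumr_eq0 => [/allP /(_ i)|l _]; last by rewrite real_exprn_even_ge0.
rewrite mem_index_enum expf_eq0 => /(_ isT) /eqP qi0.
by have := qe i; rewrite wi qi0 mul0r.
Qed.
End Killing.

(** * Heights of roots *)

Lemma absz_ltD (s t : int) : s + t < 0 -> 0 < s -> (absz (s + t)%R < absz t)%N.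
Proof. lia. Qed.

Section Height.
Variables (K : numFieldType) (g : lieAlg K) (D : triangular g).
Notation wt := (weight (cartan D)).

(** An integer picked by [xget] with default 0; it is meaningful on weights with integral coordinate
    sum, in particular on roots and their sums. *)
Definition hgt (a : wt) : int :=
  xget 0 [set z : int | \sum_(i < size (simple_roots D)) scoord i a = z%:~R].

Lemma hgtE (a : wt) z : \sum_(i < size (simple_roots D)) scoord i a = z%:~R -> hgt a = z.
Proof.
move=> E; have : \sum_(i < size (simple_roots D)) scoord i a = (hgt a)%:~R.
  exact: (@xgetPex _ 0 [set z : int | \sum_(i < _) scoord i a = z%:~R] (ex_intro _ z E)).
by rewrite E => /intr_inj.
Qed.

Lemma scoord_sum_qsum (f : 'I_(size (simple_roots D)) -> nat) :
  \sum_i scoord i (qsum f) = (\sum_i f i)%N%:~R :> K.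
Proof.
rewrite -pmulrn natr_sum; apply: eq_bigr => i _.
by rewrite scoord_qsum.
Qed.

Lemma hgt_qsum f : hgt (qsum f) = (\sum_i f i)%N.
Proof. by apply: hgtE; exact: scoord_sum_qsum. Qed.

Lemma hgt_qsumN f : hgt (- qsum f) = - (\sum_i f i)%N%:Z.
Proof.
apply: hgtE; rewrite mulrNz -scoord_sum_qsum -[RHS]sumrN.
by apply: eq_bigr => i _; rewrite linearN.
Qed.

Lemma hgt_pos a : a \in pos_roots D -> 0 < hgt a.
Proof.
by move=> /pos_rootP[/root_neq0 a0 [f fE]]; rewrite fE hgt_qsum; apply: (@qsum_gt0 _ _ D); rewrite -fE.
Qed.

Lemma hgt_neg a : a \in neg_roots D -> hgt a < 0.
Proof.
move=> /neg_rootP[/root_neq0 a0 [f fE]].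
rewrite -(opprK a) fE hgt_qsumN oppr_lt0; apply: (@qsum_gt0 _ _ D).
by rewrite -fE oppr_eq0.
Qed.

Lemma hgt_root a : a \in roots D ->
  \sum_(i < size (simple_roots D)) scoord i a = (hgt a)%:~R.
Proof.
move=> /rootsE[/pos_rootP|/neg_rootP] [_ [f fE]].
  by rewrite fE hgt_qsum scoord_sum_qsum.
rewrite -(opprK a) fE hgt_qsumN mulrNz -scoord_sum_qsum -[RHS]sumrN.
by apply: eq_bigr => i _; rewrite linearN.
Qed.

Lemma hgtD a b : a \in roots D -> b \in roots D -> hgt (a + b) = hgt a + hgt b.
Proof.
move=> aR bR; apply: hgtE; rewrite rmorphD /= -!hgt_root // -big_split.
by apply: eq_bigr => i _; rewrite linearD.
Qed.
End Height.

(** * Nondegeneracy of the Killing form *)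

Section Nondegenerate.
Variables (K : numFieldType) (g : lieAlg K) (D : triangular g).
Variables (theta : chevalley D) (ss : semisimple g).
Notation h := (cartan D).
Notation wt := (weight (cartan D)).
Variables (n : nat) (e : n.-tuple g) (w : 'I_n -> wt).
Hypothesis eB : homogeneous_basis e w.

Let rad x := forall y, kil e x y = 0.

Let rad0 : rad 0. Proof. by move=> y; rewrite (kilC eB) linear0. Qed.
Let rad_lin k x y : rad x -> rad y -> rad (k *: x + y).
Proof. by move=> xr yr z; rewrite (kilDl eB) (kilZl eB) xr yr mulr0 addr0. Qed.
Let rad_brk z x : rad x -> rad (brk z x).
Proof.
move=> xr y; rewrite brkC -scaleN1r -[_ *: _]addr0 (kilDl eB) (kilZl eB) rad0.
by rewrite (kil_inv eB) xr mulr0 addr0.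
Qed.

(** If a(t) is nonzero for a simple root [a], then the root vector x = a(t)^-1 [t, x] lies in the
    radical, and so does the coroot s = [x, y]. But kil(s, s) = 0 forces a(s) = 0, whereas a(s) =
    2. *)
Let rad_cartan t : t \in h -> rad t -> t = 0.
Proof.
move=> th tr; apply: (ev_sep th) => a aS; apply/eqP/negPn/negP => at0.
have [x [y [s [[xa ya] [xy as2] _ _]]]] := chev_simple theta aS.
have xr : rad x.
  rewrite -[x]scale1r -(mulVf at0) -scalerA -[_ *: _]addr0; apply: rad_lin => //.
  by rewrite -(brk_ev th xa) brkC -scaleN1r -[_ *: _]addr0; apply/rad_lin/rad0/rad_brk.
have := kil_brk_eq0 eB xa ya; rewrite xy /ev vsvalK as2.
rewrite -xy brkC -scaleN1r -[_ *: _]addr0 (rad_lin _ (rad_brk _ _)) //.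
by move=> /(_ erefl)/eqP; rewrite pnatr_eq0.
Qed.

Let rad_root a x : x \in rspace a -> rad x -> x != 0 -> a \in roots D.
Proof.
move=> xa xr x0; have [i wi] := root_basis eB xa x0; rewrite -wi; apply: (w_root eB).
apply: contraNneq x0 => wi0; apply/eqP/rad_cartan => //.
by apply: (rspace0_cartan eB); rewrite -wi0 wi.
Qed.

Let gad_weight : weight_module D (gad g).
Proof.
move=> x; exists [seq (coord e i x *: e`_i : gad g) | i : 'I_n].
  move=> _ /mapP[i _ ->]; exists (w i); apply/rspace_gad/rspaceP => t.
  by rewrite brkZr (rspaceP _ _ (e_rspace eB i)) !scalerA mulrC.
by rewrite big_image /=; exact: (e_sum eB).
Qed.

Let rad_wcomp (a : wt) x : rad x -> rad (wcomp (M := gad g) a x).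
Proof.
have [S SP] := subcl_ex rad0 rad_lin => /SP xS; apply/SP.
by apply: (wcomp_stable gad_weight) => // t m /SP mr; apply/SP/rad_brk.
Qed.

Let killed (b : wt) v := [/\ v \in rspace b, rad v, v != 0 &
  forall a x, a \in pos_roots D -> x \in rspace a -> rad x -> brk x v = 0].

(** Take a weight vector of the radical of maximal height: a positive root vector would map it to 0
    or to a vector of the radical of larger height. *)
Let rad_killed x : rad x -> x != 0 -> exists2 b, b \in roots D & exists v, killed b v.
Proof.
move=> xr x0.
have ex : exists2 b, b \in roots D & exists v, [/\ v \in rspace b, rad v & v != 0].
  apply: contrapT => nex; case/eqP: x0.
  have [r rE] := wsupp gad_weight x; rewrite (rE (undup r)) ?undup_uniq //; last first.
    by move=> a; rewrite mem_undup.
  rewrite big1 // => a _; apply: contrapT => /eqP c0.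
  have ca : wcomp (M := gad g) a x \in rspace a.
    by apply/rspace_gad; exact: wcompw.
  case: nex; exists a; first exact: (rad_root ca (rad_wcomp a xr)).
  by exists (wcomp (M := gad g) a x); split=> //; exact: rad_wcomp.
have [b [bR [v [vb vr v0]] bmax]] := exists_min (fun a => - hgt a) ex.
exists b => //; exists v; split=> // a y aP ya yr.
apply: contrapT => /eqP yv0; have yvr := rad_brk y vr.
have yvab := brk_rspace ya vb.
have abR := rad_root yvab yvr yv0.
have := bmax _ abR (ex_intro _ _ (And3 yvab yvr yv0)).
rewrite lerN2 hgtD //; last by case/pos_rootP: aP.
by rewrite gerDr leNgt hgt_pos.
Qed.

(* Engel's theorem for a graded algebra with no component of degree 0: an
   element of the radical that is killed by its positive part and has minimal
   height is killed by the negative part as well. *)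
Let rad_center x : rad x -> x != 0 ->
  exists v, [/\ rad v, v != 0 & forall y, rad y -> brk y v = 0].
Proof.
move=> xr x0.
have [b [bR [v [vb vr v0 vpos]] bmin]] := exists_min (@hgt _ _ D) (rad_killed xr x0).
have vneg k : forall a y, a \in neg_roots D -> y \in rspace a -> rad y ->
    (`|hgt a| < k)%N -> brk y v = 0.
  elim: k => // k IH a y aN ya yr ak; apply: contrapT => /eqP yv0.
  have [aR _] := neg_rootP aN.
  have yvr := rad_brk y vr; have yvab := brk_rspace ya vb.
  have abR := rad_root yvab yvr yv0.
  have : killed (a + b) (brk y v).
    (* [z, [y, v]] = [[z, y], v] because z kills v. If [z, y] is nonzero, its weight is a positive
       root, or a negative one of smaller absolute height than [a], to which the induction
       applies. *)
    split=> // c z cP zc zr; rewrite -[brk z _]subr0 -[X in _ - X](brk0r y).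
    rewrite -[X in _ - brk y X](vpos c z cP zc zr) -brk_brk.
    have [->|zy0] := eqVneq (brk z y) 0; first exact: brk0l.
    have zyr := rad_brk z yr; have zyca := brk_rspace zc ya.
    have [cR _] := pos_rootP cP.
    have caR := rad_root zyca zyr zy0; have [caP|caN] := rootsE caR; first exact: vpos zyca zyr.
    apply: (IH _ _ caN zyca zyr (leq_trans _ (ak : (`|hgt a| <= k)%N))).
    by move: (hgt_neg caN); rewrite hgtD // => ca0; apply: absz_ltD; rewrite ?hgt_pos.
  move=> /(ex_intro _ _)/(bmin _ abR); rewrite hgtD // lerDr.
  by rewrite leNgt hgt_neg.
exists v; split=> // y yr; have [r rE] := wsupp gad_weight y.
rewrite (rE (undup r)) ?undup_uniq //; last by move=> a; rewrite mem_undup.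
elim: (undup r) => [|a s IH]; first by rewrite big_nil brk0l.
rewrite big_cons brkDl IH addr0.
have ca : wcomp (M := gad g) a y \in rspace a by apply/rspace_gad; exact: wcompw.
have [->|c0] := eqVneq (wcomp (M := gad g) a y) 0; first exact: brk0l.
have cr := rad_wcomp a yr.
have [aP|aN] := rootsE (rad_root ca cr c0); first exact: vpos ca cr.
exact: vneg aN ca cr (ltnSn _).
Qed.

(** A nonzero radical of the form would have a nonzero centre by [rad_center], and this centre is an
    ideal of [g] with zero derived algebra. *)
Lemma kil_nondegenerate x : (forall y, kil e x y = 0) -> x = 0.
Proof.
move=> xr; apply: contrapT => /eqP x0; have [v [vr /eqP v0 vc]] := rad_center xr x0; apply: v0.
pose Z z := rad z /\ forall y, rad y -> brk y z = 0.
have [||S SP] := @subcl_ex K g Z.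
- by split=> // y _; rewrite brk0r.
- move=> k u t [ur uc] [tr tc]; split=> [|y yr]; first exact: rad_lin.
  by rewrite brkDr brkZr uc // tc // scaler0 addr0.
have [I IS] := vspace_of S.
have IP z : z \in I <-> Z z by rewrite IS.
have : I = 0%VS.
  apply: ss => [y z /IP[zr zc]|].
    apply/IP; split=> [|u ur]; first exact: rad_brk.
    have uyr : rad (brk u y).
      by rewrite brkC -scaleN1r -[_ *: _]addr0; apply/rad_lin/rad0/rad_brk.
    by have := brk_brk u y z; rewrite (zc _ uyr) (zc _ ur) brk0r subr0.
  exists 1%N; apply/eqP; rewrite -subv0; apply/span_subvP.
  move=> _ /allpairsP[[y z] /= [/vbasis_mem/IP[yr _] /vbasis_mem/IP[_ zc] ->]].
  by rewrite zc // mem0v.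
move=> I0; apply/eqP; rewrite -memv0 -I0; by apply/IP; split.
Qed.
End Nondegenerate.

(** * The Casimir operator *)

Section Casimir.
Variables (K : numFieldType) (g : lieAlg K) (D : triangular g).
Notation h := (cartan D).
Notation wt := (weight (cartan D)).
Notation gmod := (gmod g).
Variables (n : nat) (e : n.-tuple g) (w : 'I_n -> wt).
Hypothesis eB : homogeneous_basis e w.
Hypothesis nondeg : forall x, (forall y, kil e x y = 0) -> x = 0.

Lemma kil_sumr (I : Type) (r : seq I) P x (F : I -> g) :
  kil e x (\sum_(i <- r | P i) F i) = \sum_(i <- r | P i) kil e x (F i).
Proof. exact: (raddf_sum (kil e x)). Qed.

Lemma kil_suml (I : Type) (r : seq I) P x (F : I -> g) :
  kil e (\sum_(i <- r | P i) F i) x = \sum_(i <- r | P i) kil e (F i) x.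
Proof. by rewrite (kilC eB) kil_sumr; apply: eq_bigr => i _; rewrite (kilC eB). Qed.

Lemma kilZr k x y : kil e x (k *: y) = k * kil e x y.
Proof. exact: linearZ. Qed.

(** The Gram matrix of the basis is invertible by nondegeneracy, and the rows of its inverse give
    the dual basis. *)
Lemma dual_basis_ex : exists e' : 'I_n -> g, forall i j : 'I_n, kil e (e' i) e`_j = (i == j)%:R.
Proof.
pose G : 'M[K]_n := \matrix_(i, j) kil e e`_i e`_j.
have Gu : G \in unitmx.
  rewrite -row_free_unit; apply: inj_row_free => v vG.
  have E : \sum_i v 0 i *: e`_i = 0.
    apply: nondeg => y; rewrite (e_sum eB y) kil_sumr big1 // => j _.
    rewrite kilZr kil_suml; have /matrixP/(_ 0 j) := vG; rewrite !mxE => E.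
    under eq_bigr do rewrite (kilZl eB).
    rewrite -[X in _ * X]/(\sum_i v 0 i * kil e e`_i e`_j).
    by under eq_bigr => i _ do (have -> : kil e e`_i e`_j = G i j by rewrite mxE); rewrite E mulr0.
  apply/rowP => i; rewrite mxE; have := congr1 (coord e i) E.
  rewrite linear0 linear_sum (bigD1 i) //= big1 => [|j ji].
    by rewrite linearZ /= (coord_e eB) eqxx mulr1 addr0.
  by rewrite linearZ /= (coord_e eB) eq_sym (negPf ji) mulr0.
exists (fun i => \sum_j invmx G i j *: e`_j) => i j; rewrite kil_suml.
under eq_bigr => l _ do (rewrite (kilZl eB); have -> : kil e e`_l e`_j = G l j by rewrite mxE).
by have := mulVmx Gu => /matrixP/(_ i j); rewrite !mxE.
Qed.

Variable e' : 'I_n -> g.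
Hypothesis e'P : forall i j : 'I_n, kil e (e' i) e`_j = (i == j)%:R.

Lemma dual_coord i x : kil e (e' i) x = coord e i x.
Proof.
rewrite {1}(e_sum eB x) kil_sumr (bigD1 i) //= big1 => [|j ji].
  by rewrite kilZr e'P eqxx mulr1 addr0.
by rewrite kilZr e'P eq_sym (negPf ji) mulr0.
Qed.

Lemma dual_sum y : y = \sum_(i < n) kil e e`_i y *: e' i.
Proof.
apply/eqP; rewrite -subr_eq0; apply/eqP/nondeg => z.
rewrite -scaleN1r addrC (kilDl eB) (kilZl eB) mulN1r kil_suml.
under eq_bigr => i _ do rewrite (kilZl eB) dual_coord (kilC eB) mulrC -kilZr.
by rewrite -kil_sumr -(e_sum eB) addNr.
Qed.

Lemma dual_rspace i : e' i \in rspace (- w i).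
Proof.
apply/rspaceP => t; apply/eqP; rewrite -subr_eq0; apply/eqP/nondeg => y.
rewrite -scaleN1r scalerA (kilDl eB) (kilZl eB) (e_sum eB y) !kil_sumr mulr_sumr -big_split.
rewrite big1 // => j _; rewrite !kilZr (brkC (vsval t)) -scaleN1r (kilZl eB) (kil_inv eB).
rewrite (rspaceP _ _ (e_rspace eB j)) kilZr e'P opp_lfunE !mulN1r opprK.
rewrite /=; have [<-|_] := eqVneq i j; last by rewrite !(mulr0, oppr0, addr0).
by rewrite !mulr1 mulrN [_ * w i t]mulrC addNr.
Qed.

Definition casimir_fun (M : gmod) (m : M) : M := \sum_(i < n) act e`_i (act (e' i) m).

Lemma casimir_linear (M : gmod) : linear (@casimir_fun M).
Proof.
move=> k u v; rewrite /casimir_fun scaler_sumr -big_split.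
by apply: eq_bigr => i _ /=; rewrite !linearP.
Qed.

Lemma actMl (M : gmod) (I : Type) (r : seq I) (k : I -> K) (F : I -> g) (m : M) :
  act (\sum_(i <- r) k i *: F i) m = \sum_(i <- r) k i *: act (F i) m.
Proof.
elim: r => [|i r IH]; first by rewrite !big_nil act0l.
by rewrite !big_cons actDl actZl IH.
Qed.

Lemma act_sumr (M : gmod) (I : Type) (r : seq I) x (F : I -> M) :
  act x (\sum_(i <- r) F i) = \sum_(i <- r) act x (F i).
Proof. exact: linear_sum. Qed.

(** The commutator with x is the sum of the [x, e_i] e'_i + e_i [x, e'_i]. Expanding the brackets in
    the two dual bases gives opposite coefficients, by invariance of the form. *)
Lemma casimir_act (M : gmod) x (m : M) : casimir_fun (act x m) = act x (casimir_fun m).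
Proof.
apply/esym/eqP; rewrite -subr_eq0 /casimir_fun act_sumr -sumrB; apply/eqP.
transitivity (\sum_(i < n) (act (brk x e`_i) (act (e' i) m) + act e`_i (act (brk x (e' i)) m))).
  apply: eq_bigr => i _; rewrite act_swap (act_swap x (e' i)) linearD /=.
  by rewrite addrA addrK.
rewrite big_split /=.
have -> : \sum_(i < n) act (brk x e`_i) (act (e' i) m) =
    \sum_(i < n) \sum_(j < n) kil e (e' i) (brk x e`_j) *: act e`_i (act (e' j) m).
  rewrite exchange_big; apply: eq_bigr => j _.
  rewrite {1}(e_sum eB (brk x e`_j)) actMl; apply: eq_bigr => i _.
  by rewrite dual_coord.
have -> : \sum_(i < n) act e`_i (act (brk x (e' i)) m) =
    \sum_(i < n) \sum_(j < n) kil e e`_j (brk x (e' i)) *: act e`_i (act (e' j) m).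
  apply: eq_bigr => i _; rewrite {1}(dual_sum (brk x (e' i))) actMl act_sumr.
  by apply: eq_bigr => j _; rewrite linearZ.
rewrite -big_split big1 // => i _; rewrite -big_split big1 // => j _ /=.
have -> : kil e e`_j (brk x (e' i)) = - kil e (e' i) (brk x e`_j).
  by rewrite -(kil_inv eB) brkC -scaleN1r (kilZl eB) mulN1r (kilC eB).
by rewrite scaleNr addrN.
Qed.

Definition casimir_ghom (M : gmod) : ghom M M :=
  Ghom (@casimir_linear M) (@casimir_act M).

Lemma casimir_map (M N : gmod) (f : ghom M N) m :
  f (casimir_ghom M m) = casimir_ghom N (f m).
Proof.
rewrite /= /casimir_fun linear_sum; apply: eq_bigr => i _ /=.
by rewrite !ghom_act.
Qed.

(** For the form induced on weights this is (mu, 2 rho), since [e_i, e'_i] represents the root w_i;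
    [casimir_value] below is then (mu, mu + 2 rho). *)
Definition casimir_lin (mu : wt) : K :=
  \sum_(i | w i \in pos_roots D) ev mu (brk e`_i (e' i)).
(** The element t_nu of h that represents [nu] with respect to the Killing form, see
    [cartan_dualP]. *)
Definition cartan_dual (nu : wt) : g := \sum_(i | w i == 0) ev nu e`_i *: e' i.
Definition casimir_value (mu : wt) : K := ev mu (cartan_dual mu) + casimir_lin mu.

Lemma dual_cartan i : w i = 0 -> e' i \in h.
Proof. by move=> wi; apply: (rspace0_cartan eB); rewrite -oppr0 -wi dual_rspace. Qed.

Lemma cartan_dual_in nu : cartan_dual nu \in h.
Proof. by apply: memv_suml => i /eqP/dual_cartan; exact: memvZ. Qed.

(** The terms of weight 0 yield (mu, mu). For w_i positive, e_i kills m, so e_i e'_i m = [e_i, e'_i]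
    m; for w_i negative, e'_i is a positive root vector and kills m. *)
Lemma casimir_singular (M : gmod) (mu : wt) (m : M) : wspace M mu m ->
  (forall a x, a \in pos_roots D -> x \in rspace a -> act x m = 0) ->
  casimir_ghom M m = casimir_value mu *: m.
Proof.
move=> mw mpos; rewrite /casimir_value scalerDl /= /casimir_fun.
rewrite (bigID (fun i => w i == 0)) /=; congr (_ + _).
  rewrite /cartan_dual linear_sum scaler_suml; apply: eq_bigr => i /eqP wi.
  rewrite (act_ev (dual_cartan wi) mw) linearZ /= (act_ev (e_cartan eB wi) mw) scalerA.
  by rewrite evZr mulrC.
rewrite /casimir_lin scaler_suml (bigID (fun i => w i \in pos_roots D)) /=.
rewrite [X in _ + X]big1 ?addr0 => [|i /andP[wi0 wip]].
  rewrite (eq_bigl (fun i => w i \in pos_roots D)) => [|i]; last first.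
    rewrite andb_idl // => /pos_rootP[/root_neq0]; exact.
  apply: eq_bigr => i wip.
  rewrite act_swap (mpos _ _ wip (e_rspace eB i)) linear0 addr0.
  by apply: act_ev mw; exact: (brk_cartan eB (e_rspace eB i) (dual_rspace i)).
have [->|e0] := eqVneq (e' i) 0; first by rewrite act0l linear0.
rewrite (mpos (- w i) (e' i)) ?linear0 ?dual_rspace // mem_filter.
have [j wj] := root_basis eB (dual_rspace i) e0.
have wiR : - w i \in roots D by rewrite -wj (w_root eB) // wj oppr_eq0.
rewrite wiR andbT; apply/asboolP.
have /rootsE[wP|] := w_root eB wi0; first by rewrite wP in wip.
by rewrite mem_filter => /andP[/asboolP].
Qed.

Lemma cartan_dualP (nu : wt) x : x \in h -> kil e (cartan_dual nu) x = ev nu x.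
Proof.
move=> xh; rewrite kil_suml {2}(e_sum eB x) linear_sum [RHS](bigID (fun i => w i == 0)) /=.
rewrite [X in _ = _ + X]big1 ?addr0 => [|i wi].
  by apply: eq_bigr => i _; rewrite (kilZl eB) dual_coord evZr mulrC.
have [->|ci] := eqVneq (coord e i x) 0; first by rewrite scale0r linear0.
by rewrite (coord_wt eB (cartan_rspace0 xh) ci) eqxx in wi.
Qed.

Lemma kil_cartan_inj x : x \in h -> (forall y, y \in h -> kil e x y = 0) -> x = 0.
Proof.
move=> xh x0; apply: nondeg => y; rewrite (e_sum eB y) kil_sumr big1 // => i _.
rewrite kilZr; have [/(e_cartan eB)/x0 ->|wi] := eqVneq (w i) 0; first by rewrite mulr0.
by rewrite (kil_wt eB (cartan_rspace0 xh) (e_rspace eB i)) ?mulr0 ?add0r.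
Qed.

Lemma cartan_dual_uniq (nu : wt) t : t \in h ->
  (forall x, x \in h -> kil e t x = ev nu x) -> cartan_dual nu = t.
Proof.
move=> th tP; apply/eqP; rewrite -subr_eq0 -scaleN1r addrC; apply/eqP/kil_cartan_inj.
  by rewrite memvD ?memvZ ?cartan_dual_in.
move=> y yh; rewrite (kilDl eB) (kilZl eB) cartan_dualP // tP // mulN1r addNr //.
Qed.

Lemma cartan_dual_linear : linear cartan_dual.
Proof.
move=> k a b; apply: cartan_dual_uniq => [|x xh].
  by rewrite memvD ?memvZ ?cartan_dual_in.
by rewrite (kilDl eB) (kilZl eB) !cartan_dualP // ev_lfun.
Qed.

Lemma ev_cartan_dualC (mu nu : wt) : ev mu (cartan_dual nu) = ev nu (cartan_dual mu).
Proof.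
by rewrite -(cartan_dualP mu) ?cartan_dual_in // (kilC eB) cartan_dualP ?cartan_dual_in.
Qed.

(** From kil(t_nu, t) = sum of the w_i(t_nu) w_i(t). It bounds [nu] as soon as the numbers w_i(t_nu)
    are bounded. *)
Lemma weight_expand (nu : wt) : nu = \sum_i ev (w i) (cartan_dual nu) *: w i.
Proof.
apply/lfunP => t; have th : vsval t \in h := subvsP t.
have E (a : wt) : a t = ev a (vsval t) by rewrite /ev vsvalK.
rewrite !E ev_sum -(cartan_dualP nu th) (kil_cartan eB) ?cartan_dual_in //.
by apply: eq_bigr => i _; rewrite evZ.
Qed.

Lemma cartan_dual_norm (nu : wt) :
  ev nu (cartan_dual nu) = \sum_i ev (w i) (cartan_dual nu) ^+ 2.
Proof.
rewrite -(cartan_dualP nu) ?cartan_dual_in // (kil_cartan eB) ?cartan_dual_in //.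
Qed.

(** Here t_a = [e_l, e'_l] for a root vector e_l of weight [a], and w_i(t_a) = q_i a(t_a) with q_i
    real. Moreover a(t_a) = kil(t_a, t_a) is a(t_a)^2 times the sum of the q_i^2, so a(t_a) is 0 or
    the inverse of that sum. *)
Lemma cartan_dual_simple_real a i : a \in simple_roots D ->
  ev (w i) (cartan_dual a) \in Num.real.
Proof.
move=> /simple_roots_sub; rewrite rootsP => /andP[_].
rewrite -vpick0 => v0; have [l wl] := root_basis eB (memv_pick _) v0.
have xa : e`_l \in rspace a by rewrite -wl; exact: (e_rspace eB).
have ya : e' l \in rspace (- a) by rewrite -wl; exact: dual_rspace.
have th := brk_cartan eB xa ya.
have tE : cartan_dual a = brk e`_l (e' l).
  apply: cartan_dual_uniq => // z zh; rewrite (kil_inv eB) brkC -scaleN1r kilZr.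
  by rewrite (brk_ev zh ya) kilZr evN (kilC eB) e'P eqxx mulr1 mulN1r opprK.
have [q [qr qe kq]] := kil_brk eB xa ya; rewrite -tE in qe kq.
rewrite qe realM //.
have Sr : \sum_i q i ^+ 2 \in Num.real by apply: rpred_sum => j _; exact: realX.
move: kq; rewrite cartan_dualP ?cartan_dual_in //.
have [-> //|A0] := eqVneq (ev a (cartan_dual a)) 0.
rewrite -[X in X = _]mulr1 expr2 -mulrA => /(mulfI A0) /esym AS.
have S0 : \sum_i q i ^+ 2 != 0.
  by apply: contra_eq_neq AS => ->; rewrite mulr0 eq_sym oner_eq0.
have -> : ev a (cartan_dual a) = (\sum_i q i ^+ 2)^-1 by apply: (mulIf S0); rewrite AS mulVf.
by rewrite realV.
Qed.

Lemma cartan_dual_qsum_real f i : ev (w i) (cartan_dual (qsum (D := D) f)) \in Num.real.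
Proof.
pose F (nu : wt) := ev (w i) (cartan_dual nu).
have Fl : linear (F : wt -> K^o) by move=> k a b; rewrite /F cartan_dual_linear linearP.
rewrite -/(F _) /qsum; elim/big_rec: _ => [|j x _ xr].
  by rewrite (linear_0 Fl) real0.
have -> : F ((simple_roots D)`_j *+ f j + x) = (f j)%:R * F (simple_roots D)`_j + F x.
  by rewrite -scaler_nat Fl.
by rewrite realD // realM ?realn // cartan_dual_simple_real // mem_nth.
Qed.

(* On a level set, sum_i |b_i|^2 = sum_i d_i b_i + const for the real numbers
   b_i = w_i (t_nu), which bounds the b_i, hence the coordinates of nu. *)
Lemma casimir_value_finite (arch : forall x : K, exists m : nat, `|x| <= m%:R)
    (la : wt) (k : K) :
  exists P : seq wt, forall mu, Qp (la - mu) -> casimir_value mu = k -> mu \in P.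
Proof.
(* With nu = la - mu and b_i = w_i(t_nu), the condition on mu says that the sum of the b_i^2 is the
   sum of the b_i d_i plus [k0]. [S0] comes from |b_i| (C + 1) <= |b_i|^2 + ((C + 1) / 2)^2, where C
   + 1 exceeds by 1 the constant that bounds the linear term. *)
pose d i := 2%:R * ev (w i) (cartan_dual la) + casimir_lin (w i).
pose k0 := k - casimir_value la.
pose C : K := \sum_i `|d i|; pose S0 : K := `|k0| + n%:R * ((C + 1) / 2%:R) ^+ 2.
have C0 : 0 <= C by apply: sumr_ge0.
have bnd f : casimir_value (la - qsum f) = k ->
    \sum_i `|ev (w i) (cartan_dual (qsum f))| <= S0.
  set nu := qsum f => E; pose b i := ev (w i) (cartan_dual nu).
  rewrite -/(\sum_i `|b i|); set s := \sum_i `|b i|.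
  have br i : b i \in Num.real by exact: cartan_dual_qsum_real.
  have Lsum : casimir_lin nu = \sum_i b i * casimir_lin (w i).
    rewrite /casimir_lin {1}(weight_expand nu) -/b.
    under eq_bigr do rewrite ev_sum.
    rewrite exchange_big; apply: eq_bigr => i _; rewrite mulr_sumr.
    by apply: eq_bigr => j _; rewrite evZ.
  have LB a c : casimir_lin (a - c) = casimir_lin a - casimir_lin c.
    rewrite /casimir_lin -sumrB; apply: eq_bigr => i _.
    by rewrite evD evN.
  have dB a c : cartan_dual (a - c) = cartan_dual a - cartan_dual c.
    by rewrite addrC -scaleN1r cartan_dual_linear scaleN1r addrC.
  have Q : \sum_i b i ^+ 2 = \sum_i b i * d i + k0.
    rewrite -cartan_dual_norm.
    have -> : \sum_i b i * d i = 2%:R * ev nu (cartan_dual la) + casimir_lin nu.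
      rewrite Lsum {1}(weight_expand nu) ev_sum -/b mulr_sumr -big_split.
      by apply: eq_bigr => i _; rewrite evZ /d mulrDr mulrCA.
    rewrite /k0 -E /casimir_value LB dB !evD !evN !linearB /= (ev_cartan_dualC la nu).
    ring.
  have sq : s * (C + 1) <= \sum_i b i ^+ 2 + n%:R * ((C + 1) / 2%:R) ^+ 2.
    have -> : n%:R * ((C + 1) / 2%:R) ^+ 2 = \sum_(i < n) ((C + 1) / 2%:R) ^+ 2.
      by rewrite sumr_const card_ord mulr_natl.
    rewrite -big_split mulr_suml; apply: ler_sum => i _ /=.
    rewrite -(real_normK (br i)) -subr_ge0.
    have -> : `|b i| ^+ 2 + ((C + 1) / 2%:R) ^+ 2 - `|b i| * (C + 1) =
        (`|b i| - (C + 1) / 2%:R) ^+ 2 by field.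
    by rewrite real_exprn_even_ge0 // realB ?normr_real // realM ?realV ?realn // realD ?ger0_real.
  have le : \sum_i b i ^+ 2 <= C * s + `|k0|.
    rewrite -[X in X <= _]ger0_norm; last first.
      by apply: sumr_ge0 => i _; rewrite real_exprn_even_ge0.
    rewrite Q; apply: le_trans (ler_normD _ _) _; rewrite lerD2r.
    apply: le_trans (ler_norm_sum _ _ _) _; rewrite /C mulr_suml; apply: ler_sum => i _.
    rewrite normrM mulrC ler_wpM2l // /s (bigD1 i) //= lerDl.
    by apply: sumr_ge0.
  have := le_trans sq (lerD le (lexx _)).
  by rewrite mulrDr mulr1 [s * C]mulrC -addrA lerD2l.
have /choice[N hN] (j : 'I_(size (simple_roots D))) : exists N : nat,
    forall f, casimir_value (la - qsum f) = k -> (f j < N.+1)%N.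
  have [N hN] := arch (S0 * \sum_i `|scoord j (w i)|); exists N => f fk.
  have T0 : 0 <= \sum_i `|scoord j (w i)| by apply: sumr_ge0.
  have S00 : 0 <= S0 by apply: le_trans (bnd f fk); apply: sumr_ge0.
  rewrite ltnS -(ler_nat K) -(scoord_qsum j f); apply: le_trans hN.
  rewrite [X in _ <= X]ger0_norm ?mulr_ge0 //.
  rewrite -[X in X <= _]ger0_norm; last by rewrite scoord_qsum ler0n.
  rewrite {1}(weight_expand (qsum f)) linear_sum.
  apply: le_trans (ler_norm_sum _ _ _) _.
  apply: le_trans (ler_wpM2r T0 (bnd f fk)); rewrite mulr_suml; apply: ler_sum => i _.
  rewrite linearZ normrM ler_wpM2l // (bigD1 i) //= lerDl.
  by apply: sumr_ge0.
exists [seq la - qsum (fun i => f i) |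
    f : {ffun 'I_(size (simple_roots D)) -> 'I_(\sum_i N i).+1}] => mu [f fE] muk.
have muE : mu = la - qsum f by rewrite -fE opprB addrC subrK.
have fN i : (f i < (\sum_i N i).+1)%N.
  rewrite muE in muk; rewrite ltnS (leq_trans (hN i f muk : (f i <= N i)%N)) //.
  by rewrite (bigD1 i) //= leq_addr.
apply/mapP; exists [ffun i => Ordinal (fN i)]; first by rewrite mem_enum.
by rewrite muE; congr (_ - _); apply: eq_bigr => i _; rewrite ffunE.
Qed.
End Casimir.

(** The interface with the study of O: the basis of [g] used to build the Casimir operator no longer
    appears. *)
Theorem casimir_ex (K : numFieldType) (g : lieAlg K) (D : triangular g)
    (theta : chevalley D) (ss : semisimple g)
    (arch : forall x : K, exists m : nat, `|x| <= m%:R) :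
  exists (Om : forall M : gmod g, ghom M M) (c : weight (cartan D) -> K),
  [/\ forall (M N : gmod g) (f : ghom M N) m, f (Om M m) = Om N (f m),
      forall (M : gmod g) mu (m : M), wspace M mu m ->
        (forall a x, a \in pos_roots D -> x \in rspace a -> act x m = 0) ->
        Om M m = c mu *: m &
      forall la k, exists P : seq (weight (cartan D)), forall mu,
        Qp (la - mu) -> c mu = k -> mu \in P].
Proof.
have [n [e [w eB]]] := homogeneous_basis_ex D.
have nd := kil_nondegenerate theta ss eB.
have [e' e'P] := dual_basis_ex eB nd.
exists (casimir_ghom eB nd e'P), (casimir_value e w e').
split=> *; [exact: casimir_map|exact: casimir_singular|exact: casimir_value_finite].
Qed.

(** * Weight control and finite length *)

Section WeightControl.
Variables (K : numFieldType) (g : lieAlg K) (D : triangular g).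
Notation h := (cartan D).
Notation wt := (weight (cartan D)).
Notation gmod := (gmod g).
Let K0 : forall n, (n%:R == 0 :> K) = (n == 0%N) := @pnatr_eq0 K.

Lemma fdw_spanning (M : gmod) : fdw D M -> exists f : wt -> seq M,
  (forall a v, v \in f a -> wspace M a v) /\
  (forall a m, wspace M a m -> inspan (f a) m).
Proof.
move=> Mf; have /choice[f fP] (a : wt) : exists s : seq M, (forall v, v \in s -> wspace M a v) /\
    (forall m, wspace M a m -> inspan s m).
  have [s sP] := Mf a; have [S SP] := wspace_sub M a.
  have [s' s'S s's] := fd_sub S s; exists s'; split=> [v /s'S/SP //|m ma].
  by apply: s's; [exact: sP|exact/SP].
by exists f; split=> a; [exact: (fP a).1|exact: (fP a).2].
Qed.

(** A finite list of weights that detects every strict inclusion of submodules. With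
    finite-dimensional weight spaces it bounds the length of M, and for M in O it is inherited by
    submodules and by the star dual. *)
Definition weight_control (M : gmod) (P : seq wt) := forall S T : submod M,
  {subset S <= T} ->
  (forall a m, a \in P -> wspace M a m -> m \in T -> m \in S) -> {subset T <= S}.

Lemma wcomp_submod (M : gmod) (S : submod M) (a : wt) m :
  weight_module D M -> m \in S -> wcomp a m \in S.
Proof. by move=> Mw; apply: wcomp_stable => // t v; exact: submod_act. Qed.

Lemma submod_weights (M : gmod) (S T : submod M) : weight_module D M ->
  (forall (a : wt) m, wspace M a m -> m \in T -> m \in S) -> {subset T <= S}.
Proof.
move=> Mw ST m mT; have [r rE] := wsupp Mw m.
rewrite (rE (undup r)) ?undup_uniq => [|//|a]; last by rewrite mem_undup.
apply: rpred_sum => a _; apply: (ST a); first exact: wcompw.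
exact: wcomp_submod.
Qed.

Lemma poly_roots_list (p : {poly K}) : p != 0 ->
  exists rs : seq K, forall x, root p x -> x \in rs.
Proof.
move: {2}(size p) (leqnn (size p)) => n; elim: n p => [|n IH] p.
  by rewrite leqn0 size_poly_eq0 => ->.
move=> sp p0; have [[x px]|nex] := pselect (exists x, root p x); last first.
  by exists [::] => x px; case: nex; exists x.
have [q qE] := factor_theorem _ _ px.
have q0 : q != 0 by apply: contra_neq p0 => q0; rewrite qE q0 mul0r.
have [|rs rsP] := IH q _ q0.
  by move: sp; rewrite qE size_Mmonic ?monicXsubC // size_XsubC addn2.
exists (x :: rs) => y; rewrite qE rootM root_XsubC inE orbC => /orP[->//|/rsP ->].
by rewrite orbT.
Qed.

Section Casimir.
Variables (Om : forall M : gmod, ghom M M) (c : wt -> K).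
Hypothesis Om_map : forall (M N : gmod) (f : ghom M N) m, f (Om M m) = Om N (f m).
Hypothesis Om_singular : forall (M : gmod) mu (m : M), wspace M mu m ->
  (forall a x, a \in pos_roots D -> x \in rspace a -> act x m = 0) ->
  Om M m = c mu *: m.
Hypothesis Om_finite : forall la k, exists P : seq wt, forall mu,
  Qp (la - mu) -> c mu = k -> mu \in P.

Definition opoly (M : gmod) (p : {poly K}) (m : M) : M :=
  \sum_(i < size p) p`_i *: iter i (Om M) m.

Lemma iter_Om_lin (M : gmod) i : linear (iter i (Om M)).
Proof. by elim: i => [//|i IH] k u v /=; rewrite IH linearP. Qed.

Lemma opoly_lin (M : gmod) p : linear (@opoly M p).
Proof.
move=> k u v; rewrite /opoly scaler_sumr -big_split; apply: eq_bigr => i _ /=.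
by rewrite iter_Om_lin scalerDr !scalerA mulrC.
Qed.

Lemma iter_Om_map (M N : gmod) (f : ghom M N) i m :
  f (iter i (Om M) m) = iter i (Om N) (f m).
Proof. by elim: i => //= i <-; rewrite Om_map. Qed.

Lemma opoly_map (M N : gmod) (f : ghom M N) p m : f (opoly p m) = opoly p (f m).
Proof.
rewrite /opoly linear_sum; apply: eq_bigr => i _.
by rewrite linearZ /= iter_Om_map.
Qed.

Lemma opoly_act (M : gmod) p x (m : M) : opoly p (act x m) = act x (opoly p m).
Proof.
rewrite /opoly linear_sum; apply: eq_bigr => i _.
rewrite linearZ /=; congr (_ *: _); elim: (nat_of_ord i) => //= j ->.
exact: ghom_act.
Qed.

Lemma opoly_eigen (M : gmod) p k (m : M) : Om M m = k *: m -> opoly p m = p.[k] *: m.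
Proof.
move=> E; rewrite /opoly horner_coef scaler_suml; apply: eq_bigr => i _.
rewrite -scalerA; congr (_ *: _); elim: (nat_of_ord i) => [|j /= ->].
  by rewrite expr0 scale1r.
by rewrite linearZ /= E scalerA -exprSr.
Qed.

(** Cayley-Hamilton for a matrix of [Om] on the family [W]. As [W] may be linearly dependent, the
    matrix is a choice. *)
Lemma opoly_kills (M : gmod) (W : seq M) : (forall v, v \in W -> inspan W (Om M v)) ->
  exists2 p : {poly K}, p != 0 & forall v, inspan W v -> opoly p v = 0.
Proof.
(* The vector 0 is prepended so that the matrices have size n.+1 and form a ring even if [W] is
   empty. *)
move=> WO; pose W' := 0 :: W; pose n := size W.
have /choice[A0 AE] (i : 'I_n.+1) : exists u : 'rV[K]_n.+1, Om M W'`_i = lincomb (s := W') u.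
  have : inspan W' (Om M W'`_i); last by case=> u ->; exists u.
  have : W'`_i \in W' by rewrite mem_nth.
  rewrite inE => /predU1P[->|/WO]; first by rewrite linear0; exact: inspan0.
  by apply: inspan_mono => v vW; rewrite inE vW orbT.
pose A : 'M[K]_n.+1 := \matrix_(i, j) A0 i 0 j.
have OA (i : 'I_n.+1) : Om M W'`_i = \sum_(j < n.+1) A i j *: W'`_j.
  by rewrite AE; apply: eq_bigr => j _; rewrite mxE.
have OAk k (i : 'I_n.+1) : iter k (Om M) W'`_i = \sum_(j < n.+1) (A ^+ k) i j *: W'`_j.
  elim: k => [|k IH] /=.
    rewrite expr0 (bigD1 i) //= big1 => [|j ji]; first by rewrite mxE eqxx scale1r addr0.
    by rewrite mxE eq_sym (negPf ji) scale0r.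
  rewrite IH linear_sum exprSr /=; under eq_bigr do rewrite linearZ /= OA scaler_sumr.
  rewrite exchange_big; apply: eq_bigr => j _; rewrite mxE scaler_suml.
  by apply: eq_bigr => l _; rewrite scalerA.
exists (char_poly A); first exact/monic_neq0/char_poly_monic.
have pW (i : 'I_n.+1) : opoly (char_poly A) W'`_i = 0.
  rewrite /opoly; under eq_bigr do rewrite OAk scaler_sumr.
  rewrite exchange_big big1 // => j _.
  have /matrixP/(_ i j) := Cayley_Hamilton A.
  rewrite /horner_mx /horner_morph horner_coef size_map_poly mxE summxE => E.
  apply: etrans (etrans (congr1 (fun k => k *: W'`_j) E) (scale0r _)).
  rewrite scaler_suml; apply: eq_bigr => k _.
  by rewrite coef_map /= -[_ * _]/(_ *m _) mul_scalar_mx mxE scalerA.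
have [S SP] := subcl_ex (linear_0 (@opoly_lin M (char_poly A)))
  (fun a u v (hu : opoly (char_poly A) u = 0) (hv : opoly (char_poly A) v = 0) =>
    etrans (opoly_lin _ a u v) (etrans (congr2 (fun x y => a *: x + y) hu hv)
      (etrans (addr0 _) (scaler0 _ _)))).
move=> v vW; apply/SP; apply: inspan_sub vW => x; rewrite -index_mem => lt.
have xW : x \in W by rewrite -index_mem.
by apply/SP; have := pW (Ordinal (lt : ((index x W).+1 < n.+1)%N)); rewrite /= nth_index.
Qed.

(** The generators lie in finitely many finite-dimensional weight spaces, which [Om] preserves, so
    some nonzero polynomial p in [Om] kills them and hence M. A singular vector of weight b in a
    subquotient then has c(b) among the roots of p, and b lies in one of finitely many cones; the
    finitely many such b are contained in the list. *)
Lemma inO_control (M : gmod) : inO D M -> exists P, weight_control M P.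
Proof.
move=> MO; have [s [r [sw sg]]] := inO_generators MO; have Mw := MO.1.
have Mr := bounded_gen Mw sw sg; have Mf := fdw_gen K0 Mw sw sg.
have [f [fw fs]] := fdw_spanning Mf.
pose W := flatten [seq f a | a <- r].
have fW a v : a \in r -> inspan (f a) v -> inspan W v.
  by move=> ar; apply: inspan_mono => x xf; apply/flattenP; exists (f a); rewrite ?map_f.
have [|p p0 pW] := @opoly_kills M W.
  move=> v /flattenP[_ /mapP[a ar ->] /fw va]; apply: (fW _ _ ar); apply: fs.
  exact: wspace_map.
have pM (m : M) : opoly p m = 0.
  have [||S SP] := @subcl_ex K M (fun m => opoly p m = 0).
  - exact: linear_0 (@opoly_lin M p).
  - by move=> k u v hu hv; rewrite opoly_lin hu hv scaler0 addr0.
  apply/SP; apply: sg => [x v _ /SP vS|v /sw[a ar va]]; apply/SP.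
    by rewrite opoly_act vS linear0.
  exact/pW/(fW _ _ ar)/fs.
have [rs rsP] := poly_roots_list p0.
have /choice[F FP] (lk : wt * K) : exists P : seq wt, forall mu,
  Qp (lk.1 - mu) -> c mu = lk.2 -> mu \in P by exact: Om_finite.
exists (flatten [seq F (la, k) | la <- r, k <- rs]) => S T ST PT.
apply: (submod_weights Mw) => a v va vT.
have key b m : wspace M b m -> m \notin S ->
    (forall d x, d \in pos_roots D -> x \in rspace d -> act x m \in S) ->
    exists la k, [/\ la \in r, k \in rs, Qp (la - b) & c b = k].
  move=> mb mS mpos; have [q [_ qE]] := gquot_surj S.
  have qm0 : q m != 0 by apply: contra mS => /eqP; rewrite qE => /qpi0.
  have m0 : m <> 0 by move=> m0; rewrite m0 linear0 eqxx in qm0.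
  have [la lar lb] := Mr _ _ mb m0; exists la, (c b); split=> //; apply: rsP.
  have Oq := Om_singular (wspace_map q mb) (fun d x dP xd =>
    etrans (esym (ghom_act q x m)) (etrans (qE _) ((qpi0 S _).2 (mpos d x dP xd)))).
  have := opoly_eigen p Oq; rewrite -opoly_map pM linear0 => /esym/eqP.
  by rewrite scaler_eq0 (negPf qm0) orbF.
have [N0 hN0] := height_bound K0 r a.
(* Induction on the height of [a] below the weights in [r]: positive root vectors map [v] into [S]
   by induction, so [v] is singular modulo [S] and its weight is in the list. *)
have : forall la f, la \in r -> la - a = qsum f -> (\sum_i f i < N0.+1)%N.
  by move=> la fl lar; rewrite ltnS; exact: hN0.
elim: (N0.+1) a v va vT {hN0} => [|N IH] a v va vT Na; apply/negPn/negP => vS;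
  have v0 : v <> 0 by [move=> v0; rewrite v0 rpred0 in vS].
  by have [la lar [fl flE]] := Mr _ _ va v0; have := Na _ _ lar flE.
have [|la [k [lar krs lb ck]]] := key a v va vS.
  move=> b x bP xb; apply: IH (act_rspace xb va) (submod_act x vT) _ => la fl lar flE.
  have [/root_neq0 b0 [fb fbE]] := pos_rootP bP.
  have fb0 : (0 < \sum_i fb i)%N by apply: (@qsum_gt0 _ _ D); rewrite -fbE.
  have : la - a = qsum (fun i => (fl i + fb i)%N).
    by rewrite -qsumD -flE -fbE opprD addrA subrK.
  move=> /(Na _ _ lar); rewrite big_split /= => le.
  by rewrite -ltnS (leq_trans _ le) // ltnS -addn1 leq_add2l.
move: vS; rewrite (PT a v) //; apply/flattenP; exists (F (la, k)); last exact: FP.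
by apply/allpairsP; exists (la, k).
Qed.
End Casimir.

(* l S is the dimension of the sum of the controlling weight spaces of S. *)
Lemma control_length (M : gmod) P : fdw D M -> weight_control M P ->
  exists l : submod M -> nat, (forall S T : submod M, {subset S <= T} -> (l S <= l T)%N) /\
    (forall S T : submod M, {subset S <= T} -> (l T <= l S)%N -> {subset T <= S}).
Proof.
move=> Mf MP; have [f [fw fs]] := fdw_spanning Mf.
pose W := flatten [seq f a | a <- P].
have /choice[U UP] (S : submod M) : exists U : {vspace 'rV[K]_(size W)},
    forall u, (u \in U) = (lincomb u \in S).
  have [|a u v uS vS|T TP] := @subcl_ex K 'rV[K]_(size W) (fun u => lincomb u \in S).
  - by rewrite linear0 rpred0.
  - by rewrite linearP rpredD ?rpredZ.
  have [U UT] := vspace_of T; exists U => u; rewrite UT; apply/idP/idP => /TP //.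
have Usub (S T : submod M) : {subset S <= T} -> (U S <= U T)%VS.
  by move=> ST; apply/subvP => u; rewrite !UP; exact: ST.
exists (fun S => \dim (U S)); split=> S T ST; first exact/dimvS/Usub.
move=> le; apply: MP => // a m aP ma mT.
have : inspan W m.
  by apply: inspan_mono (fs a m ma) => x xf; apply/flattenP; exists (f a); rewrite ?map_f.
case=> u mE; rewrite mE -UP; suff -> : U S = U T by rewrite UP -mE.
by apply/eqP; rewrite -(geq_leqif (dimv_leqif_eq (Usub _ _ ST))).
Qed.

Lemma triangular_decomp (x : g) : exists y t z,
  [/\ y \in nminus D, t \in h, z \in nplus D & x = y + t + z].
Proof.
have := memvf x; rewrite -(triangular_sum D) => /memv_addP[u /memv_addP[y yn [t th ->]]].
by move=> [z zp ->]; exists y, t, z.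
Qed.

(* The sum W of the weight spaces above the weights in P is finite-dimensional and
   stable under h + n_+, so the n_- -stable subspace that it generates is stable
   under g. *)
Lemma fg_criterion (M : gmod) (r P : seq wt) : bounded M r -> fdw D M ->
  (forall T : submod M, (forall a m, a \in P -> wspace M a m -> m \in T) ->
    forall m, m \in T) -> fg_nminus D M.
Proof.
move=> Mr Mf MP; have [f [fw fs]] := fdw_spanning Mf.
have /choice[Q QP] d := bounded_interval K0 d Mr.
(* The list contains every weight of M above some element of [P]; these are finitely many because M
   is bounded. *)
pose P' := [seq b <- flatten [seq Q d | d <- P] | `[< exists2 d, d \in P & Qp (b - d) >]].
pose W := flatten [seq f b | b <- P'].
have WI b d m : d \in P -> Qp (b - d) -> wspace M b m -> inspan W m.
  move=> dP bd mb; have [->|/eqP m0] := eqVneq m 0; first exact: inspan0.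
  apply: inspan_mono (fs b m mb) => x xf; apply/flattenP; exists (f b) => //.
  apply: map_f; rewrite mem_filter; apply/andP; split; first by apply/asboolP; exists d.
  by apply/flattenP; exists (Q d); [exact: map_f|exact: QP mb m0 bd].
exists W => S0 S0n S0W.
have {S0W}S0W m : inspan W m -> m \in S0 by exact: inspan_sub.
pose X m := forall S : submodClosed M,
  (forall x m, x \in nminus D -> m \in S -> act x m \in S) ->
  {subset W <= S} -> m \in S.
have XW m : inspan W m -> X m by move=> mW S _ WS; exact: inspan_sub mW.
have X0 : X 0 by move=> S _ _; exact: rpred0.
have XD k u v : X u -> X v -> X (k *: u + v).
  by move=> hu hv S Sn SW; rewrite rpredD ?rpredZ ?hu ?hv.
have Xn x m : x \in nminus D -> X m -> X (act x m).
  by move=> xn hm S Sn SW; apply: (Sn _ _ xn (hm S Sn SW)).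
have XWact v x : v \in W -> X (act x v).
  move=> /flattenP[_ /mapP[b bP' ->]] vb.
  have vW : X v by apply/XW/mem_inspan/flattenP; exists (f b) => //; exact: map_f.
  move: bP'; rewrite mem_filter => /andP[/asboolP[d dP bd] _]; have {}vb := fw _ _ vb.
  have [y [t [z [yn th zp ->]]]] := triangular_decomp x.
  rewrite -[y + t]scale1r actDl actZl; apply: (XD _ _ _).
    rewrite actDl -[act y v]scale1r; apply: (XD _ _ _); first by apply: Xn.
    by rewrite (act_ev th vb) -[_ *: v]addr0; exact: (XD _ _ _ vW X0).
  move: z zp; apply: root_sum_ind.
  - by rewrite act0l.
  - by move=> k u u' hu hu'; rewrite act_linl; exact: (XD _ _ _ hu hu').
  move=> a z aP za; apply/XW/(WI _ d _ dP _ (act_rspace za vb)).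
  by rewrite addrAC; apply: QpD => //; case/pos_rootP: aP.
have Xact x m : X m -> X (act x m).
  (* T consists of the m in X with g m inside X. It contains W, and it is stable under y in n_-
     because z y m = [z, y] m + y z m. *)
  move=> hm; have [||T TP] := @subcl_ex K M (fun m => X m /\ forall x, X (act x m)).
  - by split=> // y; rewrite linear0.
  - move=> k u v [hu hu'] [hv hv']; split; first exact: XD.
    by move=> y; rewrite linearP; exact: (XD _ _ _ (hu' y) (hv' y)).
  suff /TP[] : m \in T by [].
  apply: hm => [y v yn /TP[hv hv']|v vW]; apply/TP; last first.
    by split=> [|y]; [exact/XW/mem_inspan|exact: XWact].
  split=> [|z]; first exact: hv'.
  by rewrite act_swap -[act _ _]scale1r; apply: (XD _ _ _); [exact: hv'|exact: Xn].
have [T TP] := submod_ex X0 XD Xact.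
move=> m; have /TP mX : m \in T; last by apply: (mX S0 S0n) => v vW; exact/S0W/mem_inspan.
apply: MP => a v aP va; apply/TP/XW/(WI a a) => //.
by rewrite subrr; exact: Qp0.
Qed.

Lemma gsub_inclusion (M : gmod) (S : submod M) :
  exists f : ghom (gsub S) M, forall m, f m = val m.
Proof.
have fl : linear (fun m : gsub S => val m : M) by [].
by exists (Ghom (M := gsub S) fl (fun x m => erefl)).
Qed.

Lemma inO_surj (M N : gmod) (f : ghom M N) : gsurj f -> inO D M -> inO D N.
Proof.
move=> fs [Mw [s sP]]; split; first exact: weight_module_surj fs Mw.
exists [seq f v | v <- s] => S Sst sS n; have [m <-] := fs n.
apply: (sP (presp f S)) => [x v xn vS|v vs].
  by rewrite unfold_in /pre_pred /= ghom_act; exact: Sst.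
by apply: sS; exact: map_f.
Qed.

Section Sub.
Hypothesis control : forall M : gmod, inO D M -> exists P, weight_control M P.

Lemma bounded_sub (M : gmod) (S : submod M) (r : seq wt) : bounded M r -> bounded (gsub S) r.
Proof.
move=> Mr m b mb m0; apply: (Mr (val m)) => [t|E].
  by rewrite -[act _ _]/(val (act (vsval t) m)) mb.
by apply: m0; exact: val_inj.
Qed.

Lemma fdw_sub (M : gmod) (S : submod M) : fdw D M -> fdw D (gsub S).
Proof.
move=> Mf a; have [s sP] := Mf a; have [s' s'S s's] := fd_sub S s.
exists [seq insubd (0 : subsp S) v | v <- s'] => m ma.
have [f fE] := gsub_inclusion S.
have : inspan s' (f m).
  apply: s's; last by rewrite fE; exact: subsp_valP.
  by apply: sP; exact: wspace_map.
move=> m's; have [||T TP] := @subcl_ex K M (fun v =>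
    exists2 n : gsub S, f n = v & inspan [seq insubd (0 : subsp S) v | v <- s'] n).
- by exists 0; [rewrite linear0|exact: inspan0].
- move=> k u v [x <- xs] [y <- ys]; exists (k *: x + y); first by rewrite linearP.
  exact: inspanP.
have : f m \in T.
  apply: inspan_sub m's => v vs; apply/TP; exists (insubd (0 : subsp S) v).
    by rewrite fE insubdK //; exact: s'S.
  exact/mem_inspan/map_f.
by case/TP=> n; rewrite !fE => /val_inj ->.
Qed.

(** A submodule T of S that contains the weight spaces of S at [P] is all of S, by weight control in
    M applied to the inclusion of T in S; so [fg_criterion] applies with the list [P] of M. *)
Lemma inO_sub (M : gmod) (S : submod M) : inO D M -> inO D (gsub S).
Proof.
move=> MO; have [P MP] := control MO; have [[r Mr] Mf] := inO_weights K0 MO.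
split; first exact: weight_module_sub MO.1.
apply: (@fg_criterion _ r P); [exact: bounded_sub|exact: fdw_sub|].
move=> T PT m; have [f fE] := gsub_inclusion S.
have sub : {subset img_submod f T <= S}.
  by move=> _ /asboolP[v vT ->]; rewrite fE; exact: subsp_valP.
have : val m \in img_submod f T.
  apply: (MP _ S sub) (subsp_valP m) => a v aP va vS.
  rewrite -[v]/(val (Subsp vS : gsub S)) -fE; apply: img_mem; apply: (PT a) => // t.
  by apply: val_inj; exact: va.
by case/asboolP=> v vT; rewrite fE => /val_inj ->.
Qed.
End Sub.
End WeightControl.

(** * Composition factors and blocks *)

Section Subquotients.
Variables (K : numFieldType) (g : lieAlg K) (D : triangular g).
Notation gmod := (gmod g).

Lemma gincl_linear (M : gmod) (S : submod M) : linear (fun m : gsub S => val m : M).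
Proof. by []. Qed.
Definition gincl (M : gmod) (S : submod M) : ghom (gsub S) M :=
  Ghom (M := gsub S) (@gincl_linear M S) (fun x m => erefl).

Lemma gproj_linear (M : gmod) (S : submod M) : linear (fun m => qpi S m : gquot S).
Proof. by move=> k u v; rewrite linearP. Qed.
Definition gproj (M : gmod) (S : submod M) : ghom M (gquot S) :=
  Ghom (N := gquot S) (@gproj_linear M S) (fun x m => esym (quot_actE S x m)).

Lemma gproj_surj (M : gmod) (S : submod M) : gsurj (gproj S).
Proof. by move=> u; exists (qrepr u); exact: qreprK. Qed.

Lemma gproj0 (M : gmod) (S : submod M) m : gproj S m = 0 <-> m \in S.
Proof. exact: qpi0. Qed.

Lemma gincl_inj (M : gmod) (S : submod M) : injective (gincl S).
Proof. by move=> u v /val_inj. Qed.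

Lemma ghom_factor (A B C : gmod) (f : ghom A B) (k : ghom A C) : gsurj f ->
  (forall a, f a = 0 -> k a = 0) -> exists l : ghom B C, forall a, l (f a) = k a.
Proof.
move=> /choice[s sP] fk; have kE a : k (s (f a)) = k a.
  by apply/eqP; rewrite -subr_eq0 -linearB /= fk // linearB /= sP subrr.
have sl : linear (fun b => k (s b)).
  by move=> c u v; rewrite -{1}(sP u) -{1}(sP v) -linearP kE linearP.
have sa x b : k (s (act x b)) = act x (k (s b)).
  by rewrite -{1}(sP b) -ghom_act kE ghom_act.
by exists (Ghom sl sa) => a; exact: kE.
Qed.

Lemma gsimple_surj (N L : gmod) (f : ghom N L) n : gsimple L -> f n <> 0 -> gsurj f.
Proof.
move=> [_ Ls] fn; have [||x m [n' <-]|S SP] := @submod_ex _ _ L (fun l => exists n, f n = l).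
- by exists 0; rewrite linear0.
- by move=> k _ _ [u <-] [v <-]; exists (k *: u + v); rewrite linearP.
- by exists (act x n'); rewrite ghom_act.
have [S0|S1] := Ls S; last by move=> l; apply/SP.
by case: fn; apply: S0; apply/SP; exists n.
Qed.

Lemma gsimple_inj (L N : gmod) (f : ghom L N) l : gsimple L -> f l <> 0 -> injective f.
Proof.
move=> [_ Ls] fl; have [||x m fm|S SP] := @submod_ex _ _ L (fun l => f l = 0).
- by rewrite linear0.
- by move=> k u v fu fv; rewrite linearP /= fu fv scaler0 addr0.
- by rewrite ghom_act fm linear0.
have [S0|S1] := Ls S; last by case: fl; apply/SP.
move=> u v E; apply/eqP; rewrite -subr_eq0; apply/eqP/S0/SP.
by rewrite linearB /= E subrr.
Qed.

Lemma comp_factor_surj (M N L : gmod) (f : ghom M N) :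
  gsurj f -> comp_factor L N -> comp_factor L M.
Proof.
move=> fs [Ls [S [p ps]]]; split=> //.
pose fS := gsub_map (f := f) (S := pre_submod f S) (T := S) (fun _ h => h).
exists (pre_submod f S), (compg p fS) => l.
have [[n nS] <-] := ps l; have [m mn] := fs n.
have mS : m \in pre_submod f S by rewrite unfold_in /= /pre_pred mn.
by exists (Subsp mS); congr (p _); apply: val_inj.
Qed.

(** Write L as a quotient of a submodule S of M. If the kernel of p on S has nonzero image in L,
    this image is L by simplicity and L is a factor of A; otherwise the map from S to L factors
    through p(S). *)
Lemma comp_factor_exact (A M C L : gmod) (i : ghom A M) (p : ghom M C) :
  exact_at i p -> comp_factor L M -> comp_factor L A \/ comp_factor L C.
Proof.
move=> ip [Ls [S [f fs]]].
have [[s [ps fs0]]|nex] := pselect (exists s : gsub S, p (val s) = 0 /\ f s <> 0).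
  left; split=> //; have [a aE] := (ip _).1 ps.
  pose iS := gsub_map (f := i) (S := pre_submod i S) (T := S) (fun _ h => h).
  have aS : a \in pre_submod i S by rewrite unfold_in /pre_pred /= aE; exact: valP.
  exists (pre_submod i S), (compg f iS).
  have nz : f (iS (Subsp aS)) <> 0.
    by have -> : iS (Subsp aS) = s by exact: val_inj.
  exact: (gsimple_surj (f := compg f iS) Ls nz).
right; split=> //; exists (img_submod p S).
pose pS : ghom (gsub S) (gsub (img_submod p S)) :=
  gsub_map (f := p) (fun m => @img_mem _ _ M C p S m).
have pSs : gsurj pS.
  by move=> [c cS]; have /asboolP[k kS ck] := cS; exists (Subsp kS); exact: val_inj.
have [s ps0|l lE] := @ghom_factor _ _ _ pS f pSs; last first.
  by exists l => z; have [s <-] := fs z; exists (pS s).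
by apply: contrapT => fs0; apply: nex; exists s; split=> //; exact: (congr1 val ps0).
Qed.

Lemma giso_sym (M N : gmod) : giso M N -> giso N M.
Proof.
move=> [f [f' fK f'K]].
have fl : linear f'.
  by move=> k u v; apply: (can_inj fK); rewrite linearP /= !f'K.
have fa x n : f' (act x n) = act x (f' n).
  by apply: (can_inj fK); rewrite ghom_act !f'K.
by exists (Ghom fl fa), f.
Qed.

Lemma giso_bij (M N : gmod) (f : ghom M N) : injective f -> gsurj f -> giso M N.
Proof.
move=> fi /choice[s sP]; exists f; exists s => [m|//].
by apply: fi; rewrite sP.
Qed.

Lemma gsimple_bij (L L' : gmod) (f : ghom L L') l :
  gsimple L -> gsimple L' -> f l <> 0 -> giso L L'.
Proof.
by move=> Ls Ls' fl; apply: (giso_bij (gsimple_inj Ls fl) (gsimple_surj Ls' fl)).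
Qed.

Lemma comp_factor_inj (M N L : gmod) (f : ghom M N) :
  injective f -> comp_factor L M -> comp_factor L N.
Proof.
move=> fi [Ls [S [p ps]]]; split=> //; exists (img_submod f S).
pose fS : ghom (gsub S) (gsub (img_submod f S)) :=
  gsub_map (f := f) (fun m => @img_mem _ _ M N f S m).
have fSs : gsurj fS.
  by move=> [c cS]; have /asboolP[k kS ck] := cS; exists (Subsp kS); exact: val_inj.
have [s fs0|l lE] := @ghom_factor _ _ _ fS p fSs; last first.
  by exists l => z; have [s <-] := ps z; exists (fS s).
have -> : s = 0 by apply/val_inj/fi; rewrite linear0; exact: (congr1 val fs0).
exact: linear0.
Qed.

Lemma comp_factor_simple (Q L : gmod) : gsimple Q -> comp_factor L Q -> giso Q L.
Proof.
move=> Qs [Ls [S [f fs]]]; have [[l0 l00] _] := Ls; have [s sE] := fs l0.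
have [S0|S1] := Qs.2 S.
  case/eqP: l00; rewrite -sE; have -> : s = 0 by apply/val_inj/S0/valP.
  exact: linear0.
have [||t E] := @ghom_factor _ _ _ (gincl S) f.
- by move=> q; exists (Subsp (S1 q)).
- by move=> a /= a0; have -> : a = 0 by [exact: val_inj]; rewrite linear0.
apply: (@gsimple_bij _ _ t (gincl S s)) => //; rewrite E sE; exact/eqP.
Qed.

(** The quotient of T by its intersection with A, which makes sense without a proof that A is
    contained in T. *)
Definition gsubquot (M : gmod) (A T : submod M) : gmod := gquot (pre_submod (gincl T) A).
Definition gsubquot_proj (M : gmod) (A T : submod M) : ghom (gsub T) (gsubquot A T) :=
  gproj (pre_submod (gincl T) A).

Lemma gsubquot_surj (M : gmod) (A T : submod M) : gsurj (gsubquot_proj A T).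
Proof. exact: gproj_surj. Qed.
Lemma gsubquot0 (M : gmod) (A T : submod M) t : gsubquot_proj A T t = 0 <-> val t \in A.
Proof. exact: gproj0. Qed.

Lemma gsubquot_map (M : gmod) (A T A' T' : submod M) :
  {subset A <= A'} -> {subset T <= T'} ->
  exists f : ghom (gsubquot A T) (gsubquot A' T'), forall t t',
    val t = val t' -> f (gsubquot_proj A T t) = gsubquot_proj A' T' t'.
Proof.
move=> AA' TT'; pose i : ghom (gsub T) (gsub T') := gsub_map (f := idg M) TT'.
have [a|l lE] := ghom_factor (k := compg (gsubquot_proj A' T') i) (@gsubquot_surj M A T).
  by move=> /gsubquot0/AA' h; apply/gsubquot0.
exists l => t t' tt'; rewrite lE /=; congr (gsubquot_proj _ _ _).
exact: val_inj.
Qed.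

Lemma submod_sum_ex (M : gmod) (A B : submod M) : exists S : submod M,
  forall m, m \in S <-> exists a b, [/\ a \in A, b \in B & m = a + b].
Proof.
apply: submod_ex.
- by exists 0, 0; rewrite !rpred0 addr0.
- move=> k _ _ [a [b [aA bB ->]]] [a' [b' [aA' bB' ->]]].
  exists (k *: a + a'), (k *: b + b'); rewrite scalerDr addrACA.
  by split=> //; rewrite rpredD ?rpredZ.
move=> x _ [a [b [aA bB ->]]]; exists (act x a), (act x b).
by rewrite linearD !submod_act.
Qed.

Lemma gsub_eqsub (M : gmod) (S T : submod M) : {subset S <= T} -> {subset T <= S} ->
  exists f : ghom (gsub S) (gsub T), gsurj f.
Proof.
move=> ST TS; exists (gsub_map (f := idg M) ST) => -[t tT].
by exists (Subsp (TS t tT)); exact: val_inj.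
Qed.
End Subquotients.
Arguments gproj : simpl never.
Arguments gsubquot_proj : simpl never.

Section Blocks.
Variables (K : numFieldType) (g : lieAlg K) (D : triangular g).
Notation gmod := (gmod g).
Hypothesis control : forall M : gmod, inO D M -> exists P, @weight_control K g D M P.

Lemma inO_length (M : gmod) : inO D M ->
  exists l : submod M -> nat, (forall S T : submod M, {subset S <= T} -> (l S <= l T)%N) /\
    (forall S T : submod M, {subset S <= T} -> (l T <= l S)%N -> {subset T <= S}).
Proof.
move=> MO; have [P MP] := control MO; apply: control_length MP.
exact: (inO_weights (@pnatr_eq0 K) MO).2.
Qed.

(** Among the submodules of B strictly above A take A' of least length; a submodule of A' / A pulls
    back to one between A and A', which is A or has the length of A'. *)
Lemma cover_ex (M : gmod) (A B : submod M) : inO D M -> {subset A <= B} ->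
  ~ {subset B <= A} -> exists A' : submod M,
  [/\ {subset A <= A'}, {subset A' <= B}, ~ {subset A' <= A} & gsimple (gsubquot A A')].
Proof.
move=> MO AB nBA; have [l [lmono lstrict]] := inO_length MO.
pose P n := `[< exists A' : submod M, [/\ {subset A <= A'}, {subset A' <= B},
  ~ {subset A' <= A} & l A' = n] >].
have exP : exists n, P n by exists (l B); apply/asboolP; exists B; split.
have [_ /asboolP[A' [AA' A'B nA'A <-]] Amin] := ex_minnP exP.
exists A'; split=> //; split.
  apply: contrapT => n0; apply: nA'A => a aA'.
  apply: (gsubquot0 A (Subsp aA' : gsub A')).1; apply: contrapT => /eqP na; apply: n0.
  by exists (gsubquot_proj A A' (Subsp aA')).
move=> T; have [||x m [t tm tT]|A'' A''P] := @submod_ex _ _ M (fun m =>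
    exists2 t : gsub A', val t = m & gsubquot_proj A A' t \in T).
- by exists 0 => //; rewrite linear0 rpred0.
- move=> k _ _ [u <- uT] [v <- vT]; exists (k *: u + v) => //.
  by rewrite linearP rpredD ?rpredZ.
- by exists (act x t); [rewrite -tm|rewrite ghom_act submod_act].
have AA'' : {subset A <= A''}.
  move=> a aA; apply/A''P; exists (Subsp (AA' a aA)) => //.
  by rewrite ((gsubquot0 _ _).2 _) ?rpred0.
have A''A' : {subset A'' <= A'} by move=> _ /A''P[t <- _]; exact: valP.
have [A''A|nA''A] := pselect ({subset A'' <= A}); [left|right] => u.
  have [t <-] := gsubquot_surj u => tT; apply/gsubquot0/A''A/A''P.
  by exists t.
have [t <-] := gsubquot_surj u.
have le : (l A' <= l A'')%N.
  apply: Amin; apply/asboolP; exists A''; split=> // m /A''A'/A'B //.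
by have /A''P[t' /val_inj ->] := lstrict _ _ A''A' le _ (valP t).
Qed.
End Blocks.

(** * Splitting off a block *)

Section BlockDecomposition.
Variables (K : numFieldType) (g : lieAlg K) (D : triangular g).
Notation gmod := (gmod g).
Hypothesis control : forall M : gmod, inO D M -> exists P, @weight_control K g D M P.

Lemma inO_subquot (M : gmod) (A T : submod M) : inO D M -> inO D (gsubquot A T).
Proof. by move=> MO; apply: inO_surj (@gsubquot_surj _ _ _ A T) _; exact: inO_sub. Qed.

Lemma nontrivial_comp_factor (M : gmod) (m : M) : inO D M -> m <> 0 ->
  exists L, comp_factor L M.
Proof.
move=> MO m0; have [||x u ->|Z ZP] := @submod_ex _ _ M (fun m => m = 0) => //.
- by move=> k u v -> ->; rewrite scaler0 addr0.
- by rewrite linear0.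
have [||x u _|T TP] := @submod_ex _ _ M (fun m => True) => //.
have [|nTZ|A' [_ _ _ As]] := @cover_ex _ _ _ control M Z T MO.
- by move=> u _; apply/TP.
- by apply: m0; apply/ZP/nTZ/TP.
exists (gsubquot Z A'); split=> //; exists A', (gsubquot_proj Z A').
exact: gsubquot_surj.
Qed.

(* If E / B = Q and no composition factor of B / A extends Q nontrivially, then
   B / A has a complement in E / A. *)
Lemma complement_ex (Y Q : gmod) (P2 : gmod -> Prop) : inO D Y ->
  inO D Q -> gsimple Q ->
  (forall L, inO D L -> gsimple L -> P2 L -> ~ nonsplit_ext D L Q) ->
  forall A B E : submod Y, {subset A <= B} -> {subset B <= E} ->
  forall phi : ghom (gsub E) Q, gsurj phi -> (forall x, phi x = 0 <-> val x \in B) ->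
  (forall L, comp_factor L (gsubquot A B) -> P2 L) ->
  exists C : submod Y, [/\ {subset A <= C}, {subset C <= E},
    forall x, x \in C -> x \in B -> x \in A &
    forall x, x \in E -> exists b c, [/\ b \in B, c \in C & x = b + c]].
Proof.
move=> YO QO Qs ne A B E AB BE phi phis phi0.
have [l [lmono lstrict]] := inO_length control YO.
move: {2}(l B - l A)%N (leqnn (l B - l A)%N) => n.
elim: n A AB => [|n IH] A AB ln FP2.
  have BA : {subset B <= A} by apply: lstrict AB _; rewrite -subn_eq0 -leqn0.
  exists E; split=> // [x /AB/BE //|x _ /BA //|x xE].
  by exists 0, x; rewrite rpred0 add0r.
have [BA|nBA] := pselect ({subset B <= A}).
  exists E; split=> // [x /AB/BE //|x _ /BA //|x xE].
  by exists 0, x; rewrite rpred0 add0r.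
(* A' / A is a simple submodule of B / A. By induction on the length, B / A' has a complement C' /
   A' in E / A', which is isomorphic to Q. *)
have [A' [AA' A'B nA'A As]] := cover_ex control YO AB nBA.
have lA : (l A < l A')%N by rewrite ltnNge; apply/negP => /(lstrict _ _ AA').
have [||C' [A'C' C'E C'B C'sum]] := IH A' A'B.
- by rewrite -ltnS; apply: leq_trans ln; rewrite ltn_sub2l // (leq_trans lA) // lmono.
- move=> L LA'B; apply: FP2.
  have [f fE] := gsubquot_map (T := B) (T' := B) AA' (fun x h => h).
  apply: (comp_factor_surj (f := f)) LA'B => u; have [t <-] := gsubquot_surj u.
  by exists (gsubquot_proj A B t); exact: fE.
have AC' : {subset A <= C'} by move=> x /AA'/A'C'.
pose j : ghom (gsub C') (gsub E) := gsub_map (f := idg Y) C'E.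
have [a /gsubquot0 aA|p pE] := ghom_factor (k := compg phi j) (@gsubquot_surj _ _ _ A C').
  by apply/phi0/AB.
have [i iE] := gsubquot_map (A := A) (A' := A) (fun x h => h) A'C'.
have P2A : P2 (gsubquot A A').
  apply: FP2; have [f fE] := gsubquot_map (A := A) (A' := A) (fun x h => h) A'B.
  apply: (comp_factor_inj (f := f)); last first.
    split=> //; have [||x u _|T TP] := @submod_ex _ _ (gsubquot A A') (fun=> True) => //.
    by exists T, (gincl T) => u; exists (Subsp ((TP u).2 I)).
  move=> u v; have [s <-] := gsubquot_surj u; have [t <-] := gsubquot_surj v.
  move=> E'; apply/eqP; rewrite -subr_eq0 -linearB; apply/eqP/gsubquot0.
  have vB (x : gsub A') : val x \in B by exact/A'B/valP.
  rewrite -[val _]/(val (Subsp (vB (s - t)) : gsub B)); apply/gsubquot0.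
  by rewrite -(fE (s - t)) // !linearB /= E' subrr.
(* C' / A is an extension of Q by A' / A, so it splits; the inverse image in C' of the splitting is
   the complement sought. *)
have := ne _ (inO_subquot A A' YO) As P2A; apply: contra_notP => nC.
exists (gsubquot A C'), i, p; split.
- exact: inO_subquot.
- move=> u v; have [s <-] := gsubquot_surj u; have [t <-] := gsubquot_surj v.
  move=> E'; apply/eqP; rewrite -subr_eq0 -linearB; apply/eqP/gsubquot0.
  have vC (x : gsub A') : val x \in C' by exact/A'C'/valP.
  rewrite -[val _]/(val (Subsp (vC (s - t)) : gsub C')); apply/gsubquot0.
  by rewrite -(iE (s - t)) // !linearB /= E' subrr.
- move=> b; have [c <-] := gsubquot_surj b; rewrite pE; split.
    move=> /phi0 /= cB; have cA' := C'B _ (valP c) cB.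
    by exists (gsubquot_proj A A' (Subsp cA')); exact: iE.
  case=> u; have [a <-] := gsubquot_surj u.
  have aC : val a \in C' by exact/A'C'/valP.
  rewrite (iE a (Subsp aC)) // => E'; apply/phi0 => /=.
  have : gsubquot_proj A C' (Subsp aC - c) = 0.
    by rewrite linearB; apply/eqP; rewrite subr_eq0; apply/eqP.
  move=> /gsubquot0 /= /AB h; have := valP a; move=> /A'B aB.
  by have := submodB aB h; rewrite /= opprB addrC subrK.
- move=> q; have [x xE] := phis q.
  have [b [c [bB cC xbc]]] := C'sum _ (valP x).
  exists (gsubquot_proj A C' (Subsp cC)); rewrite pE -xE /=.
  apply/eqP; rewrite -subr_eq0 -linearB; apply/eqP/phi0.
  rewrite /= xbc opprD addrA addrAC subrr add0r -scaleN1r rpredZ //.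
case=> s sP; apply: nC.
have [||x u [c cu cs]|C CP] := @submod_ex _ _ Y (fun y =>
    exists2 c : gsub C', val c = y & gsubquot_proj A C' c = s (p (gsubquot_proj A C' c))).
- by exists 0 => //; rewrite !linear0.
- move=> k _ _ [c <- cs] [d <- ds]; exists (k *: c + d) => //.
  by rewrite !linearP /= -cs -ds.
- by exists (act x c); rewrite -?cu // !ghom_act -cs.
exists C; split.
- move=> a aA; apply/CP; exists (Subsp (AC' a aA)) => //.
  by rewrite ((gsubquot0 _ _).2 _) // !linear0.
- by move=> _ /CP[c <- _]; exact/C'E/valP.
- move=> _ /CP[c <- cs] cB; apply/(gsubquot0 A c); rewrite cs pE.
  by have -> : compg phi j c = 0 by [apply/phi0]; rewrite linear0.
move=> x /C'sum[b [c [bB cC' ->]]].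
have [d dE] := gsubquot_surj (s (p (gsubquot_proj A C' (Subsp cC')))).
exists (b + (c - val d)), (val d); split; last by rewrite -addrA subrK.
  rewrite rpredD //; have : compg phi j (Subsp cC' - d) = 0.
    rewrite linearB; apply/eqP; rewrite subr_eq0; apply/eqP.
    have /esym := pE d; rewrite dE sP => E2; rewrite -[RHS]/(compg phi j d) E2.
    exact/esym/pE.
  by move=> /phi0.
by apply/CP; exists d => //; rewrite dE sP.
Qed.

Definition inP (P : gmod -> Prop) (M : gmod) := inO D M /\ forall L, comp_factor L M -> P L.

Lemma inP_surj P (M N : gmod) (f : ghom M N) : gsurj f -> inP P M -> inP P N.
Proof.
move=> fs [MO MP]; split; first exact: inO_surj fs MO.
by move=> L LN; apply: MP; exact: comp_factor_surj fs LN.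
Qed.

Lemma inP_sub P (M : gmod) (S : submod M) : inP P M -> inP P (gsub S).
Proof.
move=> [MO MP]; split; first exact: inO_sub.
by move=> L LS; apply: MP; apply: comp_factor_inj LS; exact: (@gincl_inj _ _ _ S).
Qed.

Lemma gsub_leq (M : gmod) (S T : submod M) (ST : {subset S <= T}) :
  {f : ghom (gsub S) (gsub T) | forall s, val (f s) = val s}.
Proof. by exists (gsub_map (f := idg M) ST). Qed.

(** S / A is a quotient of B. *)
Lemma inP_sum P (M : gmod) (A B S : submod M) : inO D M ->
  (forall m, m \in S <-> exists a b, [/\ a \in A, b \in B & m = a + b]) ->
  inP P (gsub A) -> inP P (gsub B) -> inP P (gsub S).
Proof.
move=> MO SP [AO AP] [BO BP]; split=> [|L]; first exact: inO_sub.
have AS : {subset A <= S} by move=> a aA; apply/SP; exists a, 0; rewrite rpred0 addr0.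
have BS : {subset B <= S} by move=> b bB; apply/SP; exists 0, b; rewrite rpred0 add0r.
have [i iE] := gsub_leq AS.
have pS m : m \in S -> gproj A m \in img_submod (gproj A) B.
  move=> /SP[a [b [aA bB ->]]]; have -> : gproj A (a + b) = gproj A b; last exact: img_mem.
  by rewrite linearD -[X in X + _]/(gproj A a) ((gproj0 A a).2 aA) add0r.
pose p := gsub_map (f := gproj A) pS.
have ip : exact_at i p.
  move=> s; split=> [/(congr1 val)/= /gproj0 sA|[a <-]].
    by exists (Subsp sA); apply: val_inj; rewrite iE.
  by apply: val_inj; apply/gproj0; rewrite iE; exact: valP.
case/(comp_factor_exact ip) => [/AP //|LC]; apply: BP.
pose q : ghom (gsub B) (gsub (img_submod (gproj A) B)) :=
  gsub_map (f := gproj A) (fun m => @img_mem _ _ M _ (gproj A) B m).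
apply: (comp_factor_surj (f := q)) LC.
by move=> [c cS]; have /asboolP[k kS ck] := cS; exists (Subsp kS); exact: val_inj.
Qed.

(** A submodule of the class with maximal length absorbs every other one, because the class is
    stable under sums. *)
Lemma inP_max P (M : gmod) : inO D M -> exists S : submod M, inP P (gsub S) /\
  forall T : submod M, inP P (gsub T) -> {subset T <= S}.
Proof.
move=> MO; have [l [lmono lstrict]] := inO_length control MO.
have [||x u _|top topP] := @submod_ex _ _ M (fun=> True) => //.
have [||x u ->|Z ZP] := @submod_ex _ _ M (fun m => m = 0) => //.
- by move=> k u v -> ->; rewrite scaler0 addr0.
- by rewrite linear0.
pose Q n := `[< exists2 S : submod M, inP P (gsub S) & l S = n >].
have exQ : exists n, Q n.
  exists (l Z); apply/asboolP; exists Z => //; split; first exact: inO_sub.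
  move=> L [[[v v0] _] [S [f fs]]]; case/eqP: v0; have [s <-] := fs v.
  have -> : s = 0 by apply/val_inj/val_inj/ZP/valP.
  exact: linear0.
have ubQ n : Q n -> (n <= l top)%N.
  by move=> /asboolP[S _ <-]; apply: lmono => m _; apply/topP.
have [_ /asboolP[S SP <-] Smax] := ex_maxnP exQ ubQ.
exists S; split=> // T TP; have [U UP] := submod_sum_ex S T.
have UPP := inP_sum MO UP SP TP.
have SU : {subset S <= U} by move=> s sS; apply/UP; exists s, 0; rewrite rpred0 addr0.
have US : {subset U <= S} by apply: lstrict SU _; apply: Smax; apply/asboolP; exists U.
by move=> t tT; apply/US/UP; exists 0, t; rewrite rpred0 add0r.
Qed.

Section Decomposition.
Variables P1 P2 : gmod -> Prop.
Hypothesis P1iso : forall L L', inO D L -> inO D L' -> gsimple L -> gsimple L' ->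
  giso L L' -> P1 L -> P1 L'.
Hypothesis ne : forall L Q, inO D L -> inO D Q -> gsimple L -> gsimple Q ->
  P2 L -> P1 Q -> ~ nonsplit_ext D L Q.

Lemma max_cover (Y : gmod) (Y1 Y2 B T : submod Y) : inO D Y ->
  inP P1 (gsub Y1) -> (forall S : submod Y, inP P1 (gsub S) -> {subset S <= Y1}) ->
  inP P2 (gsub Y2) ->
  (forall m, m \in B <-> exists a b, [/\ a \in Y1, b \in Y2 & m = a + b]) ->
  {subset B <= T} -> ~ {subset T <= B} -> gsimple (gsubquot B T) ->
  ~ P1 (gsubquot B T).
Proof.
move=> YO [Y1O Y1P] Y1max [Y2O Y2P] BP BT nTB Qs PQ; apply: nTB.
have QO := inO_subquot B T YO.
have Y1B : {subset Y1 <= B} by move=> s sS; apply/BP; exists s, 0; rewrite rpred0 addr0.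
have Y2B : {subset Y2 <= B} by move=> s sS; apply/BP; exists 0, s; rewrite rpred0 add0r.
have [|C [Y1C CT CB Tsum]] := @complement_ex Y _ P2 YO QO Qs
    (fun L LO Ls LP => ne LO QO Ls Qs LP PQ) Y1 B T Y1B BT _ (@gsubquot_surj _ _ _ B T)
    (@gsubquot0 _ _ _ B T).
  move=> L LF; apply: Y2P; have [i iE] := gsub_leq Y2B.
  apply: (comp_factor_surj (f := compg (gsubquot_proj Y1 B) i)) LF => u.
  have [b <-] := gsubquot_surj u; have /BP[x [y [xY yY bE]]] := valP b.
  exists (Subsp yY); apply/eqP; rewrite -subr_eq0 /= -linearB; apply/eqP/gsubquot0.
  by rewrite /= iE bE opprD addrCA subrr addr0 -scaleN1r rpredZ.
have CY1 : {subset C <= Y1}.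
  apply: Y1max; split; first exact: inO_sub.
  have [i iE] := gsub_leq Y1C; have [j jE] := gsub_leq CT.
  have ip : exact_at i (compg (gsubquot_proj B T) j).
    move=> c; split=> [/gsubquot0 cB|[y <-]].
      rewrite jE in cB; exists (Subsp (CB _ (valP c) cB)); apply: val_inj.
      by rewrite iE.
    by apply/gsubquot0; rewrite jE iE; exact/Y1B/valP.
  move=> L LC; case: (comp_factor_exact ip LC) => [/Y1P //|LQ].
  have LQi := comp_factor_simple Qs LQ; have [Ls _] := LQ.
  apply: (P1iso _ _ _ _ LQi PQ) => //; have [f [f' fK f'K]] := LQi.
  by apply: (inO_surj (f := f)) QO => v; exists (f' v).
by move=> t /Tsum[b [c [bB /CY1/Y1B cB ->]]]; rewrite rpredD.
Qed.
End Decomposition.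

(** If Y1 + Y2 were proper, a simple module just above it could neither satisfy P nor fail it, by
    [max_cover] with the two roles exchanged. *)
Lemma block_decomposition (P : gmod -> Prop) (Y : gmod) :
  (forall L L', inO D L -> inO D L' -> gsimple L -> gsimple L' ->
    giso L L' \/ nonsplit_ext D L L' -> P L <-> P L') -> inO D Y ->
  exists Y1 Y2 : submod Y, [/\ inP P (gsub Y1), inP (fun L => ~ P L) (gsub Y2) &
    forall y, exists a b, [/\ a \in Y1, b \in Y2 & y = a + b]].
Proof.
move=> Pl YO; have [Y1 [Y1P Y1max]] := inP_max P YO.
have [Y2 [Y2P Y2max]] := inP_max (fun L => ~ P L) YO.
exists Y1, Y2; split=> // y; have [B BP] := submod_sum_ex Y1 Y2.
have BP' m : m \in B <-> exists a b, [/\ a \in Y2, b \in Y1 & m = a + b].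
  by rewrite BP; split=> -[a [b [ha hb ->]]]; exists b, a; rewrite addrC.
apply/BP; have [||x u _|top topP] := @submod_ex _ _ Y (fun=> True) => //.
have [TB|nTB] := pselect ({subset top <= B}); first exact/TB/topP.
have Btop : {subset B <= top} by move=> m _; exact/topP.
have [T [BT _ nT Ts]] := cover_ex control YO Btop nTB.
exfalso.
have := max_cover (P1 := P) (P2 := fun L => ~ P L) _ _ YO Y1P Y1max Y2P BP BT nT Ts.
have := max_cover (P1 := fun L => ~ P L) (P2 := P) _ _ YO Y2P Y2max Y1P BP' BT nT Ts.
move=> h1 h2; apply: h1.
- by move=> L L' LO LO' Ls Ls' iso nP /(Pl _ _ LO LO' Ls Ls' (or_introl iso)).
- by move=> L Q LO QO Ls Qs PL nPQ ext; apply/nPQ/(Pl _ _ LO QO Ls Qs (or_intror ext)).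
apply: h2.
- by move=> L L' LO LO' Ls Ls' iso /(Pl _ _ LO LO' Ls Ls' (or_introl iso)).
- by move=> L Q LO QO Ls Qs nPL PQ ext; apply/nPL/(Pl _ _ LO QO Ls Qs (or_intror ext)).
Qed.
End BlockDecomposition.

(** * Exactness of the projection to the principal block *)

Section PrincipalBlock.
Variables (K : numFieldType) (g : lieAlg K) (D : triangular g).
Notation gmod := (gmod g).
Hypothesis control : forall M : gmod, inO D M -> exists P, @weight_control K g D M P.
Notation inB := (linked D (gtriv g)).
Notation block M := (gen_submod (@block0_set K g D M)).

Lemma linked_iff (L L' : gmod) : inO D L -> inO D L' -> gsimple L -> gsimple L' ->
  giso L L' \/ nonsplit_ext D L L' -> inB L <-> inB L'.
Proof.
move=> LO LO' Ls Ls' LL'; have st : linked D L L' by apply: rst_step.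
by split=> tL; apply: rst_trans tL _ => //; apply: rst_sym.
Qed.

Lemma inO0P (M : gmod) : inO0 D M <-> inP D inB M. Proof. by []. Qed.

Lemma inO0_sub (M : gmod) (S : submod M) : inO0 D M -> inO0 D (gsub S).
Proof. by move=> /inO0P M0; apply/inO0P; exact: inP_sub. Qed.

Lemma block0_mem (M : gmod) : inO D M -> exists S : submod M,
  inO0 D (gsub S) /\ forall m, m \in block M <-> m \in S.
Proof.
move=> MO; have [S [S0 Smax]] := inP_max control inB MO; exists S; split=> // m; split.
  by move=> /asboolP /(_ S); apply=> x [T T0 xT]; exact: Smax T0 _ xT.
by move=> mS; apply: sub_gen; exists S.
Qed.

Lemma block0_sub (M : gmod) (S : submod M) m : inO0 D (gsub S) -> m \in S -> m \in block M.
Proof. by move=> S0 mS; apply: sub_gen; exists S. Qed.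

Lemma block0_full (M : gmod) m : inO0 D M -> m \in block M.
Proof.
move=> M0; have [||x u _|T TP] := @submod_ex _ _ M (fun=> True) => //.
by apply: (@block0_sub _ T); [exact: inO0_sub|apply/TP].
Qed.

Lemma block0_inO0 (M : gmod) : inO D M -> inO0 D (block0 D M).
Proof.
move=> MO; have [S [S0 SE]] := block0_mem MO.
have [f fs] := @gsub_eqsub _ _ _ S (block M) (fun m h => (SE m).2 h) (fun m h => (SE m).1 h).
exact: inO0_surj fs S0.
Qed.

(** Lift n to a + b along the decomposition of M. Then f(b) lies both in the principal block of N
    and in the image of Y2; if it were nonzero, their intersection would have a composition factor
    both linked and not linked to the trivial module. So n = f(a). *)
Lemma block0_map_surj (M N : gmod) (f : ghom M N) : inO D M -> inO D N ->
  gsurj f -> gsurj (block0_map D f).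
Proof.
move=> MO NO fs [n nB].
have [Y1 [Y2 [Y1P Y2P Ysum]]] := block_decomposition control linked_iff MO.
have [m mn] := fs n; have [a [b [aY bY mE]]] := Ysum m.
have aB : a \in block M by exact: block0_sub Y1P aY.
have faB : f a \in block N by apply: gen_submod_map aB; exact: block0_set_map.
have [S [S0 SE]] := block0_mem NO.
have fbS : f b \in S.
  apply/SE; have -> : f b = n - f a by rewrite -mn mE linearD /= addrAC subrr add0r.
  exact: submodB.
pose q : ghom (gsub Y2) (gsub (img_submod f Y2)) :=
  gsub_map (f := f) (fun m => @img_mem _ _ M N f Y2 m).
have qs : gsurj q.
  by move=> [c cS]; have /asboolP[k kS ck] := cS; exists (Subsp kS); exact: val_inj.
have [Y2fO Y2fP] := inP_surj qs Y2P.
have fb0 : f b = 0.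
  apply: contrapT => fb0; pose T := pre_submod (gincl (img_submod f Y2)) S.
  have fbI : f b \in img_submod f Y2 by exact: img_mem.
  have TO : inO D (gsub T) by exact: inO_sub.
  have [L LT] : exists L, comp_factor L (gsub T).
    pose t : gsub T := Subsp (fbS : (Subsp fbI : gsub (img_submod f Y2)) \in T).
    have t0 : t <> 0 by move=> /(congr1 (fun x => val (val x))).
    exact: (nontrivial_comp_factor control TO t0).
  apply: (Y2fP L); first by apply: comp_factor_inj LT; exact: (@gincl_inj _ _ _ T).
  apply: S0.2; have TS (t : gsub (img_submod f Y2)) : t \in T -> gincl _ t \in S by [].
  apply: (comp_factor_inj (f := gsub_map TS)) LT => u v /(congr1 val) /= E.
  by apply/val_inj/val_inj.
by exists (Subsp aB); apply: val_inj; rewrite /= -mn mE linearD /= fb0 addr0.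
Qed.

(** Surjectivity is applied to f from the inverse image X of the block of N to J = f(X): J is in
    O_0, so it is its own block, and each of its elements lifts to the block of X. *)
Lemma block0_map_exact (M N P : gmod) (f : ghom M N) (f' : ghom N P) :
  inO D M -> inO D N -> exact_at f f' -> exact_at (block0_map D f) (block0_map D f').
Proof.
move=> MO NO ff' n; split; last first.
  move=> [m <-]; apply: val_inj => /=; apply/(ff' (f (val m))).
  by exists (val m).
move=> /(congr1 val)/= /ff'[m mE].
have [S [S0 SE]] := block0_mem NO.
pose X := pre_submod f S; pose J := img_submod f X.
have JS : {subset J <= S} by move=> _ /asboolP[x xX ->].
have J0 : inO0 D (gsub J).
  split=> [|L LJ]; first exact: inO_sub.
  apply: S0.2; have [j jE] := gsub_leq JS; apply: (comp_factor_inj (f := j)) LJ.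
  by move=> u v /(congr1 val); rewrite !jE => /val_inj.
have mX : m \in X by rewrite unfold_in /pre_pred /= mE; apply/SE/valP.
pose q : ghom (gsub X) (gsub J) :=
  gsub_map (f := f) (fun m => @img_mem _ _ M N f X m).
have qs : gsurj q.
  by move=> [c cS]; have /asboolP[k kS ck] := cS; exists (Subsp kS); exact: val_inj.
have XO : inO D (gsub X) by exact: inO_sub.
have qmB : q (Subsp mX) \in block (gsub J) by exact: block0_full.
have [x xE] := block0_map_surj XO J0.1 qs (Subsp qmB).
have xB : val (val x) \in block M.
  exact: (gen_submod_map (block0_set_map (gincl X))) (valP x).
exists (Subsp xB); apply: val_inj; rewrite /= -mE.
exact: (congr1 (fun y : block0 D (gsub J) => val (val y)) xE).
Qed.
End PrincipalBlock.

(** * Restricted duals *)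

Section Duals.
Variables (K : numFieldType) (g : lieAlg K) (D : triangular g).
Notation h := (cartan D).
Notation wt := (weight (cartan D)).
Notation gmod := (gmod g).
(* eps = -1 for M^* and eps = 1 for the star duality. *)
Variables (s : antihom g) (eps : K).
Hypothesis eps2 : eps * eps = 1.
Hypothesis s_cartan : forall t, t \in h -> s t = eps *: t.

Notation dual M := (gdual D s M).

Definition dualv (M : gmod) (f : dual M) : M -> K^o := subsp_val f.

Lemma dualv_linear (M : gmod) (f : dual M) : linear (dualv f).
Proof. exact: rdual_linear. Qed.
HB.instance Definition _ (M : gmod) (f : dual M) :=
  GRing.isLinear.Build K M K^o *:%R (dualv f) (dualv_linear f).

Lemma dual_ext (M : gmod) (f f' : dual M) : dualv f =1 dualv f' -> f = f'.
Proof. exact: rdual_ext. Qed.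

Lemma dualv_act (M : gmod) x (f : dual M) m : dualv (act x f) m = dualv f (act (s x) m).
Proof. by []. Qed.

Lemma dualv_lin (M : gmod) k (f f' : dual M) m :
  dualv (k *: f + f') m = k * dualv f m + dualv f' m.
Proof. by []. Qed.

Lemma dualvZ (M : gmod) k (f : dual M) m : dualv (k *: f) m = k * dualv f m.
Proof. by []. Qed.

Lemma dualv0 (M : gmod) m : dualv (0 : dual M) m = 0. Proof. by []. Qed.

Lemma dual_supp (M : gmod) (f : dual M) : exists r : seq wt,
  forall a, a \notin r -> forall m, wspace M a m -> dualv f m = 0.
Proof. by have /asboolP[_ []] := subsp_valP f; eexists; eassumption. Qed.

Lemma dual_mk (M : gmod) (f : M -> K^o) (r : seq wt) : linear f ->
  (forall a, a \notin r -> forall m, wspace M a m -> f m = 0) ->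
  exists F : dual M, forall m, dualv F m = f m.
Proof.
move=> fl fr; have fs : f \in rdual_sub D M by apply/asboolP; split=> //; exists r.
by exists (Subsp fs : dual M).
Qed.

Lemma dual_expand (M : gmod) (f : dual M) : weight_module D M ->
  exists2 r : seq wt, uniq r & forall m, dualv f m = \sum_(a <- r) dualv f (wcomp a m).
Proof.
move=> Mw; have [r hr] := dual_supp f; exists (undup r); first exact: undup_uniq.
apply: (wt_ind Mw).
- by rewrite linear0 big1 // => a _; rewrite wcomp0 // linear0.
- move=> k u v hu hv; rewrite linearP /= hu hv scaler_sumr -big_split; apply: eq_bigr => a _ /=.
  by rewrite wcomp_lin // linearP.
move=> b m mb; have [br|br] := boolP (b \in undup r).
  rewrite (bigD1_seq b) ?undup_uniq //= (wcomp_id Mw mb) big1 ?addr0 // => a /eqP ab.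
  by rewrite (wcomp_ne Mw mb) ?linear0 // => ba; apply: ab.
rewrite mem_undup in br; rewrite (hr b br m mb) big_seq big1 // => a ar.
rewrite (wcomp_ne Mw mb) ?linear0 // => ba.
by rewrite ba -(mem_undup r) ar in br.
Qed.

Lemma dual_ext_wt (M : gmod) (f f' : dual M) : weight_module D M ->
  (forall (a : wt) m, wspace M a m -> dualv f m = dualv f' m) -> f = f'.
Proof.
move=> Mw ff'; apply: dual_ext; apply: (wt_ind Mw) => //; first by rewrite !linear0.
by move=> k u v hu hv; rewrite !linearP /= hu hv.
Qed.

(** For m of weight b, (t f)(m) = f(s(t) m) = eps b(t) f(m). As eps^2 = 1, the weight space of the
    dual at [a] consists of the forms supported at eps a. *)
Lemma dual_wspace (M : gmod) (a : wt) (f : dual M) : weight_module D M ->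
  (forall b m, b <> eps *: a -> wspace M b m -> dualv f m = 0) -> wspace (dual M) a f.
Proof.
move=> Mw fa t; apply: dual_ext_wt => // b m mb.
 rewrite dualv_act s_cartan ?subvsP // dualvZ actZl mb linearZ /= linearZ /=.
have [->|/eqP ba] := eqVneq b (eps *: a); last by rewrite (fa b) // !scaler0 mulr0.
by rewrite scale_lfunE scalerA -[_ *: _]/(_ * _) mulrA eps2 mul1r.
Qed.

Lemma dual_wspace0 (M : gmod) (a b : wt) (f : dual M) m :
  wspace (dual M) a f -> wspace M b m -> b <> eps *: a -> dualv f m = 0.
Proof.
move=> fa mb ba; have [t nt] : exists t, eps * b t <> a t.
  apply: contrapT => nt; apply: ba; apply/lfunP => t; rewrite scale_lfunE.
  apply: contrapT => E; apply: nt; exists t => E'; apply: E.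
  by rewrite -E' -[_ *: _]/(_ * _) mulrA eps2 mul1r.
have := congr1 (@dualv M ^~ m) (fa t); rewrite -[LHS]/(dualv (act (vsval t) f) m).
rewrite -[RHS]/(dualv (a t *: f) m) dualv_act s_cartan ?subvsP // dualvZ.
rewrite actZl mb linearZ /= linearZ /=.
move/eqP; rewrite -[_ *: (_ *: _)]/(_ * (_ * _)) mulrA -subr_eq0 -mulrBl mulf_eq0 subr_eq0.
by move=> /orP[/eqP//|/eqP].
Qed.

Lemma dual_wspace_neq0 (M : gmod) (a : wt) (f : dual M) : weight_module D M ->
  wspace (dual M) a f -> f <> 0 -> exists2 m, wspace M (eps *: a) m & dualv f m <> 0.
Proof.
move=> Mw fa f0; apply: contrapT => nex; apply: f0; apply: dual_ext_wt => // b m mb.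
rewrite dualv0; have [ba|/eqP ba] := eqVneq b (eps *: a).
  by apply: contrapT => fm; apply: nex; exists m; rewrite -?ba.
exact: dual_wspace0 fa mb ba.
Qed.

Lemma dual_comp (M : gmod) (a : wt) (f : dual M) : weight_module D M ->
  exists2 f' : dual M, wspace (dual M) a f' & forall m, dualv f' m = dualv f (wcomp (eps *: a) m).
Proof.
move=> Mw; have [||F FE] := @dual_mk M (fun m => dualv f (wcomp (eps *: a) m)) [:: eps *: a].
- by move=> k u v; rewrite wcomp_lin // linearP.
- move=> b; rewrite inE => /eqP ba m mb; rewrite (wcomp_ne Mw mb) // linear0 //.
exists F => //; apply: dual_wspace => // b m ba mb.
by rewrite FE (wcomp_ne Mw mb) // linear0.
Qed.

Lemma eps_invol (a : wt) : eps *: (eps *: a) = a.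
Proof. by rewrite scalerA eps2 scale1r. Qed.

Lemma dual_weight_module (M : gmod) : weight_module D M -> weight_module D (dual M).
Proof.
move=> Mw f; have [r ru rE] := dual_expand f Mw.
have /choice[F FP] (a : wt) : exists f' : dual M, wspace (dual M) (eps *: a) f' /\
    forall m, dualv f' m = dualv f (wcomp a m).
  by have [f' f'w f'E] := dual_comp (eps *: a) f Mw; exists f'; rewrite eps_invol in f'E.
exists [seq F a | a <- r] => [_ /mapP[a _ ->]|].
  by exists (eps *: a); exact: (FP a).1.
apply: dual_ext => m; rewrite rE big_map; elim: r {ru rE} => [|a r IH].
  by rewrite !big_nil.
by rewrite !big_cons IH -[F a]scale1r dualv_lin mul1r (FP a).2.
Qed.

(** A form of weight [a] is determined by its values on a finite family spanning the weight space
    eps a. *)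
Lemma dual_fdw (M : gmod) : weight_module D M -> fdw D M -> fdw D (dual M).
Proof.
move=> Mw Mf a; have [W WP] := Mf (eps *: a).
pose phi (f : dual M) : 'rV[K]_(size W) := \row_i dualv f W`_i.
have phil : linear phi by move=> k f f'; apply/rowP => i; rewrite !mxE.
pose PHI : {linear dual M -> 'rV[K]_(size W)} :=
  HB.pack phi (GRing.isLinear.Build K _ _ *:%R phi phil).
have [S SP] := wspace_sub (dual M) a.
have [|W' W'S W'P] := @fd_inj _ _ S _ PHI; last by exists W' => f /SP /W'P.
move=> f /SP fa f0; apply: contrapT => nf; have [m mw] := dual_wspace_neq0 Mw fa nf.
have [u ->] := WP m mw; apply; rewrite linear_sum big1 // => i _.
rewrite linearZ /=; have /rowP/(_ i) := f0; rewrite !mxE => ->.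
exact: mulr0.
Qed.

(** The prescribed form only has to be extended to the sum of the weight spaces in [r], which has
    finite dimension; composing with the projection to that sum gives finite support. *)
Lemma dual_of_graph (C : gmod) (r : seq wt) (G : submodClosed (C * K^o)%type) :
  weight_module D C -> fdw D C -> uniq r -> (forall k, (0, k) \in G -> k = 0) ->
  exists f : dual C, forall c k, (\sum_(a <- r) wcomp a c, k) \in G -> dualv f c = k.
Proof.
move=> Cw Cf ru G0; have /choice[W WP] := Cf.
have [G' [GG' G'0 dom]] := graph_ext (flatten [seq W a | a <- r]) G0.
have /choice[f fP] (c : C) : exists k, (\sum_(a <- r) wcomp a c, k) \in G'.
  apply: dom; have [S SP] := subcl_ex (@inspan0 K C (flatten [seq W a | a <- r])) (@inspanP K C _).
  apply/SP; rewrite big_seq; apply: rpred_sum => a ar; apply/SP.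
  apply: inspan_mono (WP a _ (wcompw Cw a c)) => x xW; apply/flattenP.
  by exists (W a) => //; exact: map_f.
have funG c k k' : (c, k) \in G' -> (c, k') \in G' -> k = k'.
  move=> h1 h2; apply/eqP; rewrite -subr_eq0; apply/eqP/G'0.
  by rewrite -(subrr c); exact: (submodB h1 h2).
have [||F FE] := @dual_mk C f r.
- move=> k u v; apply: funG (fP _) _; under eq_bigr do rewrite wcomp_lin //.
  rewrite big_split /= -scaler_sumr.
  exact: (rpredD (rpredZ k (fP u)) (fP v)).
- move=> a ar c ca; apply: G'0; have := fP c; rewrite big_seq big1 // => b br.
  by rewrite (wcomp_ne Cw ca) // => ab; rewrite ab br in ar.
by exists F => c k /GG' h; rewrite FE; exact: funG (fP c) h.
Qed.

(** [f] descends to the image of [phi] and depends only on the components at finitely many weights,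
    so [dual_of_graph] extends it to C. The exactness of the restricted dual rests on this. *)
Lemma dual_extend (B C : gmod) (phi : ghom B C) (f : dual B) :
  weight_module D B -> weight_module D C -> fdw D C ->
  (forall b, phi b = 0 -> dualv f b = 0) ->
  exists f' : dual C, forall b, dualv f' (phi b) = dualv f b.
Proof.
move=> Bw Cw Cf fk; have [r ru rE] := dual_expand f Bw.
have [||G GP] := @subcl_ex K (C * K^o)%type (fun z => exists b, z = (phi b, dualv f b)).
- by exists 0; rewrite !linear0.
- by move=> k _ _ [b ->] [b' ->]; exists (k *: b + b'); rewrite !linearP.
have [k /GP[b [/esym/fk E ->]] //|f' f'P] := dual_of_graph (G := G) Cw Cf ru.
exists f' => b; apply: f'P; apply/GP; exists (\sum_(a <- r) wcomp a b).
rewrite !linear_sum /= -rE; congr pair.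
by apply: eq_bigr => a _; rewrite wcomp_map.
Qed.

(** Some weight component of m is outside T; the form is 0 on T, takes the value 1 on that
    component, and is supported at its weight alone. *)
Lemma dual_separate (M : gmod) (T : submod M) m : weight_module D M -> fdw D M ->
  m \notin T -> exists2 f : dual M, (forall t, t \in T -> dualv f t = 0) & dualv f m <> 0.
Proof.
move=> Mw Mf mT; have [a aT] : exists a : wt, wcomp a m \notin T.
  apply: contrapT => nex; case/negP: mT; have [r rE] := wsupp Mw m.
  rewrite (rE (undup r)) ?undup_uniq => [|//|b]; last by rewrite mem_undup.
  apply: rpred_sum => a _; apply/negPn/negP => aT; apply: nex; by exists a.
have [||G GP] := @subcl_ex K (M * K^o)%type (fun z =>
    exists t (k : K), t \in T /\ z = (t + k *: wcomp a m, k)).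
- by exists 0, 0; rewrite rpred0 scale0r addr0.
- move=> k _ _ [t [c [tT ->]]] [t' [c' [t'T ->]]]; exists (k *: t + t'), (k * c + c').
  split; first by rewrite rpredD ?rpredZ.
  congr pair; rewrite /= scalerDr scalerA scalerDl; exact: addrACA.
have [k /GP[t [c [tT [E ->]]]]|f fP] := dual_of_graph (r := [:: a]) (G := G) Mw Mf isT.
  apply/eqP/negPn/negP => c0; case/negP: aT.
  rewrite -[wcomp a m]scale1r -(mulVf c0) -scalerA rpredZ //.
  have -> : c *: wcomp a m = - t by apply/eqP; rewrite -addr_eq0 addrC -E.
  by rewrite -scaleN1r rpredZ.
exists f => [t tT|].
  apply: fP; apply/GP; exists (wcomp a t), 0; rewrite big_seq1 scale0r addr0; split=> //.
  exact: wcomp_submod.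
rewrite (fP m 1); first exact/eqP/oner_neq0.
by apply/GP; exists 0, 1; rewrite big_seq1 scale1r add0r rpred0.
Qed.

Lemma dual_map_exact (A B C : gmod) (p : ghom A B) (q : ghom B C) :
  weight_module D B -> weight_module D C -> fdw D C ->
  exact_at p q -> exact_at (gdual_map D s q) (gdual_map D s p).
Proof.
move=> Bw Cw Cf pq f; split=> [f0|[f' <-]].
  have [b /pq[a <-]|f' f'E] := @dual_extend _ _ q f Bw Cw Cf.
    exact: (congr1 (fun f => dualv f a) f0).
  by exists f'; apply: dual_ext => b; exact: f'E.
apply: dual_ext => a; rewrite dualv0 -[LHS]/(dualv f' (q (p a))).
have -> : q (p a) = 0 by apply/pq; exists a.
exact: linear0.
Qed.

Lemma dual_map_surj (A B : gmod) (p : ghom A B) :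
  weight_module D A -> weight_module D B -> fdw D B -> injective p ->
  gsurj (gdual_map D s p).
Proof.
move=> Aw Bw Bf pi f; have [b b0|f' f'E] := @dual_extend _ _ p f Aw Bw Bf.
  have -> : b = 0 by apply: pi; rewrite b0 linear0.
  exact: linear0.
by exists f'; apply: dual_ext => b; exact: f'E.
Qed.

Lemma dual_map_inj (B C : gmod) (q : ghom B C) : gsurj q -> injective (gdual_map D s q).
Proof.
move=> qs f f' E; apply: dual_ext => c; have [b <-] := qs c.
exact: (congr1 (fun f => dualv f b) E).
Qed.
End Duals.

(** * Tensor products and truncation *)

Section Tensor.
Variables (K : numFieldType) (g : lieAlg K) (D : triangular g).
Notation h := (cartan D).
Notation wt := (weight (cartan D)).
Notation gmod := (gmod g).

Lemma tens_ind (V W : lmodType K) (P : tens V W -> Prop) : P 0 ->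
  (forall k u v, P u -> P v -> P (k *: u + v)) -> (forall v w, P (tpure v w)) ->
  forall u, P u.
Proof.
move=> P0 PD Pp u; have [S SP] := subcl_ex P0 PD; apply/SP/(qpi0 S).
have ql : linear (fun u => qpi S u : quotsp S) by move=> k x y; rewrite linearP.
have zl : linear (fun _ : tens V W => 0 : quotsp S).
  by move=> k x y; rewrite scaler0 addr0.
by apply: (tens_ext ql zl) => v w; apply/qpi0/SP.
Qed.

Lemma tpureZl (V W : lmodType K) k (v : V) (w : W) :
  tpure (k *: v) w = k *: tpure v w :> tens V W.
Proof.
have [tl _] := @tpure_bilin K V W; rewrite -[k *: v]addr0 tl.
by rewrite (linear_0 (tl w)) addr0.
Qed.
Lemma tpureZr (V W : lmodType K) k (v : V) (w : W) :
  tpure v (k *: w) = k *: tpure v w :> tens V W.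
Proof.
have [_ tr] := @tpure_bilin K V W; rewrite -[k *: w]addr0 tr.
by rewrite (linear_0 (tr v)) addr0.
Qed.

Lemma tpure0l (V W : lmodType K) (w : W) : tpure (0 : V) w = 0 :> tens V W.
Proof. exact: linear_0 ((@tpure_bilin K V W).1 w). Qed.
Lemma tpure0r (V W : lmodType K) (v : V) : tpure v (0 : W) = 0 :> tens V W.
Proof. exact: linear_0 ((@tpure_bilin K V W).2 v). Qed.

Lemma tpure_wspace (M N : gmod) (a b : wt) m n : wspace M a m -> wspace N b n ->
  wspace (gtens M N) (a + b) (tpure m n).
Proof.
move=> ma nb t.
have E : tens_act (vsval t) (tpure m n) = (a t + b t) *: tpure m n.
  by rewrite tens_actE ma nb (tpureZl (a t) m n) (tpureZr (b t) m n) -scalerDl.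
by rewrite add_lfunE; exact: E.
Qed.

Lemma tens_weight_module (M N : gmod) : weight_module D M -> weight_module D N ->
  weight_module D (gtens M N).
Proof.
move=> Mw Nw; apply: (tens_ind (P := fun u : gtens M N => exists2 s : seq (gtens M N),
  (forall v, v \in s -> exists a : wt, wspace _ a v) & u = \sum_(v <- s) v)).
- by exists [::]; rewrite ?big_nil.
- move=> k _ _ [s sw ->] [s' sw' ->]; exists ([seq k *: v | v <- s] ++ s').
    move=> v; rewrite mem_cat => /orP[/mapP[x /sw[a xa] ->]|/sw' //].
    by exists a; exact: (wspaceZ k xa).
  by rewrite big_cat big_map scaler_sumr.
move=> m n; have [s sw ->] := Mw m; have [s' sw' ->] := Nw n.
exists [seq tpure v w | v <- s, w <- s'].
  by move=> _ /allpairsP[[v w] /= [/sw[a va] /sw'[b wb] ->]]; exists (a + b); exact: tpure_wspace.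
rewrite big_allpairs_dep; have [tl tr] := @tpure_bilin K M N.
have tsl (I : seq M) w : tpure (\sum_(v <- I) v) w = \sum_(v <- I) tpure v w :> tens M N.
  elim: I => [|v I IH]; first by rewrite !big_nil tpure0l.
  by rewrite !big_cons -[v in v + _]scale1r tl scale1r IH.
have tsr v (I : seq N) : tpure v (\sum_(w <- I) w) = \sum_(w <- I) tpure v w :> tens M N.
  elim: I => [|w I IH]; first by rewrite !big_nil tpure0r.
  by rewrite !big_cons -[w in w + _]scale1r tr scale1r IH.
by rewrite tsl; apply: eq_bigr => v _; rewrite tsr.
Qed.

Lemma gtens_mapE (M N M' N' : gmod) (f : ghom M M') (f' : ghom N N') m n :
  gtens_map f f' (tpure m n) = tpure (f m) (f' n).
Proof. exact: tens_mapE. Qed.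

Lemma gtens_map_surj (M M' N : gmod) (f : ghom M M') :
  gsurj f -> gsurj (gtens_map f (idg N)).
Proof.
move=> fs; apply: tens_ind.
- by exists 0; rewrite linear0.
- by move=> k _ _ [u <-] [v <-]; exists (k *: u + v); rewrite linearP.
- by move=> m' n; have [m <-] := fs m'; exists (tpure m n); rewrite gtens_mapE.
Qed.

(** For a section s of f, sending (m', n) to the class of s(m') tensor n modulo the image I of the
    first map is bilinear. The induced map, composed with [gtens_map f], is the projection modulo I,
    so the kernel lies in I. *)
Lemma gtens_map_exact (L M M' N : gmod) (i : ghom L M) (f : ghom M M') :
  exact_at i f -> gsurj f -> exact_at (gtens_map i (idg N)) (gtens_map f (idg N)).
Proof.
move=> if0 /choice[s sP] u; split; last first.
  have cl : linear (fun v => gtens_map f (idg N) (gtens_map i (idg N) v)).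
    exact: (linear_comp (ghom_linear _) (ghom_linear _)).
  have zl : linear (fun _ : tens L N => 0 : tens M' N).
    by move=> k x y; rewrite scaler0 addr0.
  case=> v <-; apply: (tens_ext cl zl).
  move=> l n; have fi0 : f (i l) = 0 by apply/if0; exists l.
  rewrite (gtens_mapE i (idg N) l n) (gtens_mapE f (idg N) (i l) n) fi0.
  exact: tpure0l.
move=> u0; have [||I IP] := @subcl_ex K (tens M N) (fun u => exists v, gtens_map i (idg N) v = u).
- by exists 0; rewrite linear0.
- by move=> k _ _ [x <-] [y <-]; exists (k *: x + y); rewrite linearP.
apply/IP/(qpi0 I); have [tl tr] := @tpure_bilin K M N.
pose b (m' : M') (n : N) : quotsp I := qpi I (tpure (s m') n).
have bE m n : b (f m) n = qpi I (tpure m n).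
  apply/qpi_eq/IP; have /if0[l lE] : f (s (f m) - m) = 0 by rewrite linearB /= sP subrr.
  exists (tpure l n); rewrite gtens_mapE lE addrC -scaleN1r tl scaleN1r addrC.
  by rewrite /= addrC.
have bb : bilin b.
  split=> [n k x y|m k x y]; last by rewrite /b tr linearP.
  by rewrite -{1}(sP x) -{1}(sP y) -linearP bE tl linearP.
have ql : linear (fun u => qpi I u : quotsp I) by move=> k x y; rewrite linearP.
have E := tens_ext ql (linear_comp (tlift_linear bb) (@tens_map_linear _ _ _ _ _ _ f (idg N))).
rewrite E /=; first by rewrite -[tens_map _ _ u]/(gtens_map f (idg N) u) u0 (linear_0 (tlift_linear bb)).
by move=> m n; rewrite /= tens_mapE (tliftE bb) bE.
Qed.

Lemma trunc_proj_weight (a : wt) (M : gmod) : weight_module D M -> weight_module D (trunc a M).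
Proof. exact: weight_module_surj (@gproj_surj _ _ _ _). Qed.

Lemma trunc_mapE (a : wt) (M N : gmod) (f : ghom M N) m :
  trunc_map a f (gproj _ m) = gproj _ (f m).
Proof. exact: (quot_mapE (gen_submod_map (@nle_set_map K g D a M N f)) m). Qed.

Lemma trunc_map_surj (a : wt) (M N : gmod) (f : ghom M N) :
  gsurj f -> gsurj (trunc_map a f).
Proof.
move=> fs u; have [n <-] := gproj_surj u; have [m <-] := fs n.
by exists (gproj _ m); rewrite trunc_mapE.
Qed.

(** A vector of N of weight b lifts to M, and the lift may be projected to weight b; hence f maps
    the submodule divided out of M onto the one divided out of N. *)
Lemma trunc_map_exact (a : wt) (L M N : gmod) (i : ghom L M) (f : ghom M N) :
  weight_module D M -> weight_module D N -> exact_at i f -> gsurj f ->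
  exact_at (trunc_map a i) (trunc_map a f).
Proof.
move=> Mw Nw if0 fs u; have [m <-] := gproj_surj u; rewrite trunc_mapE; split.
  move=> /gproj0 fm; pose G := gen_submod (@nle_set _ _ D a M).
  have : f m \in img_submod f G.
    move/asboolP: fm; apply=> n [b ba nb]; apply/asboolP.
    have [m' m'n] := fs n; exists (wcomp b m'); last first.
      by rewrite (wcomp_map _ _ _ Mw Nw) m'n wcomp_id.
    by apply: sub_gen; exists b => //; exact: wcompw.
  move=> /asboolP[m' m'G fE]; have /if0[l lE] : f (m - m') = 0 by rewrite linearB /= fE subrr.
  exists (gproj _ l); rewrite trunc_mapE lE linearB.
  by rewrite -[X in _ - X]/(gproj G m') ((gproj0 G m').2 m'G) subr0.
case=> v; have [l <-] := gproj_surj v; rewrite trunc_mapE => /qpi_eq E.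
apply/gproj0; have : f (i l - m) \in gen_submod (@nle_set _ _ D a N).
  by apply: gen_submod_map E => x; exact: nle_set_map.
rewrite linearB /=; have -> : f (i l) = 0 by apply/if0; exists l.
by rewrite sub0r -scaleN1r => h; rewrite -[f m]opprK -scaleN1r rpredZ // -scaleN1r.
Qed.

Lemma opp_cartan t : t \in h -> opp_anti g t = -1 *: t.
Proof. by rewrite scaleN1r. Qed.
Let N1 : (-1 : K) * -1 = 1. Proof. by rewrite mulrNN mulr1. Qed.

(** For a weight generator v of N and f of weight b, the class of f tensor v vanishes unless -b is a
    weight of M above that of v. Hence finitely many weights b matter, each with a
    finite-dimensional weight space, and the corresponding pure tensors generate. *)
Lemma trunc_tens_inO (M N : gmod) : inO D M -> inO D N ->
  inO D (trunc (0 : wt) (gtens (mdual D M) N)).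
Proof.
move=> MO NO; have [Mw Nw] := (MO.1, NO.1); have [[r Mr] Mf] := inO_weights (@pnatr_eq0 K) MO.
have dw : weight_module D (mdual D M) := dual_weight_module N1 opp_cartan Mw.
split; first exact/trunc_proj_weight/tens_weight_module.
have [s [r' [sw sg]]] := inO_generators NO.
have [W [Wwt WP]] := fdw_spanning (dual_fdw N1 opp_cartan Mw Mf).
have /choice[om omP] v : exists a : wt, v \in s -> wspace N a v.
  case: (boolP (v \in s)) => [/sw[a _ va]|_]; last by exists 0.
  by exists a.
have /choice[Q QP] (d : wt) := bounded_interval (@pnatr_eq0 K) d Mr.
pose p := gproj (gen_submod (@nle_set _ _ D 0 (gtens (mdual D M) N))).
exists [seq p (tpure f v) | v <- s, f <- flatten [seq W (- b) | b <- Q (om v)]].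
move=> S Sn Sg u; have [t <-] := gproj_surj u; move: t.
have [T TP] := @submod_ex _ _ _ (fun=> True) I (fun _ _ _ _ _ => I) (fun _ _ _ => I) : exists T : submod N, _.
have pl k x y : p (k *: x + y) = k *: p x + p y by rewrite linearP.
suff good n : forall f, p (tpure f n) \in S.
  apply: tens_ind => //; first by rewrite -[gproj _ _]/(p 0) linear0 rpred0.
  by move=> k x y hx hy; rewrite -[gproj _ _]/(p _) pl rpredD ?rpredZ.
have [tl tr] := @tpure_bilin K (mdual D M) N.
have [||Gd GdP] := @subcl_ex K N (fun n => forall f, p (tpure f n) \in S).
- by move=> f; rewrite tpure0r linear0 rpred0.
- by move=> k x y hx hy f; rewrite tr pl rpredD ?rpredZ.
apply/GdP; apply: sg => [y m yn /GdP my|v vs]; apply/GdP => f.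
  (* By the Leibniz rule, f tensor y m = y (f tensor m) - (y f) tensor m, so the property passes
     from m to y m. *)
  have -> : tpure f (act y m) = act y (tpure f m : gtens (mdual D M) N) - tpure (act y f) m.
    by rewrite -[act y (tpure f m : gtens _ _)]/(tens_act y (tpure f m)) tens_actE addrAC subrr add0r.
  rewrite linearB; apply: submodB; last exact: my.
  by rewrite -[X in X \in _]/(p (act y (tpure f m : gtens _ _))) ghom_act; apply: Sn => //; exact: my.
have [Z ZP] : exists Z : submodClosed (mdual D M), forall f, f \in Z <-> p (tpure f v) \in S.
  apply: subcl_ex => [|k x y hx hy]; first by rewrite tpure0l linear0 rpred0.
  rewrite (etrans (congr1 p (tl v k x y)) (pl k (tpure x v) (tpure y v))).
  exact: (rpredD (rpredZ k hx) hy).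
have Z0 : 0 \in Z by exact: rpred0.
have ZD k x y : x \in Z -> y \in Z -> k *: x + y \in Z.
  by move=> hx hy; rewrite rpredD ?rpredZ.
apply/ZP; move: f; apply: (wt_ind dw Z0 ZD).
move=> b f fb; have [->|/eqP f0] := eqVneq f 0; first exact: Z0.
have vb := tpure_wspace fb (omP v vs).
have [le|nle] := pselect (wle (b + om v) 0); last first.
  apply/ZP; suff -> : p (tpure f v) = 0 by rewrite rpred0.
  by apply/gproj0/sub_gen; exists (b + om v).
have [m mb fm] := dual_wspace_neq0 N1 opp_cartan Mw fb f0; rewrite scaleN1r in mb.
have bQ : - b \in Q (om v).
  apply: (QP _ _ m mb) => [m0|]; first by rewrite m0 linear0 in fm.
  by have := wle_Qp le; rewrite sub0r opprD.
apply: inspan_sub (WP b f fb) => f' f'W; apply/ZP/Sg.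
apply/allpairsPdep; exists v, f'; split=> //; apply/flattenP; exists (W b) => //.
by apply/mapP; exists (- b) => //; rewrite opprK.
Qed.
End Tensor.

(** * Duality on O_0 *)

Lemma separate_rV (K : fieldType) n (S : submodClosed 'rV[K]_n) u : u \notin S ->
  exists2 k : 'cV[K]_n, (forall v, v \in S -> v *m k = 0) & u *m k != 0.
Proof.
move=> uS; have [U US] := vspace_of S.
pose A : 'M[K]_(\dim U, n) := \matrix_i (vbasis U)`_i.
have AU v : (v <= A)%MS -> v \in S.
  move=> /submxP[w ->]; rewrite -US mulmx_sum_row; apply: rpred_sum => i _.
  by rewrite rowK rpredZ // vbasis_mem // mem_nth ?size_tuple.
have UA v : v \in S -> (v <= A)%MS.
  rewrite -US => /coord_vbasis ->; apply: summx_sub => i _; apply: scalemx_sub.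
  by have := row_sub i A; rewrite rowK.
have : u *m cokermx A != 0 by rewrite -submxE; apply: contra uS; exact: AU.
move=> /matrix0Pn[i [j nz]]; exists (col j (cokermx A)) => [v /UA|].
  by rewrite submxE => /eqP vA; rewrite colE mulmxA vA mul0mx.
by apply/matrix0Pn; exists i, 0; rewrite colE mulmxA -colE mxE.
Qed.

Section Star.
Variables (K : numFieldType) (g : lieAlg K) (D : triangular g) (theta : chevalley D).
Notation h := (cartan D).
Notation wt := (weight (cartan D)).
Notation gmod := (gmod g).
Hypothesis control : forall M : gmod, inO D M -> exists P, @weight_control K g D M P.
Notation dual M := (gdual D theta M).
Let K0 := @pnatr_eq0 K.
Let e2 : (1 : K) * 1 = 1 := mulr1 1.
Let theta_cartan t : t \in h -> theta t = 1 *: t.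
Proof. by move=> th; rewrite scale1r chev_cartan. Qed.

(** Stability under [g] uses the surjectivity of [theta]: every x is some theta(y), and f(theta(y)
    m) = (y f)(m). *)
Lemma perp_ex (M : gmod) (T : submod (dual M)) : exists S : submod M,
  forall m, m \in S <-> forall f, f \in T -> dualv f m = 0.
Proof.
apply: submod_ex => [f _|k u v hu hv f fT|x m hm f fT]; first exact: linear0.
  by rewrite linearP /= hu // hv // scaler0 addr0.
have [y <-] : exists y, theta y = x.
  by have [th' _ thK] := chev_bij theta; exists (th' x); rewrite thK.
by rewrite -dualv_act; apply: hm; exact: submod_act.
Qed.

Lemma annih_ex (M : gmod) (S : submod M) : exists T : submod (dual M),
  forall f, f \in T <-> forall m, m \in S -> dualv f m = 0.
Proof.
apply: submod_ex => [m _|k u v hu hv m mS|x f hf m mS]; first exact: dualv0.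
  by rewrite dualv_lin hu // hv // mulr0 addr0.
by rewrite dualv_act; apply: hf; exact: submod_act.
Qed.

Section DoublePerp.
Variables (M : gmod) (Mw : weight_module D M) (Mf : fdw D M).

Lemma dual_separate0 (m : M) : m <> 0 -> exists f : dual M, dualv f m <> 0.
Proof.
move=> m0; have [||x u ->|Z ZP] := @submod_ex _ _ M (fun m => m = 0) => //.
- by move=> k u v -> ->; rewrite scaler0 addr0.
- by rewrite linear0.
have [|f _ fm] := @dual_separate _ _ _ theta M Z m Mw Mf; last by exists f.
by apply/negP => /ZP.
Qed.

(** The double perpendicular of T is T. It suffices to compare them at one weight, where spaces are
    finite-dimensional and [separate_rV] yields a vector killed by T but not by f. *)
Lemma dual_perp (T : submod (dual M)) f :
  (forall m, (forall f, f \in T -> dualv f m = 0) -> dualv f m = 0) -> f \in T.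
Proof.
have [S SP] := perp_ex T; have [T' T'P] := annih_ex S.
move=> fS; have {fS} : f \in T' by apply/T'P => m /SP/fS.
have dw : weight_module D (dual M) := dual_weight_module e2 theta_cartan Mw.
move: f; apply: (submod_weights dw) => a f fa /T'P fS.
have [F [Fw Fs]] := fdw_spanning Mf; pose W := F a.
pose phi (f : dual M) : 'rV[K]_(size W) := \row_i dualv f W`_i.
have [||U UP] := @subcl_ex K 'rV[K]_(size W)
    (fun u => exists f1, [/\ f1 \in T, wspace (dual M) a f1 & u = phi f1]).
- exists 0; rewrite rpred0; split=> //; first exact: wspace0.
  by apply/rowP => i; rewrite !mxE dualv0.
- move=> k _ _ [f1 [f1T f1a ->]] [f2 [f2T f2a ->]]; exists (k *: f1 + f2).
  split; [by rewrite rpredD ?rpredZ|exact: wspace_lin|].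
  by apply/rowP => i; rewrite !mxE dualv_lin.
have [/UP[f1 [f1T f1a E]]|/separate_rV[k kU kf]] := boolP (phi f \in U).
  suff -> : f = f1 by [].
  apply/eqP; rewrite -subr_eq0; apply/eqP; apply: contrapT => nz.
  have da : wspace (dual M) a (f - f1).
    by rewrite addrC -scaleN1r; apply: wspace_lin.
  have [m ma] := dual_wspace_neq0 e2 theta_cartan Mw da nz; rewrite scale1r in ma.
  have [u ->] := Fs a m ma; apply; rewrite linear_sum big1 // => i _.
  have /rowP/(_ i) := E; rewrite !mxE => E'.
  have E2 : dualv (f - f1) W`_i = 0.
    by apply: (etrans (y := dualv f W`_i - dualv f1 W`_i)); rewrite // E' subrr.
  by rewrite linearZ; apply: (etrans (congr1 (fun k : K^o => u 0 i *: k) E2)); exact: scaler0.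
(* The separating column [k] becomes a vector [x] of weight [a]: multiplication by [k] is evaluation
   at [x]. *)
case/eqP: kf; pose x := \sum_i k i 0 *: W`_i.
have phix f1 : phi f1 *m k = (dualv f1 x)%:M.
  apply/matrixP => i j; rewrite !ord1 !mxE eqxx mulr1n linear_sum; apply: eq_bigr => l _.
  by rewrite linearZ /= !mxE mulrC.
have xa : wspace M a x.
  have [A AP] := wspace_sub M a; apply/AP/rpred_sum => i _.
  by apply/rpredZ/AP/Fw/mem_nth.
have E1 (b : K) : b%:M = 0 :> 'M_1 -> b = 0.
  by move=> /matrixP/(_ 0 0); rewrite !mxE eqxx.
rewrite phix fS ?raddf0 //; apply/SP => f1 f1T.
have [r rE] := wsupp dw f1; rewrite (rE (undup r)) ?undup_uniq => [|//|b]; last by rewrite mem_undup.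
have dsum (I : seq wt) (Fb : wt -> dual M) : dualv (\sum_(b <- I) Fb b) x = \sum_(b <- I) dualv (Fb b) x.
  elim: I => [|b I IH]; first by rewrite !big_nil.
  by rewrite !big_cons -IH.
rewrite dsum big1 // => b _; have cT : wcomp b f1 \in T by exact: wcomp_submod.
have cw := wcompw dw b f1; have [ba|/eqP ba] := eqVneq a b.
  by apply: E1; rewrite -phix kU //; apply/UP; exists (wcomp b f1); rewrite ba.
by apply: (dual_wspace0 e2 theta_cartan cw xa); rewrite scale1r.
Qed.
End DoublePerp.

(** If T contains the weight spaces of the dual at [P], its perpendicular space has no nonzero
    vector of these weights; it is 0 by weight control, and T is everything by [dual_perp]. So
    [fg_criterion] applies with the list [P] of M. *)
Lemma star_inO (M : gmod) : inO D M -> inO D (dual M).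
Proof.
move=> MO; have Mw := MO.1; have [[r Mr] Mf] := inO_weights K0 MO; have [P MP] := control MO.
split; first exact: (dual_weight_module e2 theta_cartan).
apply: (@fg_criterion _ _ _ _ r P).
- move=> f a fa /(dual_wspace_neq0 e2 theta_cartan Mw fa)[m]; rewrite scale1r => ma fm.
  by apply: (Mr m) => // m0; apply: fm; rewrite m0 linear0.
- exact: (dual_fdw e2 theta_cartan).
move=> T PT f; apply: (dual_perp Mw Mf) => m mT.
suff -> : m = 0 by rewrite linear0.
have [S SP] := perp_ex T.
have [||x u ->|Z ZP] := @submod_ex _ _ M (fun m => m = 0) => //.
- by move=> k u v -> ->; rewrite scaler0 addr0.
- by rewrite linear0.
have ZS : {subset Z <= S} by move=> _ /ZP ->; exact: rpred0.
apply/ZP; apply: (MP Z S ZS); last exact/SP.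
move=> a x aP xa /SP xT; apply/ZP; apply: contrapT => x0.
have [f0 f0x] := dual_separate0 Mw Mf x0.
have [f' f'a f'E] := dual_comp e2 theta_cartan a f0 Mw.
have := xT f' (PT a f' aP f'a); rewrite f'E scale1r (wcomp_id Mw xa).
exact: f0x.
Qed.

Lemma star_simple (Q : gmod) : inO D Q -> gsimple Q -> gsimple (dual Q).
Proof.
move=> QO [[q q0] Qs]; have Qw := QO.1; have [_ Qf] := inO_weights K0 QO; split.
  have [f fq] := dual_separate0 Qw Qf (elimN eqP q0); exists f.
  by apply/eqP => f0; rewrite f0 dualv0 in fq.
move=> T; have [S SP] := perp_ex T; have [S0|S1] := Qs S; [right|left] => f.
  by apply: (dual_perp Qw Qf) => m /SP/S0 ->; exact: linear0.
by move=> fT; apply: dual_ext => m; rewrite dualv0; exact: (SP m).1.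
Qed.

(** Let I be the image of a section of the dual of i, and T its perpendicular space. T meets i(L)
    trivially, so p is injective on T. If p is nonzero on T, it is an isomorphism onto L' and E
    splits. Otherwise T = 0 and I is the whole dual, although the nonzero image of the dual of p
    meets I only in 0. *)
Lemma star_nonsplit (L L' : gmod) : inO D L -> inO D L' -> gsimple L -> gsimple L' ->
  nonsplit_ext D L L' -> nonsplit_ext D (dual L') (dual L).
Proof.
move=> LO LO' Ls Ls' [E [i [p [EO ii ip ps ns]]]].
have [Lw Ew] := (LO.1, EO.1); have Lw' := LO'.1.
have [_ Lf] := inO_weights K0 LO; have [_ Ef] := inO_weights K0 EO.
have [_ Lf'] := inO_weights K0 LO'.
exists (dual E), (gdual_map D theta p), (gdual_map D theta i); split.
- exact: star_inO.
- exact: dual_map_inj.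
- exact: dual_map_exact.
- exact: dual_map_surj.
case=> s sP; apply: ns.
have [||x u [v <-]|I IP] := @submod_ex _ _ (dual E) (fun f => exists u, s u = f).
- by exists 0; rewrite linear0.
- by move=> k _ _ [u <-] [v <-]; exists (k *: u + v); rewrite linearP.
- by exists (act x v); rewrite ghom_act.
have [T TP] := perp_ex I.
have Tker l : i l \in T -> l = 0.
  move=> /TP lT; apply: contrapT => l0; have [f fl] := dual_separate0 Lw Lf l0.
  apply: fl; rewrite -[in LHS](sP f); apply: (lT (s f)); apply/IP; by exists f.
pose q := compg p (gincl T).
have qi : injective q.
  move=> u v uv; apply/eqP; rewrite -subr_eq0; apply/eqP.
  have : q (u - v) = 0 by rewrite linearB; apply/eqP; rewrite subr_eq0; apply/eqP.
  move=> /ip[l lE]; have lT : i l \in T by rewrite lE; exact: (valP (u - v)).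
  apply: val_inj; rewrite -[LHS]lE (Tker l lT); exact: linear0.
have [[t qt]|nq] := pselect (exists t, q t <> 0).
  have [r rK] : exists r : ghom L' (gsub T), forall v, q (r v) = v.
    have qs := gsimple_surj Ls' qt.
    have [t0 q0|r rE] := @ghom_factor _ _ _ _ _ q (idg _) qs.
      by apply: qi; rewrite q0 linear0.
    by exists r => v; have [w <-] := qs v; rewrite rE.
  by exists (compg (gincl T) r) => u; exact: rK.
have [[f0 f00] _] := star_simple LO' Ls'; case/eqP: f00.
apply: (dual_map_inj (s := theta) (D := D) ps); rewrite linear0.
have T0 m : m \in T -> m = 0.
  move=> mT; apply: (congr1 val (x := Subsp mT : gsub T) (y := 0)).
  apply: qi; rewrite linear0; apply: contrapT => nz; apply: nq; by exists (Subsp mT).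
have /IP[u uE] : gdual_map D theta p f0 \in I.
  by apply: (dual_perp Ew Ef) => m /TP/T0 ->; exact: linear0.
rewrite -uE; suff -> : u = 0 by rewrite linear0.
rewrite -(sP u) uE; apply: (dual_map_exact (s := theta) Ew Lw' Lf' ip _).2; by exists f0.
Qed.

Lemma star_giso (L L' : gmod) : inO D L -> inO D L' -> giso L L' -> giso (dual L') (dual L).
Proof.
move=> LO LO' [f [f' fK f'K]].
have fs : gsurj f by move=> n; exists (f' n).
have fi : injective f by exact: can_inj fK.
apply: (giso_bij (f := gdual_map D theta f)); first exact: dual_map_inj.
by apply: dual_map_surj => //; [exact: LO.1|exact: LO'.1|exact: (inO_weights K0 LO').2].
Qed.

Lemma star_linked (L L' : gmod) : linked D L L' -> linked D (dual L) (dual L').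
Proof.
elim=> {L L'} [L L' [LO Ls LO' Ls' LL']|L|L L' _ IH|L1 L2 L3 _ IH1 _ IH2].
- apply/rst_sym/rst_step; split; rewrite ?star_inO ?star_simple //; try exact: star_inO; try exact: star_simple.
  by case: LL' => [/(star_giso LO LO')|/(star_nonsplit LO LO' Ls Ls')]; [left|right].
- exact: rst_refl.
- exact: rst_sym.
- exact: rst_trans IH1 IH2.
Qed.
End Star.

(** * Composition factors of the star dual *)

Section StarBlock.
Variables (K : numFieldType) (g : lieAlg K) (D : triangular g) (theta : chevalley D).
Notation h := (cartan D).
Notation wt := (weight (cartan D)).
Notation gmod := (gmod g).
Hypothesis control : forall M : gmod, inO D M -> exists P, @weight_control K g D M P.
Notation dual M := (gdual D theta M).
Let K0 := @pnatr_eq0 K.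

Lemma gtriv_wspace (m : gtriv g) : wspace (gtriv g) (0 : wt) m.
Proof. by move=> t; rewrite lfunE scale0r. Qed.

Lemma gtriv_inO : inO D (gtriv g).
Proof.
split=> [m|].
  exists [:: m]; last by rewrite big_seq1.
  by move=> v _; exists 0; exact: gtriv_wspace.
exists [:: (1 : K^o)] => S _ S1 m.
by rewrite -[m]mulr1; apply: rpredZ; apply: S1; rewrite mem_head.
Qed.

Lemma gtriv_simple : gsimple (gtriv g).
Proof.
split; first by exists (1 : K^o); exact: oner_neq0.
move=> S; have [[s [sS s0]]|nex] := pselect (exists s : gtriv g, s \in S /\ s <> 0).
  right=> m; have -> : m = ((m : K) / s) *: s.
    by rewrite -[RHS]/((m : K) / s * s) divfK //; exact/eqP.
  exact: rpredZ.
by left=> m mS; apply: contrapT => m0; apply: nex; exists m.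
Qed.

Lemma gtriv_star : giso (gtriv g) (dual (gtriv g)).
Proof.
have /choice[F FP] (k : K) : exists f : dual (gtriv g), forall m, dualv f m = k * m.
  apply: (@dual_mk _ _ D theta (gtriv g) (fun m => k * m) [:: 0]).
    by move=> c u v; rewrite mulrDr mulrCA.
  move=> a; rewrite inE => a0 m ma; have [t at0] : exists t, a t <> 0.
    apply: contrapT => nt; case/eqP: a0; apply/lfunP => t; rewrite lfunE.
    by apply: contrapT => ?; apply: nt; exists t.
  have := ma t; rewrite -[LHS]/(0 : K) => /esym/eqP.
  by rewrite -[_ *: _]/(a t * m) mulf_eq0 => /orP[/eqP//|/eqP ->]; rewrite mulr0.
have Fl : linear (F : gtriv g -> dual (gtriv g)).
  by move=> c u v; apply: dual_ext => m; rewrite dualv_lin !FP mulrDl mulrA.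
have Fa x m : F (act x (m : gtriv g)) = act x (F m).
  by apply: dual_ext => k; rewrite dualv_act !FP mul0r -[act _ k]/(0 : K) mulr0.
apply: (@gsimple_bij _ _ _ _ (Ghom (M := gtriv g) Fl Fa) (1 : K^o)).
- exact: gtriv_simple.
- exact: (star_simple theta gtriv_inO gtriv_simple).
move=> /(congr1 (fun f : dual (gtriv g) => dualv f (1 : K^o))).
by rewrite FP mulr1; apply/eqP; exact: oner_neq0.
Qed.

(* For S0 <= S in the dual of X with S / S0 = L, the perpendicular spaces B of S0
   and A of S satisfy B / A simple, and L is isomorphic to the dual of B / A. *)
Lemma star_comp_factor (X L : gmod) : inO D X -> comp_factor L (dual X) ->
  exists Q, comp_factor Q X /\ giso L (dual Q).
Proof.
move=> XO [Ls [S [phi phis]]]; have Xw := XO.1; have [_ Xf] := inO_weights K0 XO.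
have [||x _ [s <- ps]|S0 S0P] := @submod_ex _ _ (dual X) (fun f =>
    exists2 s : gsub S, val s = f & phi s = 0).
- by exists 0 => //; rewrite linear0.
- move=> k _ _ [s <- ps] [t <- pt]; exists (k *: s + t) => //.
  by rewrite linearP /= ps pt scaler0 addr0.
- by exists (act x s) => //; rewrite ghom_act ps linear0.
have S0S : {subset S0 <= S} by move=> _ /S0P[s <- _]; exact: valP.
have [A AP] := perp_ex S; have [B BP] := perp_ex S0.
have AB : {subset A <= B} by move=> m /AP mS; apply/BP => f /S0S/mS.
have S0perp f : (forall m, m \in B -> dualv f m = 0) -> f \in S0.
  by move=> fB; apply: (dual_perp Xw Xf) => m /BP; exact: fB.
have Sperp f : (forall m, m \in A -> dualv f m = 0) -> f \in S.
  by move=> fA; apply: (dual_perp Xw Xf) => m /AP; exact: fA.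
have S0phi (s : gsub S) : val s \in S0 -> phi s = 0.
  by move=> /S0P[t /val_inj ->].
have [[l0 l00] Lsub] := Ls; have [s0 s0E] := phis l0.
have nS0 : phi s0 <> 0 by rewrite s0E; exact/eqP.
pose Q := gsubquot A B; pose pr := gsubquot_proj A B.
have Qs : gsimple Q.
  split.
    apply: contrapT => Q0; apply: nS0; apply/S0phi/S0perp => m mB.
    have /AP : m \in A; last by apply; exact: valP.
    apply: (gsubquot0 A (Subsp mB : gsub B)).1; apply: contrapT => /eqP nz.
    by apply: Q0; exists (pr (Subsp mB)).
  move=> T; have [||x _ [t <- tT]|T' T'P] := @submod_ex _ _ X (fun m =>
      exists2 t : gsub B, val t = m & pr t \in T).
  - by exists 0 => //; rewrite linear0 rpred0.
  - by move=> k _ _ [u <- uT] [v <- vT]; exists (k *: u + v); rewrite ?linearP ?rpredD ?rpredZ.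
  - by exists (act x t); rewrite ?ghom_act ?submod_act.
  (* The functionals of S vanishing on the preimage T' of T have an image under phi that is 0 or L;
     accordingly T is everything or 0. *)
  have [N NP] := annih_ex theta T'.
  have S0N f : f \in S0 -> f \in N.
    by move=> fS0; apply/NP => _ /T'P[t <- _]; exact: (BP (val t)).1 (valP t) f fS0.
  have [||x _ [s sN <-]|V VP] := @submod_ex _ _ L (fun l =>
      exists2 s : gsub S, val s \in N & phi s = l).
  - by exists 0; rewrite ?linear0 ?rpred0.
  - move=> k _ _ [s sN <-] [t tN <-]; exists (k *: s + t); last by rewrite linearP.
    exact: (rpredD (rpredZ k sN) tN).
  - by exists (act x s); rewrite ?ghom_act //; exact: (submod_act x sN).
  have [V0|V1] := Lsub V; [right|left] => q; have [b <-] := gsubquot_surj q.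
    suff /T'P[t /val_inj ->] : val b \in T' by [].
    apply/negPn/negP => bT; have [f fT fb] := dual_separate theta Xw Xf bT.
    apply: fb; have fN : f \in N by apply/NP.
    have fS : f \in S.
      apply: Sperp => m mA; apply: fT; apply/T'P; exists (Subsp (AB m mA)) => //.
      by rewrite /pr ((gsubquot0 A (Subsp (AB m mA) : gsub B)).2 mA) rpred0.
    apply: ((BP (val b)).1 (valP b) f _); apply/S0P; exists (Subsp fS) => //.
    by apply/V0/VP; exists (Subsp fS).
  move=> bT; apply/gsubquot0/AP => f fS.
  have /VP[s sN sE] := V1 (phi (Subsp fS)).
  have : f - val s \in S0.
    apply/S0P; exists (Subsp fS - s) => //; rewrite linearB; apply/eqP.
    by rewrite subr_eq0; apply/eqP/esym.
  move=> /S0N h; have /NP : f \in N by rewrite -(subrK (val s) f) rpredD.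
  by apply; apply/T'P; exists b.
(* The map psi below restricts a functional in S to B, where it vanishes on A. It factors through
   phi because the kernel S0 of phi vanishes on B. *)
exists Q; split; first by split=> //; exists B, pr; exact: gsubquot_surj.
have /choice[psi psiP] (s : gsub S) : exists f : dual Q, forall b, dualv f (pr b) = dualv (gincl S s) (gincl B b).
  have QO : inO D Q := inO_subquot control A B XO.
  have BO : inO D (gsub B) := inO_sub control B XO.
  have [b /gsubquot0/AP bA|f fE] := @dual_extend _ _ D theta _ _ pr (gdual_map D theta (gincl B) (val s))
    BO.1 QO.1 (inO_weights K0 QO).2; last by exists f.
  by apply: (bA (val s)); exact: valP.
have prs : gsurj pr := @gsubquot_surj _ _ _ A B.
have dext (f f' : dual Q) : (forall b, dualv f (pr b) = dualv f' (pr b)) -> f = f'.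
  by move=> E; apply: dual_ext => q; have [b <-] := prs q.
have psil : linear psi.
  move=> k s t; apply: dext => b; apply: (etrans (psiP _ b)).
  apply: (etrans _ (esym (dualv_lin k (psi s) (psi t) (pr b)))).
  apply: (etrans (congr1 (fun f : dual X => dualv f (gincl B b)) (ghom_linear (gincl S) k s t))).
  apply: (etrans (dualv_lin k (gincl S s) (gincl S t) (gincl B b))).
  exact: (congr2 (fun x y : K => k * x + y) (esym (psiP s b)) (esym (psiP t b))).
have psia x s : psi (act x s) = act x (psi s).
  apply: dext => b; apply: (etrans (psiP _ b)).
  rewrite dualv_act -ghom_act; apply: (etrans _ (esym (psiP s _))).
  by rewrite !ghom_act dualv_act.
have [s ps|l lE] := @ghom_factor _ _ _ _ _ phi (Ghom psil psia) phis.
  apply: dext => b; rewrite psiP dualv0; apply: ((BP (val b)).1 (valP b) _ _).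
  by apply/S0P; exists s.
apply: (gsimple_bij (f := l) (l := phi s0)) => //.
  exact: (star_simple theta (inO_subquot control A B XO)).
rewrite lE /= => E; apply/nS0/S0phi/S0perp => m mB.
by have := psiP s0 (Subsp mB); rewrite E dualv0 => <-.
Qed.

(** The factors of the dual are duals of those of X by [star_comp_factor]; duality preserves
    linkage, and the trivial module is self-dual. *)
Lemma star_inO0 (X : gmod) : inO0 D X -> inO0 D (dual X).
Proof.
move=> [XO XL]; split=> [|L LX]; first exact: star_inO.
have [Q [QX LQ]] := star_comp_factor XO LX.
have QO : inO D Q.
  have [_ [S [f fs]]] := QX; apply: inO_surj fs _; exact: inO_sub.
have Ls := LX.1; have Qs := QX.1.
have QOd := star_inO theta control QO; have Qsd := star_simple theta QO Qs.
have LO : inO D L.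
  by have [f [f' fK f'K]] := giso_sym LQ; apply: (inO_surj (f := f)) QOd => v; exists (f' v).
have tO := star_inO theta control gtriv_inO.
have ts := star_simple theta gtriv_inO gtriv_simple.
apply: (rst_trans _ _ _ (dual (gtriv g))).
  apply: rst_step; split=> //; [exact: gtriv_inO|exact: gtriv_simple|].
  by left; exact: gtriv_star.
apply: (rst_trans _ _ _ (dual Q) _ (star_linked theta control (XL Q QX))).
by apply/rst_sym/rst_step; split=> //; left.
Qed.
End StarBlock.

(** * Exactness of F and H *)

Section Functors.
Variables (K : numFieldType) (g : lieAlg K) (D : triangular g) (theta : chevalley D).
Notation wt := (weight (cartan D)).
Notation gmod := (gmod g).
Hypothesis control : forall M : gmod, inO D M -> exists P, @weight_control K g D M P.
Let K0 := @pnatr_eq0 K.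
Let N1 : (-1 : K) * -1 = 1. Proof. by rewrite mulrNN mulr1. Qed.

Lemma compg_idl (M N : gmod) (f : ghom M N) : compg (idg N) f = f.
Proof. exact: ghom_ext. Qed.
Lemma compg_idr (M N : gmod) (f : ghom M N) : compg f (idg M) = f.
Proof. exact: ghom_ext. Qed.

Lemma gdual_map_id s (M : gmod) : gdual_map D s (idg M) = idg (gdual D s M).
Proof. by apply: ghom_ext => f; apply: dual_ext. Qed.
Lemma gdual_map_comp s (M N P : gmod) (f : ghom N P) (f' : ghom M N) :
  gdual_map D s (compg f f') = compg (gdual_map D s f') (gdual_map D s f).
Proof. by apply: ghom_ext => u; apply: dual_ext. Qed.

Lemma gtens_map_id (M N : gmod) : gtens_map (idg M) (idg N) = idg (gtens M N).
Proof.
apply: ghom_ext; have l1 := ghom_linear (gtens_map (idg M) (idg N)).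
have l2 := ghom_linear (idg (gtens M N)).
by apply: (tens_ext l1 l2) => m n; exact: gtens_mapE.
Qed.

Lemma gtens_map_comp (M M' M'' N N' N'' : gmod) (f : ghom M' M'') (f' : ghom M M')
    (k : ghom N' N'') (k' : ghom N N') :
  gtens_map (compg f f') (compg k k') = compg (gtens_map f k) (gtens_map f' k').
Proof.
apply: ghom_ext; have l1 := ghom_linear (gtens_map (compg f f') (compg k k')).
have l2 := ghom_linear (compg (gtens_map f k) (gtens_map f' k')).
apply: (tens_ext l1 l2) => m n.
apply: (etrans (gtens_mapE _ _ m n)); apply: esym.
exact: (etrans (congr1 (gtens_map f k) (gtens_mapE f' k' m n)) (gtens_mapE f k _ _)).
Qed.

Lemma trunc_map_id (a : wt) (M : gmod) : trunc_map a (idg M) = idg (trunc a M).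
Proof. by apply: ghom_ext => u; have [m <-] := gproj_surj u; rewrite trunc_mapE. Qed.

Lemma trunc_map_comp (a : wt) (M N P : gmod) (f : ghom N P) (f' : ghom M N) :
  trunc_map a (compg f f') = compg (trunc_map a f) (trunc_map a f').
Proof.
apply: ghom_ext => u; have [m <-] := gproj_surj u.
by rewrite trunc_mapE -[RHS]/(trunc_map a f (trunc_map a f' (gproj _ m))) !trunc_mapE.
Qed.

Lemma block0_map_id (M : gmod) : block0_map D (idg M) = idg (block0 D M).
Proof. by apply: ghom_ext => u; apply: val_inj. Qed.

Lemma block0_map_comp (M N P : gmod) (f : ghom N P) (f' : ghom M N) :
  block0_map D (compg f f') = compg (block0_map D f) (block0_map D f').
Proof. by apply: ghom_ext => u; apply: val_inj. Qed.

(** The bifunctor behind F: [F_mor] and [F_nat] are its values on pairs with one identity, so that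
    functoriality and naturality both reduce to [trunc_tens_map_comp]. *)
Definition trunc_tens_map (M M' N N' : gmod) (f : ghom M M') (k : ghom N N') :=
  block0_map D (trunc_map (0 : wt) (gtens_map f k)).

Lemma trunc_tens_map_id (M N : gmod) : trunc_tens_map (idg M) (idg N) = idg _.
Proof. by rewrite /trunc_tens_map gtens_map_id trunc_map_id block0_map_id. Qed.

Lemma trunc_tens_map_comp (M M' M'' N N' N'' : gmod) (f : ghom M' M'') (f' : ghom M M')
    (k : ghom N' N'') (k' : ghom N N') :
  compg (trunc_tens_map f k) (trunc_tens_map f' k') =
  trunc_tens_map (compg f f') (compg k k').
Proof.
by rewrite /trunc_tens_map gtens_map_comp trunc_map_comp block0_map_comp.
Qed.

Lemma F_morE M (N N' : gmod) (f : ghom N N') :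
  F_mor D M f = trunc_tens_map (idg (mdual D M)) f.
Proof. by []. Qed.
Lemma F_natE (M M' : gmod) (p : ghom M M') N :
  F_nat D p N = trunc_tens_map (mdual_map D p) (idg N).
Proof. by []. Qed.

Lemma F_ob_inO0 (M N : gmod) : inO D M -> inO D N -> inO0 D (F_ob D M N).
Proof. by move=> MO NO; apply: (block0_inO0 control); exact: trunc_tens_inO. Qed.

Lemma F_functor : is_contravariant_functor D (F_data D).
Proof.
split=> [M M0|M M' M0 M0' p|M M0 N N0|M M' M'' M0 M0' M0'' p q N N0] /=.
- split=> [N N0|N N0|N N' N'' N0 N0' N0'' f f'].
  + exact: F_ob_inO0 M0.1 N0.1.
  + by rewrite F_morE trunc_tens_map_id.
  by rewrite !F_morE trunc_tens_map_comp compg_idl.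
- move=> N N' N0 N0' f; rewrite !F_natE !F_morE !trunc_tens_map_comp.
  by rewrite !compg_idl !compg_idr.
- by rewrite F_natE /mdual_map gdual_map_id trunc_tens_map_id.
by rewrite !F_natE trunc_tens_map_comp compg_idl /mdual_map gdual_map_comp.
Qed.

(** Dualizing turns the injection p into a surjection and keeps exactness in the middle; tensoring,
    truncating and projecting to the block each preserve this pair of properties. *)
Lemma F_right_exact : right_exact D (F_data D).
Proof.
move=> A B C A0 B0 C0 p q pi pq N N0 /=.
have [[AO BO] CO] := (A0.1, B0.1, C0.1); have NO := N0.1.
have dw M : inO D M -> weight_module D (gtens (mdual D M) N).
  move=> MO; apply: tens_weight_module NO.1.
  exact: (dual_weight_module N1 (@opp_cartan _ _ D) MO.1).
have ex : exact_at (mdual_map D q) (mdual_map D p).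
  exact: (dual_map_exact BO.1 CO.1 (inO_weights K0 CO).2 pq).
have su : gsurj (mdual_map D p).
  exact: (dual_map_surj AO.1 BO.1 (inO_weights K0 BO).2 pi).
have tsu := gtens_map_surj (N := N) su.
have tex := gtens_map_exact (N := N) ex su.
split.
  apply: (block0_map_exact control); try exact: trunc_tens_inO.
  exact: (trunc_map_exact (dw B BO) (dw A AO) tex tsu).
apply: (block0_map_surj control); try exact: trunc_tens_inO.
exact: trunc_map_surj.
Qed.

Lemma H_functor : is_contravariant_functor D (H_data theta).
Proof.
have star0 := star_inO0 theta control.
have Fob := contra_endofunctor F_functor.
split=> [M M0|M M' M0 M0' p|M M0 N N0|M M' M'' M0 M0' M0'' p q N N0] /=.
- have [ob id comp] := Fob _ (star0 _ M0).
  split=> [N N0|N N0|N N' N'' N0 N0' N0'' f f']; rewrite /H_mor /star_map.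
  + exact/star0/ob/star0.
  + rewrite gdual_map_id -[F_mor _ _ _]/(cmor (F_data D) _ _) (id _ (star0 _ N0)).
    exact: gdual_map_id.
  (* The star on the argument and the star on the value each reverse the composition, so the order
     is restored. *)
  rewrite gdual_map_comp -[RHS]gdual_map_comp; apply: (congr1 (@gdual_map K g D theta _ _)).
  exact: (comp _ _ _ (star0 _ N0'') (star0 _ N0') (star0 _ N0)).
- move=> N N' N0 N0' f; rewrite /H_nat /H_mor /star_map -!gdual_map_comp.
  apply/(congr1 (@gdual_map K g D theta _ _))/esym.
  exact: (contra_natural F_functor (star0 _ M0') (star0 _ M0) _ (star0 _ N0') (star0 _ N0)).
- rewrite /H_nat /star_map gdual_map_id.
  rewrite -[F_nat _ _ _]/(cnat (F_data D) _ _) (contra_id F_functor (star0 _ M0) (star0 _ N0)).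
  exact: gdual_map_id.
rewrite /H_nat /star_map -gdual_map_comp gdual_map_comp.
apply: (congr1 (@gdual_map K g D theta _ _)).
exact: (contra_comp F_functor (star0 _ M0'') (star0 _ M0') (star0 _ M0) _ _ (star0 _ N0)).
Qed.

Lemma H_left_exact : left_exact D (H_data theta).
Proof.
move=> A B C A0 B0 C0 p q pq qs N N0 /=.
have star0 := star_inO0 theta control.
have FO M : inO0 D M -> inO D (F_ob D (gdual D theta M) (gdual D theta N)).
  by move=> M0; apply: (F_ob_inO0 _ _).1; [exact: (star0 _ M0).1|exact: (star0 _ N0).1].
have ex : exact_at (gdual_map D theta q) (gdual_map D theta p).
  exact: (dual_map_exact B0.1.1 C0.1.1 (inO_weights K0 C0.1).2 pq).
have qi : injective (gdual_map D theta q) := dual_map_inj qs.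
have [Fex Fsu] := F_right_exact (star0 _ C0) (star0 _ B0) (star0 _ A0) qi ex (star0 _ N0).
split; first exact: (dual_map_inj Fsu).
exact: (dual_map_exact (FO _ B0).1 (FO _ C0).1 (inO_weights K0 (FO _ C0)).2 Fex).
Qed.
End Functors.

(** The order of R[i] is only partial, but norms are real, so the bound comes from [Num.bound] in
    R. *)
Lemma complex_archimedean (R : realType) (x : R[i]) : exists m : nat, `|x| <= m%:R.
Proof.
case: x => a b; rewrite normc_def /=.
set r := Num.sqrt _; exists (Num.bound r).
rewrite -(rmorph_nat (real_complex R)) lecR ltW //.
by rewrite archi_boundP // sqrtr_ge0.
Qed.

Theorem corollary3p5 (R : realType) (g : lieAlg R[i]) (g_ss : semisimple g)
    (D : triangular g) (theta : chevalley D) :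
  [/\ is_contravariant_functor D (F_data D),
      is_contravariant_functor D (H_data theta),
      right_exact D (F_data D) &
      left_exact D (H_data theta)].
Proof.
have [Om [c [Om_map Om_sing Om_fin]]] :=
  casimir_ex theta g_ss (@complex_archimedean R).
have control := inO_control Om_map Om_sing Om_fin.
split; [exact: F_functor|exact: H_functor|exact: F_right_exact|exact: H_left_exact].
Qed.
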